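(* Let $R$ be a domestic string algebra over an algebraically closed field $K$, and let $U$ be the set of infinite-dimensional string modules in the Ziegler spectrum ${}_R\mathrm{Zg}$, with the subspace topology. All modules considered below are points of $U$, and ''open'' means open in $U$. (1) Let $w={}^\infty b_0\,c\,b^\infty$ be a $2$-sided (non-periodic) string, with $b_0,b$ bands and $c$ a finite string. For each $n$ denote by $w_n$ the image substring $b_0^{\,n}\,c\,b^n$ of $w$, and let $U_n$ be the set of string modules $C(y)$ such that $y$ contains $w_n$ as an image substring. Then the sets $U_n$ form a basis of open neighbourhoods of $C(w)$. (2) Similarly, let $w=cb^\infty$ with $b$ a band and $c$ a finite string. For each $n$ let $w_n=cb^n$, and let $U_n$ be the set of $1$-sided string modules $C(y)$ such that $y$ contains $w_n$ as an initial image substring. Then the sets $U_n$ form a basis of open neighbourhoods of $C(w)$.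
   Context: String algebras. $K$ is algebraically closed; a string algebra is a finite-dimensional algebra $R=KQ/I$ ($Q$ a finite quiver) such that every vertex has at most two incoming and at most two outgoing arrows; for every arrow $\alpha$ there is at most one arrow $\beta$ with $\beta\alpha\neq 0$ and at most one arrow $\gamma$ with $\alpha\gamma\ne 0$ in $R$; and $I$ can be generated by monomials. Paths are composed right to left; modules are left modules. Strings and bands. A letter is an arrow $\alpha$ (direct letter: left end = target, right end = source) or a formal inverse $\alpha^{-1}$ (inverse letter: left end = source, right end = target). A string is a word of letters in which the right end of each letter equals the left end of the next, with no subword $\alpha\alpha^{-1}$ or $\alpha^{-1}\alpha$, and with no finite subword or inverse of a finite subword being a path in $I$ (also strings of length $0$ at each vertex). Strings may be finite, $1$-sided infinite, or $2$-sided infinite. A band is a finite string $b$ of positive length such that every power of $b$ is a string, $b$ is not a proper power of a string, and its first letter is direct and last letter inverse. $R$ is domestic if it has only finitely many bands. Non-periodic means not of the form ${}^\infty b^\infty$ for a band $b$; only non-periodic $2$-sided strings have an associated module $C(w)$. Image substrings. An occurrence of a substring $v$ in a string $y$ makes $v$ an image substring of $y$ if it is closed under successors: the letter of $y$ immediately to the left of $v$ (if any) is an inverse letter and the letter of $y$ immediately to the right of $v$ (if any) is a direct letter (so the adjacent arrows point towards $v$). It is initial if $y=vy'$ for some $y'$. String modules. For a string $w$, $M(w)$ has a $K$-basis $(z_i)$ indexed by the successive vertices visited by the walk $w$, where for each letter of $w$ linking positions $i-1$ and $i$ the underlying arrow sends $z_i\mapsto z_{i-1}$ if the letter is direct and $z_{i-1}\mapsto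 z_i$ if it is inverse; vertex idempotents act as projections onto the spans of the $z_i$ at that vertex; arrows act as zero otherwise. $M(w)\cong M(w^{-1})$; correspondingly $C(y)\cong C(y^{-1})$. On a side (say right) on which $w$ is infinite, write $w=y(b')^\infty$ with $b'$ primitive and $y$ (finite or left-infinite) either empty or with last letter different from the last letter of $b'$; $w$ is expanding on the right if the last letter of $b'$ is inverse, contracting on the right if it is direct; similarly on the left via $w^{-1}$. $C(w)$ is the module of all families $(a_i)_i\in\prod_iKz_i$ with only finitely many nonzero coordinates on each infinite side on which $w$ is contracting (no restriction on expanding sides), with $R$-action extending that of $M(w)$; for finite $w$, $C(w)=M(w)$. These are indecomposable pure-injective. The string modules are the modules $C(w)$ with $w$ a finite, $1$-sided infinite, or non-periodic $2$-sided infinite string; the infinite-dimensional ones are those with $w$ infinite, and a $1$-sided string module is a $C(w)$ with $w$ a $1$-sided infinite string. Ziegler spectrum. ${}_R\mathrm{Zg}$ is the topological space whose points are the isomorphism classes of indecomposable pure-injective left $R$-modules, with basis of open sets $(f)=\{N:\ \text{some morphism } A\to N \text{ does not factor through } f\}$, for $f:A\to B$ a morphism between finite-dimensional modules. *)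

(* Defs.v *)
From HB Require Import structures.
From mathcomp Require Import all_boot all_order all_algebra.
From mathcomp Require Import boolp functions.
From mathcomp Require Import zify.
Set Implicit Arguments.
Unset Strict Implicit.
Unset Printing Implicit Defensive.
Import Order.TTheory GRing.Theory Num.Theory.
Local Open Scope ring_scope.

Record quiver := Quiver {
  vertex : finType;
  arrow : finType;
  src : arrow -> vertex;
  tgt : arrow -> vertex
}.

(* Paths compose right to left: the pair [(v, [:: a1; ...; ak])] encodes the
   path [a1 ... ak] with [ak] traversed first, so that [v = tgt a1] and
   [src ai = tgt a(i+1)]; the pair [(v, [::])] is the trivial path at [v]. *)
Fixpoint is_path (Q : quiver) (v : vertex Q) (s : seq (arrow Q)) : bool :=
  if s is a :: s' then (tgt a == v) && is_path (src a) s' else true.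

Definition path_src (Q : quiver) (p : vertex Q * seq (arrow Q)) : vertex Q :=
  last p.1 (map (@src Q) p.2).

(* The path [s] lies in the ideal generated by the monomials in [gens]. *)
Definition in_ideal (Q : quiver) (gens : pred (seq (arrow Q)))
    (s : seq (arrow Q)) : bool :=
  [exists i : 'I_(size s).+1, [exists j : 'I_(size s).+1,
     gens (take j (drop i s))]].

Definition nonzero_path (Q : quiver) (gens : pred (seq (arrow Q)))
    (p : vertex Q * seq (arrow Q)) : bool :=
  is_path p.1 p.2 && ~~ in_ideal gens p.2.

(* The data [(Q, I)] of a string algebra.  The paths outside a monomial ideal
   [I] are a basis of [KQ/I]; [nz_basis] witnesses that there are finitely many. *)
Record string_algebra := StringAlgebra {
  quiver_of :> quiver;
  gens : pred (seq (arrow quiver_of));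
  nz_basis : seq (vertex quiver_of * seq (arrow quiver_of));
  gens_pos : ~~ gens [::];
  nz_basisP : nz_basis =i nonzero_path gens;
  two_in : forall v, (#|[set a : arrow quiver_of | tgt a == v]%SET| <= 2)%N;
  two_out : forall v, (#|[set a : arrow quiver_of | src a == v]%SET| <= 2)%N;
  one_after : forall a : arrow quiver_of,
    (#|[set b : arrow quiver_of
        | nonzero_path gens (tgt b, [:: b; a])]%SET| <= 1)%N;
  one_before : forall a : arrow quiver_of,
    (#|[set c : arrow quiver_of
        | nonzero_path gens (tgt a, [:: a; c])]%SET| <= 1)%N
}.

Section Algebra.
Variables (K : fieldType) (A : string_algebra).

Definition nzpath := seq_sub (@nz_basis A).

Definition is_prod (q r p : nzpath) : bool :=
  (path_src (val q) == (val r).1) &&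
  (val p == ((val q).1, (val q).2 ++ (val r).2)).

(* Coordinates in the basis of nonzero paths. *)
Definition algebra := {ffun nzpath -> K^o}.
HB.instance Definition _ := GRing.Lmodule.on algebra.

Definition alg_one : algebra := [ffun p => ((val p).2 == [::])%:R].

Definition alg_mul (f g : algebra) : algebra :=
  [ffun p => \sum_(q : nzpath) \sum_(r : nzpath | is_prod q r p) f q * g r].

Lemma in_ideal_sub s t u :
  in_ideal (@gens A) t -> in_ideal (@gens A) (s ++ t ++ u).
Proof.
move=> /existsP[i /existsP[j H]]; apply/existsP.
have hi : (size s + i < (size (s ++ t ++ u)).+1)%N.
  rewrite !size_cat ltnS leq_add2l; apply: leq_trans (leq_addr _ _).
  by rewrite -ltnS.
exists (Ordinal hi); apply/existsP.
have hj : (minn j (size t - i) < (size (s ++ t ++ u)).+1)%N.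
  rewrite ltnS !size_cat; apply: leq_trans (geq_minr _ _) _.
  by rewrite (leq_trans (leq_subr _ _))// addnCA leq_addr.
exists (Ordinal hj) => /=.
rewrite drop_cat ltnNge leq_addr /= addKn.
suff -> : take (minn j (size t - i)) (drop i (t ++ u)) = take j (drop i t) by [].
have it : (i <= size t)%N by rewrite -ltnS.
have -> : drop i (t ++ u) = drop i t ++ u.
  rewrite drop_cat; case: ltngtP it => // -> _.
  by rewrite subnn drop0 drop_size.
rewrite takel_cat ?size_drop ?geq_minr // take_min.
by rewrite (take_oversize (s := drop i t)) ?size_drop // .
Qed.

Lemma nzpathP (p : nzpath) : is_path (val p).1 (val p).2 /\
  ~~ in_ideal (@gens A) (val p).2.
Proof. by have := valP p; rewrite /= nz_basisP => /andP. Qed.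

Lemma is_path_cat (v : vertex A) s t :
  is_path v (s ++ t) = is_path v s && is_path (path_src (v, s)) t.
Proof.
rewrite /path_src; elim: s v => //= a s IH v; rewrite IH.
by case: (tgt a == v).
Qed.

Lemma path_src_cat (v u : vertex A) s t : path_src (v, s) = u ->
  path_src (v, s ++ t) = path_src (u, t).
Proof. by rewrite /path_src /= map_cat last_cat => ->. Qed.

Lemma nz_of (v : vertex A) s : is_path v s -> ~~ in_ideal (@gens A) s ->
  exists p : nzpath, val p = (v, s).
Proof.
move=> h1 h2; have h : (v, s) \in @nz_basis A.
  by rewrite nz_basisP; apply/andP.
by exists (SeqSub h).
Qed.

Definition is_prod3 (q s t p : nzpath) : bool :=
  [&& path_src (val q) == (val s).1, path_src (val s) == (val t).1 &
   val p == ((val q).1, (val q).2 ++ (val s).2 ++ (val t).2)].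

Lemma sum_nz_unique (P : pred nzpath) (b : bool) (x : K) :
  (b -> exists r, P r) -> (forall r, P r -> b) ->
  (forall r r', P r -> P r' -> r = r') ->
  \sum_(r | P r) x = if b then x else 0.
Proof.
move=> h1 h2 h3; case: b h1 h2 => h1 h2; last first.
  by rewrite big1 // => r /h2.
have [r Pr] := h1 isT; rewrite (bigD1 r) //= big1 ?addr0 // => r' /andP[Pr' /eqP].
by case; apply: h3.
Qed.

Lemma prod3r q s t p (x : K) :
  \sum_(r | is_prod q r p && is_prod s t r) x =
  if is_prod3 q s t p then x else 0.
Proof.
apply: sum_nz_unique => [/and3P[/eqP e1 /eqP e2 /eqP e3]|r|r r'].
- have [hp hI] := nzpathP p; rewrite e3 /= in hp hI.
  move: hp; rewrite is_path_cat => /andP[_ hp].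
  rewrite -surjective_pairing e1 in hp.
  have hI' : ~~ in_ideal (@gens A) ((val s).2 ++ (val t).2).
    apply: contra hI => h; have := in_ideal_sub (val q).2 [::] h.
    by rewrite cats0.
  have [r hr] := nz_of hp hI'; exists r.
  by rewrite /is_prod hr /= e1 e2 e3 !eqxx.
- move=> /andP[/andP[/eqP e1 /eqP e2] /andP[/eqP e3 /eqP e4]].
  by rewrite /is_prod3 e1 e3 e2 e4 /= !eqxx.
- move=> /andP[_ /andP[_ /eqP e]] /andP[_ /andP[_ /eqP e']].
  by apply: val_inj; rewrite e e'.
Qed.

Lemma prod3l q s t p (x : K) :
  \sum_(r | is_prod r t p && is_prod q s r) x =
  if is_prod3 q s t p then x else 0.
Proof.
apply: sum_nz_unique => [/and3P[/eqP e1 /eqP e2 /eqP e3]|r|r r'].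
- have [hp hI] := nzpathP p; rewrite e3 /= catA in hp hI.
  move: hp; rewrite is_path_cat => /andP[hp _].
  have hI' : ~~ in_ideal (@gens A) ((val q).2 ++ (val s).2).
    apply: contra hI => h; exact: (in_ideal_sub [::] (val t).2 h).
  have [r hr] := nz_of hp hI'; exists r.
  rewrite /is_prod hr /= e1 e3 -catA !eqxx !andbT -e2.
  by rewrite (path_src_cat (u := (val s).1)) -?surjective_pairing.
- move=> /andP[/andP[/eqP e1 /eqP e2] /andP[/eqP e3 /eqP e4]].
  rewrite /is_prod3 -e1 e2 e4 e3 /= catA !eqxx andbT /=.
  by rewrite (path_src_cat (u := (val s).1)) -?surjective_pairing.
- move=> /andP[_ /andP[_ /eqP e]] /andP[_ /andP[_ /eqP e']].
  by apply: val_inj; rewrite e e'.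
Qed.

Lemma alg_mulA : associative alg_mul.
Proof.
move=> f g h; apply/ffunP => p; rewrite !ffunE.
transitivity (\sum_q \sum_s \sum_t
    if is_prod3 q s t p then f q * g s * h t else 0).
  apply: eq_bigr => q _.
  under eq_bigr => r _ do rewrite ffunE mulr_sumr.
  under eq_bigr => r _ do (under eq_bigr => s _ do rewrite mulr_sumr).
  rewrite exchange_big /=; apply: eq_bigr => s _.
  under eq_bigr => r _ do rewrite big_mkcond /=.
  rewrite exchange_big /=; apply: eq_bigr => t _.
  rewrite -prod3r -big_mkcondr; apply: eq_bigr => r _.
  by rewrite mulrA.
under [RHS]eq_bigr => r _.
  under eq_bigr => t _ do rewrite ffunE mulr_suml.
  under eq_bigr => t _ do (under eq_bigr => q _ do rewrite mulr_suml).
  rewrite exchange_big /=.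
  over.
rewrite /= [RHS]exchange_big /=; apply: eq_bigr => q _.
under [RHS]eq_bigr => r _.
  under eq_bigr => t _ do rewrite big_mkcond /=.
  rewrite exchange_big /=.
  over.
rewrite /= [RHS]exchange_big /=; apply: eq_bigr => s _.
under [RHS]eq_bigr => r _ do rewrite big_mkcond /=.
rewrite [RHS]exchange_big /=; apply: eq_bigr => t _.
rewrite -prod3l big_mkcond /=; apply: eq_bigr => r _.
by case: (is_prod r t p).
Qed.

Lemma in_ideal0 : ~~ in_ideal (@gens A) [::].
Proof.
by apply/existsP => -[i /existsP[j]]; apply/negP; exact: gens_pos.
Qed.

Lemma alg_mul1 : left_id alg_one alg_mul.
Proof.
move=> f; apply/ffunP => p; rewrite ffunE (exchange_big_dep predT) //=.
rewrite (bigD1 p) //= [X in _ + X]big1 ?addr0 => [|r rp].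
- have [e he] := @nz_of (val p).1 [::] isT in_ideal0.
  rewrite (bigD1 e) /=; last by rewrite /is_prod he /= -surjective_pairing !eqxx.
  rewrite big1 ?addr0; first by rewrite ffunE he /= mul1r.
  move=> q /andP[/andP[_ /eqP h] /eqP qe]; rewrite ffunE.
  case: eqP => [q0|]; last by rewrite mul0r.
  by case: qe; apply: val_inj; rewrite he -q0 h /=; case: (val q).
- rewrite big1 // => q /andP[/eqP h1 /eqP h2]; rewrite ffunE.
  case: eqP => [q0|]; last by rewrite mul0r.
  case/eqP: rp; apply: val_inj.
  by move: h1 h2; rewrite /path_src q0 /= => -> ->; case: (val r).
Qed.

Lemma alg_1mul : right_id alg_one alg_mul.
Proof.
move=> f; apply/ffunP => p; rewrite ffunE.
rewrite (bigD1 p) //= [X in _ + X]big1 ?addr0 => [|q qp].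
- have [e he] := @nz_of (path_src (val p)) [::] isT in_ideal0.
  rewrite (bigD1 e) /=; last first.
    by rewrite /is_prod he /= cats0 -surjective_pairing !eqxx.
  rewrite big1 ?addr0; first by rewrite ffunE he /= mulr1.
  move=> r /andP[/andP[/eqP h _] /eqP re]; rewrite ffunE.
  case: eqP => [r0|]; last by rewrite mulr0.
  by case: re; apply: val_inj; rewrite he -r0 h /=; case: (val r).
- rewrite big1 // => r /andP[/eqP h1 /eqP h2]; rewrite ffunE.
  case: eqP => [r0|]; last by rewrite mulr0.
  case/eqP: qp; apply: val_inj.
  by rewrite h2 r0 cats0 -surjective_pairing.
Qed.

Lemma alg_mulDl : left_distributive alg_mul +%R.
Proof.
move=> f g h; apply/ffunP => p; rewrite !ffunE -big_split; apply: eq_bigr => q _.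
by rewrite -big_split; apply: eq_bigr => r _; rewrite ffunE mulrDl.
Qed.

Lemma alg_mulDr : right_distributive alg_mul +%R.
Proof.
move=> f g h; apply/ffunP => p; rewrite !ffunE -big_split; apply: eq_bigr => q _.
by rewrite -big_split; apply: eq_bigr => r _; rewrite ffunE mulrDr.
Qed.

HB.instance Definition _ := GRing.Zmodule_isPzRing.Build algebra
  alg_mulA alg_mul1 alg_1mul alg_mulDl alg_mulDr.

Definition scalar (k : K) : algebra := k *: (alg_one : algebra).

End Algebra.

Section Strings.
Variable A : string_algebra.

(* [(a, true)] is the direct letter [a], [(a, false)] the inverse letter. *)
Definition letter := (arrow A * bool)%type.
Definition is_direct (l : letter) : bool := l.2.
Definition left_end (l : letter) := if l.2 then tgt l.1 else src l.1.
Definition right_end (l : letter) := if l.2 then src l.1 else tgt l.1.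
Definition letter_inv (l : letter) : letter := (l.1, ~~ l.2).
Definition letters_inv (u : seq letter) : seq letter := rev (map letter_inv u).

(* A word is a walk whose successive vertices [vert i] are indexed by the
   integers in the interval between [lo] and [hi], where [None] stands for an
   infinite side; [lett i] is the letter linking [i] and [i + 1].  Values at
   indices outside the interval are irrelevant. *)
Record word := Word {
  lo : option int;
  hi : option int;
  vert : int -> vertex A;
  lett : int -> option letter
}.

Definition is_pos (w : word) (i : int) : bool :=
  (if lo w is Some l then l <= i else true) &&
  (if hi w is Some h then i <= h else true).

Definition letter_at (w : word) (i : int) : option letter :=
  if is_pos w i && is_pos w (i + 1) then lett w i else None.

Definition word_inv (w : word) : word :=
  Word (omap -%R (hi w)) (omap -%R (lo w)) (fun i => vert w (- i))
    (fun i => omap letter_inv (lett w (- i - 1))).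

Definition occurs (w : word) (i : int) (u : seq letter) : Prop :=
  forall k : nat, (k < size u)%N -> letter_at w (i + k%:Z) = onth u k.

Record is_string (w : word) : Prop := IsString {
  str_nonempty : exists i, is_pos w i;
  str_walk : forall i, is_pos w i -> is_pos w (i + 1) ->
    exists l, [/\ lett w i = Some l, left_end l = vert w i &
                  right_end l = vert w (i + 1)];
  str_reduced : forall i l, letter_at w i = Some l ->
    letter_at w (i + 1) <> Some (letter_inv l);
  str_nonzero : forall i u s, occurs w i u ->
    u = [seq (a, true) | a <- s] \/ letters_inv u = [seq (a, true) | a <- s] ->
    ~~ in_ideal (@gens A) s
}.

Record string := String { wd :> word; wd_string : is_string wd }.

(* A finite word, given by its leftmost vertex and its letters. *)
Definition fword := (vertex A * seq letter)%type.

Definition fcat (u v : fword) : fword := (u.1, u.2 ++ v.2).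
Definition fpow (u : fword) (n : nat) : fword := (u.1, flatten (nseq n u.2)).

Definition walk_vert (v : vertex A) (l : int -> option letter) (i : int) :=
  if i == 0 then v else if l (i - 1) is Some x then right_end x else v.

Definition fin_lett (u : fword) (i : int) : option letter :=
  if i is Posz k then onth u.2 k else None.

Definition fin_word (u : fword) : word :=
  Word (Some 0) (Some (size u.2)%:Z) (walk_vert u.1 (fin_lett u)) (fin_lett u).

Definition is_fstring (u : fword) : Prop := is_string (fin_word u).

Record is_band (b : fword) : Prop := IsBand {
  band_pos : (0 < size b.2)%N;
  band_pow : forall n, is_fstring (fpow b n);
  band_primitive : ~ exists u n,
    [/\ is_fstring u, (1 < n)%N & b = fpow u n];
  band_first : exists a, ohead b.2 = Some (a, true);
  band_last : exists a, onth b.2 (size b.2).-1 = Some (a, false)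
}.

Definition domestic : Prop := exists bs : seq fword,
  forall b, is_band b -> b \in bs.

(* The right-infinite sequence of letters [c b b b ...]. *)
Definition tail_lett (c b : fword) (k : nat) : option letter :=
  if (k < size c.2)%N then onth c.2 k
  else onth b.2 ((k - size c.2) %% size b.2)%N.

(* The word [c b b b ...], with [c] starting at position [0]. *)
Definition right_lett (c b : fword) (i : int) : option letter :=
  if i is Posz k then tail_lett c b k else None.
Definition right_word (c b : fword) : word :=
  Word (Some 0) None (walk_vert c.1 (right_lett c b)) (right_lett c b).

(* The word [... b0 b0 c b b ...], with [c] starting at position [0]. *)
Definition bi_lett (b0 c b : fword) (i : int) : option letter :=
  match i with
  | Posz k => tail_lett c b k
  | Negz k => onth (rev b0.2) (k %% size b0.2)%N
  end.
Definition bi_word (b0 c b : fword) : word :=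
  Word None None (walk_vert c.1 (bi_lett b0 c b)) (bi_lett b0 c b).

Definition right_infinite (w : word) : Prop := hi w = None.
Definition left_infinite (w : word) : Prop := lo w = None.
Definition one_sided (w : word) : Prop :=
  (right_infinite w /\ ~ left_infinite w) \/
  (left_infinite w /\ ~ right_infinite w).

(* [w] is [... b b b ...] for a band [b], up to a shift of the indices. *)
Definition periodic (w : word) : Prop :=
  [/\ left_infinite w, right_infinite w & exists b p, is_band b /\
   forall i : int, lett w (p + i) = onth b.2 `|(i %% (size b.2)%:Z)%Z|%N].

(* [v] occurs in [y] starting at position [i], and the letters of [y] adjacent
   to this occurrence, if any, point towards it. *)
Definition image_substring_at (y : word) (i : int) (v : fword) : Prop :=
  [/\ is_pos y i /\ is_pos y (i + (size v.2)%:Z),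
      vert y i = v.1,
      occurs y i v.2,
      forall l, letter_at y (i - 1) = Some l -> ~~ is_direct l &
      forall l, letter_at y (i + (size v.2)%:Z) = Some l -> is_direct l].

Definition has_image_substring (y : word) (v : fword) : Prop :=
  exists i, image_substring_at y i v.

Definition has_initial_image_substring (y : word) (v : fword) : Prop :=
  exists2 i, lo y = Some i & image_substring_at y i v.

Definition primitive (u : seq letter) : Prop :=
  (0 < size u)%N /\
  ~ exists v n, (1 < n)%N /\ u = flatten (nseq n v).

(* On the right, [w = y u u u ...] with [u] primitive, the first copy of [u]
   starting at position [p], and [y] either empty or with a last letter
   different from that of [u]. *)
Definition right_tail (w : word) (p : int) (u : seq letter) : Prop :=
  [/\ right_infinite w, is_pos w p, primitive u,
      forall k : nat, lett w (p + k%:Z) = onth u (k %% size u)%N &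
      lo w = Some p \/
      (is_pos w (p - 1) /\ lett w (p - 1) <> onth u (size u).-1)].

Definition contracting_right (w : word) : Prop := exists p u a,
  right_tail w p u /\ onth u (size u).-1 = Some (a, true).

Definition contracting_left (w : word) : Prop := contracting_right (word_inv w).

End Strings.

Section StringModule.
Variables (K : fieldType) (A : string_algebra).

(* The family [a] stands for the formal sum of the [a i z_i]. *)
Definition is_family (w : word A) : {pred int -> K} := fun a => `[<
  [/\ forall i, ~~ is_pos w i -> a i = 0,
      contracting_right w -> exists n, forall i, n <= i -> a i = 0 &
      contracting_left w -> exists n, forall i, i <= n -> a i = 0] >].

Record string_module (w : string A) := StringModule {
  coord : int -> K;
  _ : coord \in is_family w
}.

Section Action.
Variable w : word A.
Implicit Type a : int -> K.

Definition vertex_act (v : vertex A) a : int -> K :=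
  fun i => if is_pos w i && (vert w i == v) then a i else 0.

Definition arrow_act (x : arrow A) a : int -> K := fun i =>
  (if letter_at w i == Some (x, true) then a (i + 1) else 0) +
  (if letter_at w (i - 1) == Some (x, false) then a (i - 1) else 0).

Definition path_act (p : vertex A * seq (arrow A)) a : int -> K :=
  vertex_act p.1 (foldr arrow_act a p.2).

Definition alg_act (r : algebra K A) a : int -> K :=
  fun i => \sum_(p : nzpath A) r p * path_act (val p) a i.

Lemma vertex_act_sum v (I : Type) (s : seq I) (P : pred I) (k : I -> K)
    (F : I -> int -> K) i :
  vertex_act v (fun i => \sum_(j <- s | P j) k j * F j i) i =
  \sum_(j <- s | P j) k j * vertex_act v (F j) i.
Proof.
rewrite /vertex_act; case: ifP => // _.
by rewrite big1 // => j _; rewrite mulr0.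
Qed.

Lemma arrow_act_sum x (I : Type) (s : seq I) (P : pred I) (k : I -> K)
    (F : I -> int -> K) i :
  arrow_act x (fun i => \sum_(j <- s | P j) k j * F j i) i =
  \sum_(j <- s | P j) k j * arrow_act x (F j) i.
Proof.
rewrite /arrow_act; under [RHS]eq_bigr => j _ do rewrite mulrDr.
rewrite big_split /=; congr (_ + _); case: ifP => // _;
  by rewrite big1 // => j _; rewrite mulr0.
Qed.

Lemma path_act_sum p (I : Type) (s : seq I) (P : pred I) (k : I -> K)
    (F : I -> int -> K) i :
  path_act p (fun i => \sum_(j <- s | P j) k j * F j i) i =
  \sum_(j <- s | P j) k j * path_act p (F j) i.
Proof.
case: p => v t; rewrite /path_act /=.
have -> : foldr arrow_act (fun i => \sum_(j <- s | P j) k j * F j i) t =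
   (fun i => \sum_(j <- s | P j) k j * foldr arrow_act (F j) t i).
  by elim: t => //= x t ->; apply/funext => l; rewrite arrow_act_sum.
exact: vertex_act_sum.
Qed.

Lemma path_actD p a b i :
  path_act p (fun i => a i + b i) i = path_act p a i + path_act p b i.
Proof.
have := @path_act_sum p bool [:: true; false] predT (fun=> 1)
  (fun c => if c then a else b) i.
rewrite !big_cons big_nil /= !mul1r addr0 => <-.
congr (path_act p _ i); apply/funext => j.
by rewrite !big_cons big_nil /= !mul1r addr0.
Qed.

Lemma path_act0 p i : path_act p (fun=> 0) i = 0.
Proof.
have := path_actD p (fun=> 0) (fun=> 0) i.
under [X in path_act p X i]eq_fun do rewrite addr0.
by move=> /eqP; rewrite -subr_eq subrr => /eqP.
Qed.

Hypothesis hw : is_string w.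

Lemma letter_ends i l : letter_at w i = Some l ->
  [/\ is_pos w i, is_pos w (i + 1), left_end l = vert w i &
      right_end l = vert w (i + 1)].
Proof.
rewrite /letter_at; case: ifP => // /andP[h1 h2] e; split => //;
  by have [l' []] := str_walk hw h1 h2; rewrite e => -[->].
Qed.

Lemma arrow_vertex_act x u a :
  arrow_act x (vertex_act u a) =
  if src x == u then arrow_act x a else fun=> 0.
Proof.
case hu: (src x == u); apply/funext => i; rewrite /arrow_act /vertex_act;
case: (eqVneq (letter_at w i) _) => [/letter_ends[_ h _ e]|_];
case: (eqVneq (letter_at w (i - 1)) _) => [/letter_ends[h' _ e' _]|_];
by rewrite ?h -?e ?h' -?e' /left_end /right_end /= ?hu ?addr0.
Qed.

Lemma path_vertex_act v s u a : is_path v s ->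
  path_act (v, s) (vertex_act u a) =
  if path_src (v, s) == u then path_act (v, s) a else fun=> 0.
Proof.
elim: s v => [|x s IH] v /=.
  move=> _; rewrite /path_act /path_src /=; apply/funext => i.
  rewrite /vertex_act; case: (eqVneq v u) => [<-|vu].
    by case: ifP => // ->.
  case: ifP => // /andP[_ /eqP ->]; rewrite (negPf vu) andbF //.
move=> /andP[_ /IH IHs].
have E b : path_act (v, x :: s) b =
    vertex_act v (arrow_act x (path_act (src x, s) b)).
  by rewrite /path_act arrow_vertex_act eqxx.
rewrite !E IHs [path_src (v, _)]/(path_src (src x, s)); case: ifP => // _.
apply/funext => i; rewrite /vertex_act /arrow_act.
by case: ifP => // _; rewrite !if_same addr0.
Qed.

Lemma foldr_act_neq0 s a i : foldr arrow_act a s i != 0 ->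
  occurs w i [seq (x, true) | x <- s] \/
  occurs w (i - (size s)%:Z) (letters_inv [seq (x, true) | x <- s]).
Proof.
elim: s i => [|x s IH] i /=; first by left.
rewrite /arrow_act => h.
have {h}[[/eqP e /IH h]|[/eqP e /IH h]] :
  (letter_at w i == Some (x, true) /\ foldr arrow_act a s (i + 1) != 0) \/
  (letter_at w (i - 1) == Some (x, false) /\
     foldr arrow_act a s (i - 1) != 0).
- move: h; case: ifP => e1; case: ifP => e2 h.
  + case: (eqVneq (foldr arrow_act a s (i + 1)) 0) => [h0|]; last by left.
    by right; move: h; rewrite h0 add0r.
  + by left; move: h; rewrite addr0.
  + by right; move: h; rewrite add0r.
  + by move: h; rewrite addr0 eqxx.
- left=> -[|k] hk /=; first by rewrite addr0.
  case: h => h.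
    rewrite -h //; congr letter_at; lia.
  case: s h {IH} hk => // y s h _.
  have := h (size s).
  rewrite /letters_inv size_rev !size_map /= => /(_ (ltnSn _)).
  have -> : i + 1 - (size s).+1%:Z + (size s)%:Z = i by lia.
  by rewrite e rev_cons -cats1 onth_cat size_rev !size_map ltnn subnn.
- right; case: h => h; last first.
    rewrite /letters_inv /= rev_cons -cats1 => k.
    rewrite size_cat size_rev !size_map /= addn1 ltnS leq_eqVlt.
    rewrite onth_cat size_rev !size_map.
    case/orP=> [/eqP->|hk].
      rewrite ltnn subnn /= -e; congr letter_at; lia.
    rewrite hk; have := h k.
    rewrite /letters_inv size_rev !size_map => /(_ hk) <-.
    congr letter_at; lia.
  case: s h {IH} => [|y s] h.
    by move=> [|k] //= _; rewrite addr0 e.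
  have := h 0%N isT; rewrite /= addr0.
  by rewrite e.
Qed.

Lemma foldr_act_ideal s a i : in_ideal (@gens A) s -> foldr arrow_act a s i = 0.
Proof.
move=> hs; apply/eqP; apply: contraTT hs => /foldr_act_neq0[] h.
  by apply: (str_nonzero hw h); left.
apply: (str_nonzero hw h); right.
rewrite /letters_inv map_rev revK -!map_comp; exact: eq_map.
Qed.

Lemma path_act_mul (q r : nzpath A) a i :
  path_act (val q) (path_act (val r) a) i =
  \sum_(p : nzpath A | is_prod q r p) path_act (val p) a i.
Proof.
have [hq _] := nzpathP q; have [hr _] := nzpathP r.
rewrite [X in path_act _ X]/path_act; rewrite {1}(surjective_pairing (val q)).
rewrite path_vertex_act // -surjective_pairing.
case: (eqVneq (path_src (val q)) (val r).1) => [e|ne]; last first.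
  by rewrite big1 // => p /andP[/eqP h]; rewrite h eqxx in ne.
have E : path_act (val q) (foldr arrow_act a (val r).2) =
    path_act ((val q).1, (val q).2 ++ (val r).2) a.
  by rewrite /path_act /= foldr_cat.
rewrite E; case hI: (in_ideal (@gens A) ((val q).2 ++ (val r).2)).
  rewrite /path_act /= /vertex_act foldr_act_ideal // if_same big1 // => p.
  by move=> /andP[_ /eqP hp]; have [_] := nzpathP p; rewrite hp hI.
have hp : is_path (val q).1 ((val q).2 ++ (val r).2).
  by rewrite is_path_cat hq -surjective_pairing e.
have [p hpE] := nz_of hp (negbT hI).
rewrite (bigD1 p) /=; last by rewrite /is_prod hpE e !eqxx.
rewrite big1 ?addr0 ?hpE // => p' /andP[/andP[_ /eqP h] /eqP []].
by apply: val_inj; rewrite h hpE.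
Qed.

Lemma alg_act_mul (f g : algebra K A) a :
  alg_act f (alg_act g a) = alg_act (f * g) a.
Proof.
apply/funext => i; rewrite /alg_act.
under eq_bigr => q _ do rewrite path_act_sum mulr_sumr.
transitivity (\sum_(q : nzpath A) \sum_(r : nzpath A)
   \sum_(p : nzpath A | is_prod q r p) f q * g r * path_act (val p) a i).
  apply: eq_bigr => q _; apply: eq_bigr => r _.
  by rewrite path_act_mul mulrA mulr_sumr.
under [RHS]eq_bigr => p _.
  rewrite ffunE mulr_suml.
  under eq_bigr => q _ do rewrite mulr_suml big_mkcond /=.
  over.
rewrite /= [RHS]exchange_big /=; apply: eq_bigr => q _.
rewrite [RHS]exchange_big /=; apply: eq_bigr => r _.
by rewrite big_mkcond.
Qed.

Lemma alg_act_one a : (forall i, ~~ is_pos w i -> a i = 0) ->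
  alg_act (1 : algebra K A) a = a.
Proof.
move=> ha; apply/funext => i; rewrite /alg_act.
have [e he] := @nz_of A (vert w i) [::] isT (in_ideal0 A).
rewrite (bigD1 e) // big1 ?addr0 => [|p /andP[_ pe]].
  rewrite ffunE he /= mul1r /path_act /vertex_act /= eqxx andbT addr0.
  by case: ifP => // /negbT/ha.
rewrite ffunE; case: eqP => [p0|]; last by rewrite mul0r.
rewrite mul1r /path_act /vertex_act p0 /=; case: ifP => // /andP[_ /eqP h].
case/eqP: pe; apply: val_inj; by rewrite he [LHS]surjective_pairing p0 h.
Qed.

Lemma path_act_bound p a i :
  (forall j, i - (size p.2)%:Z <= j <= i + (size p.2)%:Z -> a j = 0) ->
  path_act p a i = 0.
Proof.
case: p => v s /= h; rewrite /path_act /vertex_act /=.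
suff -> : foldr arrow_act a s i = 0 by rewrite if_same.
elim: s i h => [|x s IH] i /= h; first by apply: h; lia.
rewrite /arrow_act !IH ?if_same ?addr0 // => j hj; apply: h; lia.
Qed.

Lemma alg_act_family r a : a \in is_family w -> alg_act r a \in is_family w.
Proof.
move=> /asboolP[h0 hr hl]; apply/asboolP.
pose N := \max_(p : nzpath A) size (val p).2.
have act0 i : (forall j, i - N%:Z <= j <= i + N%:Z -> a j = 0) ->
    alg_act r a i = 0.
  move=> h; rewrite /alg_act big1 // => p _; rewrite path_act_bound ?mulr0 //.
  have := leq_bigmax (F := fun p : nzpath A => size (val p).2) p.
  rewrite -/N; move: (size _) => k hk j hj; apply: h.
  move: N hk hj => N; lia.
split=> [i hi|/hr[n hn]|/hl[n hn]].
- by rewrite /alg_act big1 // => p _; rewrite /path_act /vertex_act (negPf hi) mulr0.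
- by exists (n + N%:Z) => i hi; apply: act0 => j hj; apply: hn; lia.
- by exists (n - N%:Z) => i hi; apply: act0 => j hj; apply: hn; lia.
Qed.

End Action.

Section Instances.
Variable w : string A.

HB.instance Definition _ := [isSub for @coord w].
HB.instance Definition _ := [Choice of string_module w by <:].

Lemma family_zmod_closed : zmod_closed (is_family w : {pred int -> K}).
Proof.
split=> [|a b /asboolP[a0 ar al] /asboolP[b0 br bl]]; apply/asboolP.
  by split=> // _; exists 0.
have E i : (a - b) i = a i - b i by [].
split=> [i hi|h|h]; first by rewrite E a0 // b0 // subrr.
- have [n hn] := ar h; have [m hm] := br h; exists (Num.max n m) => i.
  by rewrite ge_max => /andP[h1 h2]; rewrite E hn // hm // subrr.
- have [n hn] := al h; have [m hm] := bl h; exists (Num.min n m) => i.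
  by rewrite le_min => /andP[h1 h2]; rewrite E hn // hm // subrr.
Qed.
HB.instance Definition _ :=
  GRing.isZmodClosed.Build (int -> K) (is_family w) family_zmod_closed.
HB.instance Definition _ := [SubChoice_isSubZmodule of string_module w by <:].

Definition module_act (r : algebra K A) (m : string_module w) :
    string_module w :=
  StringModule (alg_act_family r (valP m)).

Lemma module_actA r s m : module_act r (module_act s m) = module_act (r * s) m.
Proof. by apply: val_inj; rewrite /= (alg_act_mul (wd_string w)). Qed.

Lemma module_act1 : left_id 1 module_act.
Proof.
move=> m; apply: val_inj; rewrite /= alg_act_one //.
by case: m => a /= /asboolP[].
Qed.

Lemma module_actDr : right_distributive module_act +%R.
Proof.
move=> r m n; apply: val_inj; rewrite !raddfD /=; apply/funext => i.
transitivity (alg_act w r (coord m) i + alg_act w r (coord n) i) => //.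
rewrite /alg_act -big_split; apply: eq_bigr => p _ /=.
by rewrite -mulrDr -path_actD.
Qed.

Lemma module_actDl m : {morph module_act^~ m : r s / r + s}.
Proof.
move=> r s; apply: val_inj; rewrite !raddfD /=; apply/funext => i.
transitivity (alg_act w r (coord m) i + alg_act w s (coord m) i) => //.
rewrite /alg_act -big_split; apply: eq_bigr => p _ /=.
by rewrite ffunE mulrDl.
Qed.

HB.instance Definition _ := GRing.Zmodule_isLmodule.Build (algebra K A)
  (string_module w) module_actA module_act1 module_actDr module_actDl.

End Instances.
End StringModule.

Arguments string_module K {A} w.

Section Ziegler.
Variables (K : fieldType) (A : string_algebra).
Local Notation R := (algebra K A).

Definition isomorphic (M N : lmodType R) : Prop :=
  exists f : {linear M -> N}, bijective f.

Definition finite_dimensional (M : lmodType R) : Prop :=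
  exists s : seq M, forall m : M, exists k : nat -> K,
    m = \sum_(i < size s) scalar A (k i) *: s`_i.

Definition indecomposable (M : lmodType R) : Prop :=
  (exists m : M, m != 0) /\
  forall M1 M2 : lmodType R, isomorphic M (M1 * M2)%type ->
    (forall m : M1, m = 0) \/ (forall m : M2, m = 0).

(* Every finite system of linear equations with constants in [M] which is
   solvable in [N] is already solvable in [M]. *)
Definition pure_embedding (M N : lmodType R) (f : {linear M -> N}) : Prop :=
  forall (m n : nat) (r : 'I_m -> 'I_n -> R) (c : 'I_m -> M),
    (exists y : 'I_n -> N, forall i, \sum_(j < n) r i j *: y j = f (c i)) ->
    exists x : 'I_n -> M, forall i, \sum_(j < n) r i j *: x j = c i.

Definition pure_injective (M : lmodType R) : Prop :=
  forall (X Y : lmodType R) (f : {linear X -> Y}) (g : {linear X -> M}),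
    pure_embedding f -> exists h : {linear Y -> M}, forall x, h (f x) = g x.

(* A point of the Ziegler spectrum is the isomorphism class [modules] of an
   indecomposable pure-injective module.  Since [lmodType R] is too large for
   the types of MathComp-Analysis to apply, the topology is spelled out by hand,
   subsets being predicates. *)
Record Zg := ZgPoint {
  modules : lmodType R -> Prop;
  modulesP : exists M, [/\ indecomposable M, pure_injective M &
    forall N, modules N <-> isomorphic M N]
}.

(* The basic open set [(f)]. *)
Definition not_factoring (M N : lmodType R) (f : {linear M -> N}) (x : Zg) :
    Prop :=
  exists2 X, modules x X & exists g : {linear M -> X},
    ~ exists h : {linear N -> X}, forall m, h (f m) = g m.

Definition Zg_open (O : Zg -> Prop) : Prop :=
  forall x, O x -> exists (M N : lmodType R) (f : {linear M -> N}),
    [/\ finite_dimensional M, finite_dimensional N, not_factoring f x &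
        forall y, not_factoring f y -> O y].

Definition open_in (X V : Zg -> Prop) : Prop :=
  exists2 O, Zg_open O & forall x, V x <-> X x /\ O x.

Definition open_nbhs_basis_in (X : Zg -> Prop) (x : Zg)
    (B : nat -> Zg -> Prop) : Prop :=
  (forall n, open_in X (B n) /\ B n x) /\
  (forall V, open_in X V -> V x -> exists n, forall y, B n y -> V y).

Definition is_string_point (x : Zg) : Prop :=
  exists2 y : string A, ~ periodic y & modules x (string_module K y).

Definition U (x : Zg) : Prop :=
  is_string_point x /\ forall M, modules x M -> ~ finite_dimensional M.

Definition U_image (v : fword A) (x : Zg) : Prop :=
  U x /\ exists y : string A,
    [/\ ~ periodic y, has_image_substring y v &
        modules x (string_module K y)].

Definition U_initial (v : fword A) (x : Zg) : Prop :=
  U x /\ exists y : string A,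
    [/\ one_sided y, has_initial_image_substring y v &
        modules x (string_module K y)].

End Ziegler.

(* Main.v *)
From HB Require Import structures.
From mathcomp Require Import all_boot all_order all_algebra.
From mathcomp Require Import boolp classical_sets functions.
From mathcomp Require Import generic_quotient ring_quotient.
From mathcomp Require Import zify.
Require Import Defs.

(** A homomorphism from a module [M] to the string module [C(w)] is the same as
    a family of functionals [h i] on [M], one for each position of [w], which
    satisfies a local condition [hom_at] at every position and a support
    condition on each contracting side.  Everything is derived from this
    description.

    The points.  [C(w)] is pure-injective ([string_module_pure_injective]): a
    homomorphism extends along a pure embedding to a family satisfying all local
    conditions, because a system of linear equations in functionals is solvable as soon
    as its finite parts are consistent ([consistent_solvable]).  Such a family is then
    pushed back into [C(w)] along each contracting tail
    ([contracting_retraction]); there the shift by one period makes the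
    coefficients sequences on which a polynomial ring acts, and the finite
    sequences, being a divisible module, are a direct summand of all sequences.
    [C(w)] is indecomposable ([string_module_indecomposable]): a lexicographic
    comparison of walks orders the positions, endomorphisms only go up in this
    order, and an infinite aperiodic string has no two equivalent positions.
    Every nonzero element has a lowest position on which each endomorphism
    acts by its diagonal coefficient, and this coefficient is the same at all
    positions, so it is 0 or 1 for a projection and tells which summand
    vanishes.

    The sets [U_n] are open.  For a finite string [v] the submodule of an image
    substring gives a morphism from [M(v)] to [C(y)] with coefficient 1 at all
    vertices of [v].  This morphism is not a sum of a morphism killing the first vertex
    of [v] and a morphism killing the last one, whereas in the absence of an image
    occurrence of [v] every morphism is such a sum ([image_not_split],
    [no_image_split]).  Being such a sum means factoring through one fixed morphism
    between finite-dimensional modules ([split_module]).  For initial image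
    substrings the first condition is weakened to: the first vertex is sent to
    a multiple of [a], the only arrow which can precede [v].

    The sets [U_n] are small.  Let [g] be a morphism from [M] to [C(w)] which does not
    factor through [f], with [M] and the target [N] of [f] of finite dimension.  On a
    contracting side the functionals on [N] that can occur at the ends of longer
    and longer strips form a descending chain, hence a stationary one, and
    this allows to cut off partial factorizations ([contracting_cut]); on an
    expanding side an ascending chain allows to truncate [g] itself
    ([expanding_cut]).  With linear compactness it follows that finitely many
    positions of [w] obstruct the factorization, of a morphism with finite support
    ([finite_witness]).  Both are inherited by every string which shares a
    large window with [w] ([not_factoring_nearby]), in particular by every [y]
    containing [w_n] for large [n]. *)

Set Implicit Arguments.
Unset Strict Implicit.
Unset Printing Implicit Defensive.
Import Order.TTheory GRing.Theory Num.Theory.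
Local Open Scope ring_scope.

(** * Steps of a walk *)

Section Steps.
Variable A : string_algebra.
Implicit Types (w : word A) (i : int) (d e : bool) (l : letter A).

Definition nb i e : int := if e then i + 1 else i - 1.

(** Reading the letters away from [i] makes the two sides of a position symmetric:
    for either direction [e] the letter is direct if its arrow ends at [i], and
    inverse if its arrow starts at [i]. *)
Definition step w i e : option (letter A) :=
  if e then letter_at w i else omap (@letter_inv A) (letter_at w (i - 1)).

Lemma letter_invK : involutive (@letter_inv A).
Proof. by case=> a []. Qed.

Lemma nbK i e : nb (nb i e) (~~ e) = i.
Proof. by case: e; rewrite /nb /=; lia. Qed.

Lemma step_nb w i e : step w (nb i e) (~~ e) = omap (@letter_inv A) (step w i e).
Proof.
case: e; rewrite /step /nb /=; first by rewrite addrK.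
by case: (letter_at w (i - 1)) => //= l; rewrite letter_invK.
Qed.

Lemma step_nbn w i e : step w (nb i (~~ e)) e = omap (@letter_inv A) (step w i (~~ e)).
Proof. by rewrite -{2}(negbK e) step_nb. Qed.

Lemma step_nb_some w i e l :
  step w i e = Some l -> step w (nb i e) (~~ e) = Some (letter_inv l).
Proof. by move=> h; rewrite step_nb h. Qed.

Lemma arrow_actE (K : fieldType) w x (a : int -> K) i : arrow_act w x a i =
  \sum_(e : bool) (if step w i e == Some (x, true) then a (nb i e) else 0).
Proof.
rewrite big_bool /arrow_act /step /nb /=; congr (_ + _).
by case: (letter_at w (i - 1)) => [[y []]|].
Qed.

Variable w : word A.
Hypothesis hw : is_string w.

Lemma step_ends i e l : step w i e = Some l ->
  [/\ is_pos w i, is_pos w (nb i e), left_end l = vert w i &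
      right_end l = vert w (nb i e)].
Proof.
rewrite /step /nb; case: e; first exact: letter_ends.
case E: (letter_at w (i - 1)) => [m|] //= [<-].
have [h1 h2 h3 h4] := letter_ends hw E; rewrite subrK in h2 h4.
by split=> //; move: h3 h4; case: (m) => a [].
Qed.

Lemma step_some i e : is_pos w i -> is_pos w (nb i e) -> exists l, step w i e = Some l.
Proof.
rewrite /step /nb; case: e => h1 h2.
  by have [l [h _ _]] := str_walk hw h1 h2; exists l; rewrite /letter_at h1 h2.
have h1' : is_pos w (i - 1 + 1) by rewrite subrK.
have [l [h _ _]] := str_walk hw h2 h1'.
by exists (letter_inv l); rewrite /letter_at h1' h2 h.
Qed.

Lemma step_reduced i e l : step w i e = Some l -> step w i (~~ e) <> Some l.
Proof.
wlog -> : e / e = true => [H h h'|].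
  by case: e h h' => h h'; [apply: (H true)|apply: (H true)].
rewrite /step /= => h; case E: (letter_at w (i - 1)) => [m|] //= [mE].
apply: (str_reduced hw E); by rewrite subrK h mE.
Qed.

Lemma step_inj i d e l : step w i d = Some l -> step w i e = Some l -> d = e.
Proof.
by case: (eqVneq d e) => // /eqP; case: d e => [] [] // _ h; move/step_reduced: h.
Qed.

(** In one of the two directions of reading, the two letters form a direct word
    of length two. *)
Lemma step_nonzero i e x z :
  step w i e = Some (x, false) -> step w i (~~ e) = Some (z, true) ->
  nonzero_path (@gens A) (tgt x, [:: x; z]).
Proof.
move=> h1 h2; have [_ _ e1 _] := step_ends h1; have [_ _ e2 _] := step_ends h2.
rewrite /nonzero_path /= eqxx andbT /=; rewrite /left_end /= in e1 e2.
rewrite e1 e2 eqxx /=.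
move: h1 h2; rewrite /step; case: e => /=.
  move=> h1; case E: (letter_at w (i - 1)) => [[m b]|] //= [hm hb].
  subst m; case: b E hb => // E _.
  apply: (str_nonzero hw (i := i - 1) (u := [:: (z, false); (x, false)])).
    by move=> [|[|k]] //= _; rewrite ?addr0 ?subrK.
  by right.
move=> + h1; case E: (letter_at w (i - 1)) => [[m b]|] //= [hm hb].
subst m; case: b E hb => // E _.
apply: (str_nonzero hw (i := i - 1) (u := [:: (x, true); (z, true)])).
  by move=> [|[|k]] //= _; rewrite ?addr0 ?subrK.
by left.
Qed.

End Steps.

Lemma set_le1_eq (T : finType) (S : {set T}) x y :
  (#|S| <= 1)%N -> x \in S -> y \in S -> x = y.
Proof. by move=> /card_le1_eqP h hx hy; apply: h. Qed.

Lemma set_le2_eq (T : finType) (S : {set T}) z x y :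
  (#|S| <= 2)%N -> z \in S -> x \in S -> y \in S -> x != z -> y != z -> x = y.
Proof.
move=> h hz hx hy xz yz; apply: (@set_le1_eq _ (S :\ z)); rewrite ?inE ?xz ?yz //.
by rewrite (cardsD1 z) hz in h.
Qed.

(** At each vertex at most two arrows start and at most two end, and at most one
    composes to a nonzero path with a given arrow; so a letter determines the
    next one once it is known whether the latter is direct. *)
Lemma step_unique (A : string_algebra) (w w' : word A) i i' e e' x z z' :
  is_string w -> is_string w' ->
  step w i e = Some x -> step w' i' e' = Some x ->
  step w i (~~ e) = Some z -> step w' i' (~~ e') = Some z' ->
  z.2 = z'.2 -> z = z'.
Proof.
move=> hw hw' hx hx' hz hz'.
have xz : z != x by apply: contra_not_neq (step_reduced hw hx) => <-.
have xz' : z' != x by apply: contra_not_neq (step_reduced hw' hx') => <-.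
have [_ _ e1 _] := step_ends hw hx; have [_ _ e2 _] := step_ends hw hz.
have [_ _ e1' _] := step_ends hw' hx'; have [_ _ e2' _] := step_ends hw' hz'.
rewrite -e1' in e2'; rewrite -e1 in e2 => {e1 e1'}.
case: x hx hx' xz xz' e2 e2' => x []; case: z hz => z [];
  case: z' hz' => z' [] //= hz' hz hx hx'.
- rewrite /left_end /= !xpair_eqE !andbT => zx zx' e1 e2 _; congr pair.
  by apply: (set_le2_eq (two_in (tgt x)) (z := x)); rewrite ?inE ?e1 ?e2 ?eqxx.
- move=> _ _ _ _ _; congr pair.
  apply: (set_le1_eq (one_after x)); rewrite ?inE.
    by apply: (step_nonzero hw hz); rewrite negbK.
  by apply: (step_nonzero hw' hz'); rewrite negbK.
- move=> _ _ _ _ _; congr pair.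
  by apply: (set_le1_eq (one_before x)); rewrite ?inE;
    [apply: (step_nonzero hw hx)|apply: (step_nonzero hw' hx')].
- rewrite /left_end /= !xpair_eqE !andbT => zx zx' e1 e2 _; congr pair.
  by apply: (set_le2_eq (two_out (src x)) (z := x)); rewrite ?inE ?e1 ?e2 ?eqxx.
Qed.

(** * Generators of the algebra and their action *)

Section Generators.
Variables (K : fieldType) (A : string_algebra).
Local Notation R := (algebra K A).

Definition path_elt (q : vertex A * seq (arrow A)) : R :=
  [ffun p => (val p == q)%:R].
Definition vtx (v : vertex A) : R := path_elt (v, [::]).
Definition arr (x : arrow A) : R := path_elt (tgt x, [:: x]).

Lemma path_elt_mul (q r : nzpath A) :
  path_elt (val q) * path_elt (val r) = [ffun p => (is_prod q r p)%:R].
Proof.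
apply/ffunP => p; rewrite !ffunE (bigD1 q) //= [X in _ + X]big1 ?addr0 => [|s sq].
  case E: (is_prod q r p).
    rewrite (bigD1 r) //= big1 ?addr0 ?ffunE ?eqxx ?mulr1 // => s /andP[_ sr].
    by rewrite !ffunE val_eqE (negPf sr) mulr0.
  rewrite big1 // => s hs; rewrite !ffunE !val_eqE.
  by case: (eqVneq s r) hs => [->|_ _]; rewrite ?E // mulr0.
by rewrite big1 // => t _; rewrite !ffunE val_eqE (negPf sq) mul0r.
Qed.

Lemma path_elt_cons v x s : nonzero_path (@gens A) (v, x :: s) ->
  path_elt (v, x :: s) = arr x * path_elt (src x, s).
Proof.
rewrite /nonzero_path /= => /andP[/andP[/eqP <- hs] hI].
have [q hq] : exists q : nzpath A, val q = (tgt x, [:: x]).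
  apply: nz_of => /=; first by rewrite eqxx.
  by apply: contra hI => h; exact: (@in_ideal_sub A [::] [:: x] s).
have [r hr] : exists r : nzpath A, val r = (src x, s).
  apply: nz_of => //; apply: contra hI => h.
  by have := @in_ideal_sub A [:: x] s [::] h; rewrite cats0.
rewrite /arr -hq -hr path_elt_mul; apply/ffunP => p; rewrite !ffunE.
by rewrite /is_prod hq hr /= /path_src /= eqxx.
Qed.

Lemma scalar_mull k (r : R) : scalar A k * r = k *: r.
Proof.
rewrite -[in RHS](mul1r r); apply/ffunP => p; rewrite !ffunE /= scaler_sumr.
apply: eq_bigr => q _; rewrite scaler_sumr; apply: eq_bigr => s _.
by rewrite ffunE -[k *: _]/(k * _) -[k *: _]/(k * _) mulrA.
Qed.

Lemma scalar_mulr k (r : R) : r * scalar A k = k *: r.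
Proof.
rewrite -[in RHS](mulr1 r); apply/ffunP => p; rewrite !ffunE /= scaler_sumr.
apply: eq_bigr => q _; rewrite scaler_sumr; apply: eq_bigr => s _.
by rewrite ffunE -[k *: _]/(k * _) -[k *: (_ * _)]/(k * (_ * _)) mulrCA.
Qed.

Lemma scalar_comm k (r : R) : scalar A k * r = r * scalar A k.
Proof. by rewrite scalar_mull scalar_mulr. Qed.

Lemma scalarM k l : scalar A (k * l) = scalar A k * scalar A l :> R.
Proof. by rewrite scalar_mull /scalar scalerA. Qed.

Lemma scalarD k l : scalar A (k + l) = scalar A k + scalar A l :> R.
Proof. exact: scalerDl. Qed.

Lemma scalar0 : scalar A 0 = 0 :> R. Proof. exact: scale0r. Qed.
Lemma scalar1 : scalar A 1 = 1 :> R. Proof. exact: scale1r. Qed.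
Lemma scalarN k : scalar A (- k) = - scalar A k :> R. Proof. exact: scaleNr. Qed.

Lemma algebra_sum (r : R) : r = \sum_(p : nzpath A) @scalar K A (r p) * path_elt (val p).
Proof.
apply/ffunP => q; rewrite sum_ffunE (bigD1 q) //= big1 => [|p pq].
  by rewrite scalar_mull !ffunE eqxx addr0 -[_ *: _]/(_ * _) mulr1.
by rewrite scalar_mull !ffunE val_eqE eq_sym (negPf pq) scaler0.
Qed.

Section ActOn.
Variables M N : lmodType R.
Variable f : M -> N.
Hypothesis fD : {morph f : m n / m + n}.
Hypothesis fK : forall k m, f (scalar A k *: m) = scalar A k *: f m.
Hypothesis fv : forall v m, f (vtx v *: m) = vtx v *: f m.
Hypothesis fx : forall x m, f (arr x *: m) = arr x *: f m.

(** The algebra is spanned by products of vertices and arrows. *)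
Lemma linear_of_gens : linear f.
Proof.
have f0 : f 0 = 0 by have := fK 0 0; rewrite !scalar0 !scale0r.
have fp (q : vertex A * seq (arrow A)) m : nonzero_path (@gens A) q ->
    f (path_elt q *: m) = path_elt q *: f m.
  case: q => v s; elim: s v m => [|x s IH] v m hq; first exact: fv.
  rewrite path_elt_cons // -!scalerA fx IH //.
  move: hq; rewrite /nonzero_path /= => /andP[/andP[_ ->]] /=; apply: contra => h.
  by have := @in_ideal_sub A [:: x] s [::] h; rewrite cats0.
move=> r m n; rewrite fD; congr (_ + _).
rewrite [r]algebra_sum !scaler_suml (big_morph f fD f0).
apply: eq_bigr => p _; rewrite -!scalerA fK fp //.
by have := valP p; rewrite /= nz_basisP.
Qed.
End ActOn.

Lemma vtx_sum : \sum_(v : vertex A) vtx v = 1 :> R.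
Proof.
apply/ffunP => p; rewrite sum_ffunE ffunE.
case: (eqVneq (val p).2 [::]) => [e|ne].
  rewrite (bigD1 (val p).1) //= big1 => [|v ve]; rewrite ?ffunE /=.
    by rewrite -e -surjective_pairing eqxx addr0.
  case: eqP => h //; case/negP: ve; by rewrite h.
rewrite big1 // => v _; rewrite ffunE; case: eqP => // h.
by rewrite h eqxx in ne.
Qed.

Variable w : string A.
Implicit Type m : string_module K w.

Lemma path_act_notnz v s (a : int -> K) i : is_path v s ->
  ~~ nonzero_path (@gens A) (v, s) -> path_act w (v, s) a i = 0.
Proof.
rewrite /nonzero_path /= => ->; rewrite negbK => h.
by rewrite /path_act /vertex_act /= (foldr_act_ideal (wd_string w)) // if_same.
Qed.

Lemma path_elt_act q m i : is_path q.1 q.2 ->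
  coord (path_elt q *: m) i = path_act w q (coord m) i.
Proof.
move=> hp; rewrite -[LHS]/(alg_act w (path_elt q) (coord m) i) /alg_act.
case h: (nonzero_path (@gens A) q).
  have hq : q \in @nz_basis A by rewrite nz_basisP.
  rewrite (bigD1 (SeqSub hq)) //= big1 => [|p pq].
    by rewrite ffunE /= eqxx mul1r addr0.
  by rewrite ffunE -[q]/(val (SeqSub hq)) val_eqE (negPf pq) mul0r.
rewrite big1 => [|p _].
  by case: q hp h => v s hp h; rewrite path_act_notnz // h.
rewrite ffunE; case: eqP => [e|]; last by rewrite mul0r.
by have := valP p; rewrite /= nz_basisP e /in_mem /= h.
Qed.

Lemma vtx_act v m i : coord (vtx v *: m) i =
  if is_pos w i && (vert w i == v) then coord m i else 0.
Proof. by rewrite path_elt_act. Qed.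

Lemma arr_act x m i : coord (arr x *: m) i =
  \sum_(e : bool) (if step w i e == Some (x, true) then coord m (nb i e) else 0).
Proof.
rewrite path_elt_act /=; last by rewrite eqxx.
rewrite -arrow_actE /path_act /= /vertex_act; case: ifP => // /negP h.
rewrite arrow_actE big1 // => e _; case: eqP => // /(step_ends (wd_string w)).
by rewrite /left_end /= => -[h1 _ h2 _]; case: h; rewrite h1 h2 eqxx.
Qed.

Lemma coordD m n i : coord (m + n) i = coord m i + coord n i.
Proof. by []. Qed.

Lemma scalar_act k m i : coord (scalar A k *: m) i = k * coord m i.
Proof.
rewrite -[in LHS](scale1r m) scalerA mulr1.
have -> : coord (scalar A k *: m) i = \sum_p (scalar A k : R) p * path_act w (val p) (coord m) i by [].
have : coord ((1 : R) *: m) i = coord m i by rewrite scale1r.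
rewrite -{1}[coord _ i]/(\sum_p (1 : R) p * path_act w (val p) (coord m) i) => <-.
by rewrite mulr_sumr; apply: eq_bigr => p _; rewrite !ffunE mulrA.
Qed.

Lemma coord_family m : coord m \in is_family w. Proof. exact: valP. Qed.

Lemma coord_inj m n : coord m =1 coord n -> m = n.
Proof. by move=> h; apply: val_inj; apply/funext. Qed.

End Generators.

(** * Families of coefficients and inverse strings *)

Lemma onth_rev (T : Type) (s : seq T) k : (k < size s)%N ->
  onth (rev s) k = onth s (size s - k.+1).
Proof. by move=> hk; rewrite !onthE map_rev nth_rev size_map. Qed.

Lemma onth_some (T : Type) (s : seq T) k : (k < size s)%N -> exists x, onth s k = Some x.
Proof. by rewrite -onthTE; case: (onth _ _) => // x; exists x. Qed.

Section Families.
Variables (K : fieldType) (A : string_algebra).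
Local Notation R := (algebra K A).
Implicit Types (w : word A).

Definition beyond (e : bool) (n i : int) : bool := if e then n <= i else i <= n.

Definition contracting w (e : bool) : Prop :=
  if e then contracting_right w else contracting_left w.

Lemma is_familyP w (a : int -> K) : a \in is_family w <->
  (forall i, ~~ is_pos w i -> a i = 0) /\
  forall e, contracting w e -> exists n, forall i, beyond e n i -> a i = 0.
Proof.
split=> [/asboolP[h0 hr hl]|[h0 h]].
  by split=> // -[/hr|/hl] [n hn]; exists n.
by apply/asboolP; split=> //; [apply: (h true)|apply: (h false)].
Qed.

Lemma finite_family w (a : int -> K) (l h : int) :
  (forall i, ~~ is_pos w i -> a i = 0) ->
  (forall i, ~~ (l <= i <= h) -> a i = 0) -> a \in is_family w.
Proof.
move=> h0 ha; apply/is_familyP; split=> // -[] _.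
  by exists (h + 1) => i /= hi; apply: ha; lia.
by exists (l - 1) => i /= hi; apply: ha; lia.
Qed.

Lemma word_invK : involutive (@word_inv A).
Proof.
case=> l h v s; rewrite /word_inv /=; congr Word.
- by case: l => //= l; rewrite opprK.
- by case: h => //= h; rewrite opprK.
- by apply/funext => i; rewrite opprK.
- apply/funext => i; have -> : - (- i - 1) - 1 = i :> int by lia.
  by case: (s i) => //= x; rewrite letter_invK.
Qed.

Lemma contracting_inv w e : contracting (word_inv w) e = contracting w (~~ e).
Proof. by case: e; rewrite /contracting /contracting_left //= word_invK. Qed.

Lemma is_pos_inv w i : is_pos (word_inv w) i = is_pos w (- i).
Proof.
rewrite /is_pos /=; case: (lo w) => [l|]; case: (hi w) => [h|] //=; lia.
Qed.

Lemma letter_at_inv w i :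
  letter_at (word_inv w) i = omap (@letter_inv A) (letter_at w (- i - 1)).
Proof.
rewrite /letter_at !is_pos_inv.
have -> : - (i + 1) = - i - 1 :> int by lia.
by rewrite subrK andbC; case: ifP.
Qed.

Lemma step_inv w i e : step (word_inv w) i e = step w (- i) (~~ e).
Proof.
rewrite /step !letter_at_inv; case: e => //=.
have -> : - (i - 1) - 1 = - i :> int by lia.
by case: (letter_at w (- i)) => //= x; rewrite letter_invK.
Qed.

Lemma occurs_inv w i u : occurs (word_inv w) i u ->
  occurs w (- i - (size u)%:Z) (letters_inv u).
Proof.
move=> h k; rewrite /letters_inv size_rev size_map => hk.
have hk' : (size u - k.+1 < size u)%N by lia.
have := h _ hk'; rewrite letter_at_inv.
have -> : - (i + (size u - k.+1)%N%:Z) - 1 = - i - (size u)%:Z + k%:Z by lia.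
have -> : onth (rev (map (@letter_inv A) u)) k = omap (@letter_inv A) (onth u (size u - k.+1)).
  by rewrite onth_rev ?size_map // onth_map.
by move=> <-; case: (letter_at _ _) => //= l; rewrite letter_invK.
Qed.

Lemma letters_invK : involutive (@letters_inv A).
Proof.
by move=> u; rewrite /letters_inv map_rev revK -map_comp map_id_in // => l _ /=;
  rewrite letter_invK.
Qed.

Lemma word_inv_string w : is_string w -> is_string (word_inv w).
Proof.
move=> hw; split.
- by have [i hi] := str_nonempty hw; exists (- i); rewrite is_pos_inv opprK.
- move=> i; rewrite !is_pos_inv /= => h1 h2.
  have h3 : is_pos w (- i - 1) by have -> : - i - 1 = - (i + 1) :> int by lia.
  have h4 : is_pos w (- i - 1 + 1) by rewrite subrK.
  have [l [e1 e2 e3]] := str_walk hw h3 h4; exists (letter_inv l).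
  rewrite subrK in e3; have -> : - (i + 1) = - i - 1 :> int by lia.
  by split; rewrite ?e1 //; move: e2 e3; case: (l) => a [].
- move=> i l; rewrite !letter_at_inv => h1 h2.
  case E1: (letter_at w (- i - 1)) h1 => [m|] //= [hm].
  have e : - (i + 1) - 1 + 1 = - i - 1 :> int by lia.
  case E2: (letter_at w (- (i + 1) - 1)) h2 => [m'|] // h2.
  have hm' : letter_inv m' = letter_inv l by apply: Some_inj.
  by apply: (str_reduced hw E2); rewrite e E1 hm' -hm letter_invK.
- move=> i u s /occurs_inv h [e|e]; apply: (str_nonzero hw h).
    by right; rewrite letters_invK.
  by left.
Qed.

End Families.

(** * Homomorphisms to a string module as families of functionals *)

Section Homs.
Variables (K : fieldType) (A : string_algebra).
Local Notation R := (algebra K A).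

Section Def.
Variables (w : word A) (M : lmodType R).

Definition klinear (f : M -> K) : Prop :=
  {morph f : m n / m + n} /\ forall k m, f (scalar A k *: m) = k * f m.

(** [h i m] is to be the coefficient at [z_i] of the image of [m]; the condition
    at [i] says that this coefficient is compatible with vertices and arrows. *)
Definition hom_at (h : int -> M -> K) (i : int) : Prop :=
  (forall v m, h i (vtx K v *: m) =
     if is_pos w i && (vert w i == v) then h i m else 0) /\
  (forall x m, h i (arr K x *: m) =
     \sum_(e : bool) (if step w i e == Some (x, true) then h (nb i e) m else 0)).

Lemma klinear0 f : klinear f -> f 0 = 0.
Proof. by move=> [_ h]; have := h 0 0; rewrite scalar0 scale0r mul0r. Qed.

Lemma klinearN f m : klinear f -> f (- m) = - f m.
Proof.
by move=> [_ h]; have := h (-1) m; rewrite scalarN scalar1 scaleN1r mulN1r.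
Qed.

Lemma klinear_sum f (I : Type) (s : seq I) (P : pred I) (F : I -> M) :
  klinear f -> f (\sum_(i <- s | P i) F i) = \sum_(i <- s | P i) f (F i).
Proof. by move=> hf; apply: (big_morph f hf.1 (klinear0 hf)). Qed.

Lemma klinear_cst0 : klinear (fun=> 0).
Proof. by split=> [m n|k m]; rewrite ?addr0 ?mulr0. Qed.

Lemma klinear_comb a b f g : klinear f -> klinear g ->
  klinear (fun m => a * f m + b * g m).
Proof.
move=> [f1 f2] [g1 g2]; split=> [m n|k m]; rewrite ?f1 ?g1 ?f2 ?g2.
  by rewrite !mulrDr addrACA.
by rewrite mulrDr !(mulrCA _ k).
Qed.

Lemma hom_at_pos h i m : klinear (h i) -> hom_at h i -> ~~ is_pos w i -> h i m = 0.
Proof.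
move=> hl [hv _] hi; rewrite -(scale1r m) -vtx_sum scaler_suml klinear_sum //.
by rewrite big1 // => v _; rewrite hv (negPf hi).
Qed.

Lemma hom_at0 i : hom_at (fun _ _ => 0) i.
Proof.
split=> [v m|x m]; first by rewrite if_same.
by rewrite big1 // => e _; rewrite if_same.
Qed.

Lemma hom_at_comb a b h g i : hom_at h i -> hom_at g i ->
  hom_at (fun i m => a * h i m + b * g i m) i.
Proof.
move=> [h1 h2] [g1 g2]; split=> [v m|x m]; rewrite ?h1 ?g1 ?h2 ?g2.
  by case: ifP => // _; rewrite !mulr0 addr0.
rewrite !mulr_sumr -big_split; apply: eq_bigr => e _ /=.
by case: ifP => // _; rewrite !mulr0 addr0.
Qed.

(** Only the values at [i] and at its neighbours matter. *)
Lemma hom_at_eq h g i : h i =1 g i ->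
  (forall e x, step w i e = Some (x, true) -> h (nb i e) =1 g (nb i e)) ->
  hom_at h i -> hom_at g i.
Proof.
move=> e1 e2 [h1 h2]; split=> [v m|x m]; rewrite -!e1 ?h1 ?h2 //.
by apply: eq_bigr => e _; case: eqP => // /e2 ->.
Qed.

End Def.

Lemma hom_coord (w : string A) (M : lmodType R) (f : {linear M -> string_module K w}) i :
  klinear (fun m => coord (f m) i) /\ hom_at w (fun i m => coord (f m) i) i.
Proof.
split; split.
- by move=> m n; rewrite raddfD coordD.
- by move=> k m; rewrite linearZ_LR scalar_act.
- by move=> v m; rewrite linearZ_LR vtx_act.
- by move=> x m; rewrite linearZ_LR arr_act.
Qed.

Definition mk_linear (M N : lmodType R) (f : M -> N) (hf : linear f) : {linear M -> N} :=
  HB.pack f (GRing.isLinear.Build R M N *:%R f hf).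

Lemma hom_of_coord (w : string A) (M : lmodType R) (h : int -> M -> K) :
  (forall i, klinear (h i)) -> (forall i, hom_at w h i) ->
  (forall m, h^~ m \in is_family w) ->
  exists f : {linear M -> string_module K w}, forall m i, coord (f m) i = h i m.
Proof.
move=> hl hh hf; pose f m : string_module K w := StringModule (hf m).
have fl : linear f.
  apply: linear_of_gens => [m n|k m|v m|x m]; apply: coord_inj => i.
  - by rewrite coordD /= (hl i).1.
  - by rewrite scalar_act /= (hl i).2.
  - by rewrite vtx_act /= (hh i).1.
  - by rewrite arr_act /= (hh i).2.
by exists (mk_linear fl).
Qed.

End Homs.

Section BasisVectors.
Variables (K : fieldType) (A : string_algebra) (w : string A).

Lemma zvec_family j : (fun i => ((i == j) && is_pos w i)%:R : K) \in is_family w.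
Proof.
apply: (@finite_family _ _ _ _ j j) => i hi; first by rewrite (negPf hi) andbF.
case: eqP => // ij; move: hi; rewrite ij; lia.
Qed.

Definition zvec j : string_module K w := StringModule (zvec_family j).

Lemma coord_zvec j i : coord (zvec j) i = ((i == j) && is_pos w i)%:R.
Proof. by []. Qed.

Lemma arr_zvec x j e : step w j e = Some (x, false) -> arr K x *: zvec j = zvec (nb j e).
Proof.
move=> hj; apply: coord_inj => i; rewrite arr_act coord_zvec.
have [p1 p2 _ _] := step_ends (wd_string w) hj.
case: (eqVneq i (nb j e)) => [->|ne].
  rewrite (bigD1 (~~ e)) //= (step_nb_some hj) eqxx nbK eqxx p1 p2 big1 ?addr0 //.
  move=> d de; case: eqP => // /(step_inj (wd_string w) (step_nb_some hj)) h.
  by rewrite h eqxx in de.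
rewrite big1 // => d _; case: eqP => // hi; rewrite coord_zvec; case: eqP => // hd.
have := step_nb_some hi; rewrite hd => /(step_inj (wd_string w) hj) h.
by move: ne; rewrite h -hd nbK eqxx.
Qed.

Lemma arr_zvec0 x j : (forall e, step w j e <> Some (x, false)) -> arr K x *: zvec j = 0.
Proof.
move=> hj; apply: coord_inj => i; rewrite arr_act big1 // => e _.
case: eqP => // hi; rewrite coord_zvec; case: eqP => // hd.
by case: (hj (~~ e)); rewrite -hd (step_nb_some hi).
Qed.

Lemma vtx_zvec v j : vtx K v *: zvec j = if vert w j == v then zvec j else 0.
Proof.
apply: coord_inj => i; rewrite vtx_act coord_zvec.
case: (eqVneq i j) => [->|ne]; last by rewrite /= if_same; case: ifP => // _; rewrite coord_zvec (negPf ne).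
by case: (vert w j == v); rewrite ?coord_zvec ?eqxx; case: (is_pos w j).
Qed.

End BasisVectors.

Section Inverse.
Variables (K : fieldType) (A : string_algebra).

Lemma string_module_inv (w : string A) :
  isomorphic (string_module K w) (string_module K (String (word_inv_string (wd_string w)))).
Proof.
set w' := String _.
have hI (a : int -> K) : a \in is_family w -> (fun i => a (- i)) \in is_family w'.
  move=> /is_familyP[h1 h2]; apply/is_familyP; split=> [i|e].
    by rewrite is_pos_inv => /h1.
  rewrite contracting_inv => /h2[n hn]; exists (- n) => i hi; apply: hn.
  by move: hi; case: e => /=; lia.
have hI' (a : int -> K) : a \in is_family w' -> (fun i => a (- i)) \in is_family w.
  move=> /is_familyP[h1 h2]; apply/is_familyP; split=> [i hi|e].
    by apply: h1; rewrite is_pos_inv opprK.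
  rewrite -(negbK e) -contracting_inv => /h2[n hn]; exists (- n) => i hi; apply: hn.
  by move: hi; case: e => /=; lia.
have [f hf] : exists f : {linear string_module K w -> string_module K w'},
    forall m i, coord (f m) i = coord m (- i).
  apply: (@hom_of_coord _ _ w' _ (fun i m => coord m (- i))) => [i|i|m].
  - by split=> [m n|k m]; rewrite ?coordD ?scalar_act.
  - split=> [v m|x m]; first by rewrite vtx_act is_pos_inv.
    rewrite arr_act (reindex_inj (can_inj negbK)); apply: eq_bigr => e _ /=.
    rewrite step_inv; have -> // : nb (- i) (~~ e) = - nb i e.
    by case: e; rewrite /nb /=; lia.
  - exact: hI (coord_family m).
exists f; exists (fun m => StringModule (hI' _ (coord_family m))) => m;
  apply: coord_inj => i; rewrite ?hf /= ?hf opprK //.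
Qed.

End Inverse.

(** * Divisible submodules over principal ideal rings *)

Definition submodule (P : pzRingType) (V : lmodType P) (X : V -> Prop) : Prop :=
  X 0 /\ forall q x y, X x -> X y -> X (q *: x + y).

Section Submodule.
Variables (P : pzRingType) (V : lmodType P) (X : V -> Prop).
Hypothesis hX : submodule X.

Lemma submoduleD x y : X x -> X y -> X (x + y).
Proof. by move=> hx hy; rewrite -[x]scale1r; apply: hX.2. Qed.

Lemma submoduleZ q x : X x -> X (q *: x).
Proof. by move=> hx; rewrite -[_ *: _]addr0; apply: hX.2 => //; apply: hX.1. Qed.

Lemma submoduleN x : X x -> X (- x).
Proof. by move=> hx; rewrite -scaleN1r; apply: submoduleZ. Qed.

Lemma submoduleB x y : X x -> X y -> X (x - y).
Proof. by move=> hx hy; apply: submoduleD => //; apply: submoduleN. Qed.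

End Submodule.

Definition principal_ideals (P : comNzRingType) : Prop :=
  forall I : P -> Prop, submodule (I : P^o -> Prop) ->
    exists2 q0, I q0 & forall q, I q -> exists r, q = r * q0.

Definition divisible (P : comNzRingType) (V : lmodType P) (C : V -> Prop) : Prop :=
  forall q b, q != 0 -> C b -> exists2 t, C t & q *: t = b.

(** Baer's criterion: over a ring with principal ideals a divisible submodule is
    injective, hence a direct summand, and the complement can be made to contain
    any submodule that meets it trivially.  A maximal submodule meeting [C]
    trivially is a complement: if [a] were outside the sum, divisibility would
    move [a] modulo [C] to an element that can still be adjoined. *)
Lemma divisible_complement (P : comNzRingType) (V : lmodType P) (C N : V -> Prop) :
  principal_ideals P -> submodule C -> divisible C -> submodule N ->
  (forall x, N x -> C x -> x = 0) ->
  exists D, [/\ submodule D, forall x, N x -> D x, forall x, D x -> C x -> x = 0 &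
    forall a, exists c d, [/\ C c, D d & a = c + d]].
Proof.
move=> hP hC divC hN NC.
pose good (X : set V) := [/\ forall q x y, X x -> X y -> X (q *: x + y),
  forall x, X x -> C x -> x = 0 & forall x y, X x -> N y -> X y].
have [F FP tot|D [[D1 D2 D3] maxD]] := @Zorn_bigcup V good.
  split.
  - move=> q x y [X FX Xx] [Y FY Yy]; have [XY|YX] := tot _ _ FX FY.
      by exists Y => //; have [h _ _] := FP _ FY; apply: h => //; apply: XY.
    by exists X => //; have [h _ _] := FP _ FX; apply: h => //; apply: YX.
  - by move=> x [X FX Xx] Cx; have [_ h _] := FP _ FX; apply: h.
  - by move=> x y [X FX Xx] Ny; exists X => //; have [_ _ h] := FP _ FX; apply: h Xx Ny.
have [x0 Dx0] : exists x, D x.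
  apply: contrapT => D0; apply: (maxD N); last by split; [apply: hN.2|apply: NC|].
  by split=> [x Dx|h]; [case: D0; exists x|case: D0; exists 0; apply: h; apply: hN.1].
have hD : submodule D.
  by split=> //; apply: (D3 x0) => //; apply: hN.1.
exists D; split=> // [x Nx|a]; first exact: D3 Dx0 Nx.
apply: contrapT => ha.
pose I (q : P) := exists c d, [/\ C c, D d & q *: a = c + d].
have hI : submodule (I : P^o -> Prop).
  split; first by exists 0, 0; rewrite scale0r addr0; split=> //; [apply: hC.1|apply: hD.1].
  move=> q x y [c [d [Cc Dd e]]] [c' [d' [Cc' Dd' e']]].
  exists (q *: c + c'), (q *: d + d'); split; [exact: hC.2|exact: hD.2|].
  by rewrite scalerDl -[q *: x]/(q * x) -scalerA e e' scalerDr addrACA.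
have [q0 Iq0 hq0] := hP _ hI.
(* [t] is chosen such that whatever multiple of [a] lies in [C + D], the same multiple
   of [a - t] lies in [D]; for the generator [q0] this is a division in [C] *)
have [t Ct ht] : exists2 t, C t & forall q, I q -> D (q *: (a - t)).
  case: (eqVneq q0 0) => [q00|q0n].
    exists 0; first exact: hC.1.
    by move=> q /hq0[r ->]; rewrite q00 mulr0 scale0r; apply: hD.1.
  have [c [d [Cc Dd e]]] := Iq0; have [t Ct tc] := divC _ _ q0n Cc.
  exists t => // q /hq0[r ->]; rewrite -scalerA scalerBr e tc addrC addKr.
  exact: (submoduleZ hD).
pose D' x := exists d q, D d /\ x = d + q *: (a - t).
apply: (maxD D').
  split=> [x Dx|h]; first by exists x, 0; rewrite scale0r addr0.
  apply: ha; exists t, (a - t); split=> //; last by rewrite addrC subrK.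
  by apply: h; exists 0, 1; rewrite add0r scale1r; split=> //; apply: hD.1.
split.
- move=> q x y [d [r [Dd ->]]] [d' [r' [Dd' ->]]].
  exists (q *: d + d'), (q * r + r'); split; first exact: D1.
  by rewrite scalerDr scalerA addrACA -scalerDl.
- move=> x [d [q [Dd ->]]] Cx.
  have Iq : I q.
    exists (d + q *: (a - t) + q *: t), (- d); split.
    + by apply: (submoduleD hC) => //; apply: (submoduleZ hC).
    + exact: (submoduleN hD).
    + by rewrite scalerBr addrA subrK addrAC subrr add0r.
  by apply: D2 => //; apply: (submoduleD hD) => //; apply: ht.
- move=> x y _ Ny; exists y, 0; rewrite scale0r addr0; split=> //.
  exact: D3 Dx0 Ny.
Qed.

Lemma field_principal_ideals (K : fieldType) : principal_ideals K.
Proof.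
move=> I [I0 hI]; case: (pselect (exists2 q, I q & q != 0)) => [[q Iq q0]|h].
  by exists q => // r _; exists (r / q); rewrite mulfVK.
exists 0 => // q Iq; exists 0; rewrite mulr0; apply/eqP; apply: contrapT => /negP q0.
by apply: h; exists q.
Qed.

Lemma field_divisible (K : fieldType) (V : lmodType K) (C : V -> Prop) :
  submodule C -> divisible C.
Proof.
move=> hC q b q0 Cb; exists (q^-1 *: b); first exact: (submoduleZ hC).
by rewrite scalerA mulfV // scale1r.
Qed.

Lemma poly_principal_ideals (K : fieldType) : principal_ideals {poly K}.
Proof.
move=> I hI; case: (pselect (exists q, I q /\ q != 0)) => [ex|h]; last first.
  exists 0; first exact: hI.1.
  move=> q Iq; exists 0; rewrite mulr0; apply/eqP; apply: contrapT => /negP q0.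
  by apply: h; exists q.
have ex' : exists n, `[< exists q, [/\ I q, q != 0 & size q = n] >].
  by have [q [Iq q0]] := ex; exists (size q); apply/asboolP; exists q.
case: (ex_minnP ex') => n /asboolP[q0 [Iq0 q00 sq0]] min.
exists q0 => // q Iq; exists (q %/ q0); apply/eqP; rewrite -subr_eq0.
have Ir : I (q %% q0).
  have -> : q %% q0 = - (q %/ q0) * q0 + q by rewrite {3}(divp_eq q q0) mulNr addKr.
  exact: (hI.2 (- (q %/ q0)) q0 q).
have : q - q %/ q0 * q0 = q %% q0 by rewrite {1}(divp_eq q q0) addrC addKr.
move=> ->; apply: contrapT => /negP r0.
have := min (size (q %% q0)) (introT (asboolP _) (ex_intro _ _ (And3 Ir r0 erefl))).
by rewrite -sq0 leqNgt ltn_modp q00.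
Qed.

(** * Functionals on sequences *)

Section Functionals.
Variable K : fieldType.

(** A linear functional prescribed on a subspace, the prescription being given by
    its graph [N], extends to the whole space: a complement of the line
    [0 * K] which contains [N] is again a graph. *)
Lemma functional_extension (V : lmodType K) (N : V -> K -> Prop) :
  (forall a v w k l, N v k -> N w l -> N (a *: v + w) (a * k + l)) ->
  (forall k, N 0 k -> k = 0) -> N 0 0 ->
  exists phi : V -> K, [/\ {morph phi : v w / v + w},
    forall a v, phi (a *: v) = a * phi v & forall v k, N v k -> phi v = k].
Proof.
move=> Nlin N0 N00; pose C (p : V * K^o) := p.1 = 0; pose N' (p : V * K^o) := N p.1 p.2.
have hC : submodule C.
  by split=> // q x y; rewrite /C /= => -> ->; rewrite scaler0 addr0.
have [||D [hD ND DC hdec]] := divisible_complement (@field_principal_ideals K) hC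
    (field_divisible hC) (N := N').
- by split=> // q [v k] [w l]; apply: Nlin.
- by move=> [v k]; rewrite /N' /C /= => h v0; move: h; rewrite v0 => /N0 ->.
have Dx v : exists k, D (v, k).
  have [c [[d1 d2] [c0 Dd [-> _]]]] := hdec (v, 0).
  by rewrite c0 add0r; exists d2.
have Duniq v k l : D (v, k) -> D (v, l) -> k = l.
  move=> h1 h2; have := submoduleB hD h1 h2.
  rewrite -[_ - _]/(v - v, k - l) subrr => /DC/(_ erefl)[h].
  by apply/eqP; rewrite -subr_eq0 h.
pose phi v := projT1 (cid (Dx v)).
have Dphi v : D (v, phi v) by rewrite /phi; case: cid.
exists phi; split=> [v w|a v|v k Nvk].
- by apply: (Duniq (v + w)) => //; apply: (submoduleD hD (Dphi v) (Dphi w)).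
- by apply: (Duniq (a *: v)) => //; apply: (submoduleZ hD a (Dphi v)).
- by apply: (Duniq v) => //; apply: ND.
Qed.

Definition seqsp : Type := nat -> K.
HB.instance Definition _ := GRing.Zmodule.on seqsp.

Definition shift_act (q : {poly K}) (a : seqsp) : seqsp :=
  fun k => \sum_(i < size q) q`_i * a (k + i)%N.

Lemma shift_actE n (q : {poly K}) a k : (size q <= n)%N ->
  shift_act q a k = \sum_(i < n) q`_i * a (k + i)%N.
Proof.
move=> h; rewrite /shift_act (big_ord_widen _ (fun i => q`_i * a (k + i)%N) h).
rewrite big_mkcond; apply: eq_bigr => i _; case: ifP => // /negbT.
by rewrite -leqNgt => hi; rewrite nth_default // mul0r.
Qed.

Lemma shift_actDl a : {morph shift_act^~ a : p q / p + q}.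
Proof.
move=> p q; apply/funext => k; pose n := maxn (size (p + q)) (maxn (size p) (size q)).
rewrite -[RHS]/(shift_act p a k + shift_act q a k).
rewrite !(@shift_actE n) ?leq_max ?leqnn ?orbT // -big_split.
by apply: eq_bigr => i _; rewrite coefD mulrDl.
Qed.

Lemma shift_actDr q : {morph shift_act q : a b / a + b}.
Proof.
move=> a b; apply/funext => k; rewrite -[RHS]/(shift_act q a k + shift_act q b k).
by rewrite -big_split; apply: eq_bigr => i _; exact: mulrDr.
Qed.

Lemma shift_actC c a k : shift_act c%:P a k = c * a k.
Proof.
by rewrite (@shift_actE 1) ?size_polyC_leq1 // big_ord1 coefC eqxx addn0.
Qed.

Lemma shift_actMX q a k : shift_act (q * 'X) a k = shift_act q a k.+1.
Proof.
rewrite (@shift_actE (size q).+1); last first.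
  case: (eqVneq q 0) => [->|q0]; first by rewrite mul0r size_poly0.
  by rewrite size_mulX.
rewrite big_ord_recl coefMX /= mul0r add0r; apply: eq_bigr => i _.
by rewrite coefMX /= -addSnnS.
Qed.

Lemma shift_actA p q a : shift_act p (shift_act q a) = shift_act (p * q) a.
Proof.
elim/poly_ind: p q a => [|p c IH] q a; apply/funext => k.
  by rewrite mul0r /shift_act size_poly0 !big_ord0.
rewrite mulrDl !shift_actDl -mulrA ['X * q]mulrC mulrA.
rewrite -[LHS]/(shift_act _ _ k + shift_act _ _ k) -[RHS]/(shift_act _ _ k + shift_act _ _ k).
rewrite !shift_actMX IH shift_actC; congr (_ + _).
rewrite [RHS](@shift_actE (size q)) ?mul_polyC ?size_scale_leq // /shift_act mulr_sumr.
by apply: eq_bigr => i _; rewrite coefZ mulrA.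
Qed.

Lemma shift_act1 : left_id 1 shift_act.
Proof. by move=> a; apply/funext => k; rewrite -[1]/(1%:P) shift_actC mul1r. Qed.

HB.instance Definition _ := GRing.Zmodule_isLmodule.Build {poly K} seqsp
  shift_actA shift_act1 shift_actDr (fun v => @shift_actDl v).

Definition finseq (a : seqsp) : Prop := exists n, forall k, (n <= k)%N -> a k = 0.

Lemma finseq_submodule : submodule (finseq : seqsp -> Prop).
Proof.
split; first by exists 0%N.
move=> q a b [n hn] [m hm]; exists (maxn n m) => k; rewrite geq_max => /andP[hk hk'].
rewrite -[LHS]/(shift_act q a k + b k) hm // addr0 /shift_act big1 // => i _.
by rewrite hn ?mulr0 // (leq_trans hk) ?leq_addr.
Qed.

Lemma shift_act_unit_surj (q : {poly K}) n (b : seqsp) : q`_0 != 0 ->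
  (forall k, (n <= k)%N -> b k = 0) ->
  exists2 t : seqsp, (forall k, (n <= k)%N -> t k = 0) & q *: t = b.
Proof.
move=> q0; elim: n b => [|n IH] b hb.
  by exists 0 => //; rewrite scaler0; apply/funext => k; rewrite hb.
pose t1 : seqsp := fun k => if k == n then b n / q`_0 else 0.
have qt1 k : (n <= k)%N -> (q *: t1) k = if k == n then b n else 0.
  move=> nk; rewrite -[LHS]/(shift_act q t1 k) (@shift_actE (size q).+1) //.
  rewrite big_ord_recl big1 => [|i _]; last by rewrite /t1 lift0 gtn_eqF ?mulr0 // addnS ltnS (leq_trans nk) ?leq_addr.
  by rewrite addr0 addn0 /t1; case: ifP; rewrite ?mulr0 // mulrCA mulfV // mulr1.
have [|t ht qt] := IH (b - q *: t1).
  move=> k nk; rewrite -[LHS]/(b k - (q *: t1) k) qt1 //.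
  by case: eqP => [->|/eqP kn]; rewrite ?subrr // hb ?subrr //; lia.
exists (t1 + t) => [k nk|]; last by rewrite scalerDr qt addrC subrK.
by rewrite -[LHS]/(t1 k + t k) ht ?(ltnW nk) // /t1 gtn_eqF // addr0.
Qed.

(** The finite sequences under the backward shift form the Pruefer module at [0],
    which is divisible. *)
Lemma finseq_divisible : divisible (finseq : seqsp -> Prop).
Proof.
move=> q; elim/poly_ind: q => [|q c IH] b q0 hb; first by rewrite eqxx in q0.
case: (eqVneq c 0) q0 => [->|c0 _].
  rewrite addr0 => qX; have {}q0 : q != 0 by apply: contraNneq qX => ->; rewrite mul0r.
  have [t [n ht] qt] := IH b q0 hb.
  exists (fun k => if k is k'.+1 then t k' else 0).
    by exists n.+1 => -[|k] //= hk; apply: ht.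
  rewrite -scalerA -[RHS]qt; congr (_ *: _); apply/funext => k.
  rewrite -[LHS]/(shift_act 'X _ k) -['X]mul1r shift_actMX -[1]/(1%:P) shift_actC.
  by rewrite mul1r.
have [n hn] := hb; have [||t ht qt] := @shift_act_unit_surj (q * 'X + c%:P) n b.
- by rewrite coefD coefMX coefC add0r.
- exact: hn.
- by exists t => //; exists n.
Qed.

(** A projection onto the finite sequences which commutes with the shift, composed
    with the evaluation at 0: the finite sequences have a complement which is a
    submodule under the shift, by [divisible_complement]. *)
Lemma eventual_functional : exists phi : (nat -> K) -> K,
  [/\ forall a b, phi (fun k => a k + b k) = phi a + phi b,
      forall c a, phi (fun k => c * a k) = c * phi a,
      forall n a, (forall k, (n <= k)%N -> a k = 0) -> phi a = a 0%N &
      forall a, exists n, forall k, (n <= k)%N -> phi (fun j => a (j + k)%N) = 0].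
Proof.
have [||D [hD _ DC hdec]] := divisible_complement (@poly_principal_ideals K)
    finseq_submodule finseq_divisible (N := fun x => x = 0).
- by split=> // q x y -> ->; rewrite scaler0 addr0.
- by [].
have cx (a : seqsp) : exists c : seqsp, finseq c /\ D (a - c).
  have [c [d [hc Dd ->]]] := hdec a; exists c; split=> //.
  by rewrite addrC addKr.
pose f a := projT1 (cid (cx a)).
have ff a : finseq (f a) by rewrite /f; case: cid => c [].
have fD a : D (a - f a) by rewrite /f; case: cid => c [].
have funiq (a b c : seqsp) : finseq b -> D (a - b) -> finseq c -> D (a - c) -> b = c.
  move=> hb h1 hc h2; apply/eqP; rewrite -subr_eq0; apply/eqP; apply: DC.
    by have := submoduleB hD h2 h1; rewrite opprB addrC subrKA.
  exact: (submoduleB finseq_submodule).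
exists (fun a => f a 0%N); split.
- move=> a b; rewrite -[RHS]/((f a + f b : seqsp) 0%N); congr (_ 0%N).
  apply: (funiq (fun k => a k + b k)) => //; first exact: (submoduleD finseq_submodule).
  by have := submoduleD hD (fD a) (fD b); rewrite addrACA -opprD.
- move=> c a; have E : (fun k => c * a k) = c%:P *: (a : seqsp).
    by apply/funext => k; rewrite -[RHS]/(shift_act c%:P a k) shift_actC.
  rewrite -shift_actC -[RHS]/((c%:P *: f a) 0%N) E; congr (_ 0%N).
  apply: (funiq (c%:P *: (a : seqsp))) => //; first exact: (submoduleZ finseq_submodule).
  by rewrite -scalerBr; apply: (submoduleZ hD).
- move=> n a ha; congr (_ 0%N); apply: (funiq a) => //; first by exists n.
  by rewrite subrr; apply: hD.1.
- move=> a; have [n hn] := ff a; exists n => k hk.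
  have E : (fun j => a (j + k)%N) = 'X^k *: (a : seqsp).
    elim: k {hk} => [|k IH]; first by rewrite scale1r; apply/funext => j; rewrite addn0.
    rewrite exprS -scalerA -IH; apply/funext => j.
    rewrite -[RHS]/(shift_act 'X _ j) -['X]mul1r shift_actMX -[1]/(1%:P) shift_actC.
    by rewrite mul1r addSnnS.
  have E' : (fun j => f a (j + k)%N) = 'X^k *: f a.
    elim: k {hk E} => [|k IH]; first by rewrite scale1r; apply/funext => j; rewrite addn0.
    rewrite exprS -scalerA -IH; apply/funext => j.
    rewrite -[RHS]/(shift_act 'X _ j) -['X]mul1r shift_actMX -[1]/(1%:P) shift_actC.
    by rewrite mul1r addSnnS.
  have -> : f (fun j => a (j + k)%N) = (fun j => f a (j + k)%N).
    apply: (funiq (fun j => a (j + k)%N)) => //.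
      by rewrite E'; apply: (submoduleZ finseq_submodule).
    by rewrite E E' -scalerBr; apply: (submoduleZ hD).
  by rewrite /= add0n hn.
Qed.

End Functionals.

(** * Linear compactness *)

Section LinearCompactness.
Variables (K : fieldType) (A : string_algebra).
Local Notation R := (algebra K A).

Section ScalarRestriction.
Variable M : lmodType R.
Definition kspace : Type := M.
HB.instance Definition _ := GRing.Zmodule.on kspace.

Definition kscale (k : K) (m : kspace) : kspace := scalar A k *: (m : M).
Lemma kscaleA k l m : kscale k (kscale l m) = kscale (k * l) m.
Proof. by rewrite /kscale scalerA scalarM. Qed.
Lemma kscale1 : left_id 1 kscale.
Proof. by move=> m; rewrite /kscale scalar1 scale1r. Qed.
Lemma kscaleDr : right_distributive kscale +%R.
Proof. by move=> k m n; rewrite /kscale scalerDr. Qed.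
Lemma kscaleDl m : {morph kscale^~ m : k l / k + l}.
Proof. by move=> k l; rewrite /kscale scalarD scalerDl. Qed.
HB.instance Definition _ := GRing.Zmodule_isLmodule.Build K kspace
  kscaleA kscale1 kscaleDr kscaleDl.
End ScalarRestriction.

Variable M : lmodType R.
Implicit Types (L : seq (int * M)) (h : int -> M -> K).

(** A linear form in the unknown functionals [h i], and its value. *)
Definition form_eval h L : K := \sum_(p <- L) h p.1 p.2.
Definition form_fun L : int -> kspace M := fun i => \sum_(p <- L | p.1 == i) p.2.
Definition form_scale (k : K) L := [seq (p.1, scalar A k *: p.2) | p <- L].

Lemma form_fun_cat L L' : form_fun (L ++ L') = form_fun L + form_fun L'.
Proof. by apply/funext => i; rewrite /form_fun big_cat. Qed.

Lemma form_fun_scale k L : form_fun (form_scale k L) = k *: form_fun L.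
Proof.
by apply/funext => i; rewrite /form_fun big_map; exact: (esym (scaler_sumr _ _ _ _)).
Qed.

Lemma form_eval_fun h L (J : seq int) : (forall i, klinear (h i)) -> uniq J ->
  {subset [seq p.1 | p <- L] <= J} ->
  form_eval h L = \sum_(i <- J) h i (form_fun L i).
Proof.
move=> hl uJ LJ; rewrite /form_eval /form_fun.
under [RHS]eq_bigr => i _ do rewrite (klinear_sum _ _ _ (hl i)).
rewrite (exchange_big_dep predT) //= big_seq [RHS]big_seq; apply: eq_bigr => p pL.
rewrite big_mkcond (bigD1_seq p.1) //=; last by apply: LJ; apply: map_f.
by rewrite eqxx big1 ?addr0 // => i ip; rewrite eq_sym (negPf ip).
Qed.

Section System.
Variable E : seq (int * M) -> K -> Prop.
Hypothesis Escale : forall k L c, E L c -> E (form_scale k L) (k * c).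

(** A system of linear equations in functionals is solvable as soon as no linear
    combination of its equations reads 0 = 1. *)
Lemma consistent_solvable :
  (forall s : seq (seq (int * M) * K), (forall p, p \in s -> E p.1 p.2) ->
     form_fun (flatten [seq p.1 | p <- s]) = 0 -> \sum_(p <- s) p.2 = 0) ->
  exists h, (forall i, klinear (h i)) /\ forall L c, E L c -> form_eval h L = c.
Proof.
move=> cons; pose N (v : int -> kspace M) (k : K) := exists s : seq (seq (int * M) * K),
  [/\ forall p, p \in s -> E p.1 p.2, v = form_fun (flatten [seq p.1 | p <- s]) &
      k = \sum_(p <- s) p.2].
have [| | |phi [phiD phiZ phiN]] := @functional_extension K (int -> kspace M) N.
- move=> a v w k l [s [hs -> ->]] [t [ht -> ->]].
  exists ([seq (form_scale a p.1, a * p.2) | p <- s] ++ t); split.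
  + move=> p; rewrite mem_cat => /orP[/mapP[q /hs qs ->]|/ht //].
    exact: Escale.
  + rewrite map_cat flatten_cat form_fun_cat -map_comp; congr (_ + _).
    rewrite -form_fun_scale /form_scale map_flatten -map_comp.
    by congr (form_fun (flatten _)); apply: eq_map.
  + by rewrite big_cat big_map mulr_sumr.
- by move=> k [s [hs /esym e ->]]; apply: cons e.
- exists [::]; rewrite big_nil; split=> //; apply/funext => i.
  by rewrite /form_fun big_nil.
pose single i (m : M) : int -> kspace M := fun j => if i == j then m else 0.
exists (fun i m => phi (single i m)); split=> [i|L c ELc].
  split=> [m n|k m]; rewrite -?phiD -?phiZ; congr phi; apply/funext => j.
    change (single i (m + n) j = single i m j + single i n j :> M).
    by rewrite /single; case: ifP; rewrite ?addr0.
  change (single i (scalar A k *: m) j = scalar A k *: (single i m j : M)).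
  by rewrite /single; case: ifP; rewrite ?scaler0.
have phi0 : phi 0 = 0 by have := phiZ 0 0; rewrite scale0r mul0r.
rewrite /form_eval -(big_morph phi phiD phi0); apply: phiN.
exists [:: (L, c)]; rewrite big_seq1 /= cats0; split=> //.
  by move=> p; rewrite inE => /eqP ->.
clear -L; elim: L => [|p L IH]; apply/funext => j.
  by rewrite big_nil /form_fun big_nil.
rewrite big_cons IH /form_fun big_cons -/(form_fun L j).
change (single p.1 p.2 j + form_fun L j = if p.1 == j then p.2 + form_fun L j else form_fun L j).
by rewrite /single; case: ifP; rewrite ?add0r.
Qed.

Lemma finitely_solvable :
  (forall s : seq (seq (int * M) * K), (forall p, p \in s -> E p.1 p.2) ->
     exists h, (forall i, klinear (h i)) /\
       forall p, p \in s -> form_eval h p.1 = p.2) ->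
  exists h, (forall i, klinear (h i)) /\ forall L c, E L c -> form_eval h L = c.
Proof.
move=> fin; apply: consistent_solvable => s /fin[h [hl hs]] e.
pose L := flatten [seq p.1 | p <- s].
have -> : \sum_(p <- s) p.2 = form_eval h L.
  rewrite /form_eval /L big_flatten big_map big_seq [RHS]big_seq.
  by apply: eq_bigr => p /hs.
rewrite (form_eval_fun hl (undup_uniq [seq p.1 | p <- L])); last first.
  by move=> i; rewrite mem_undup.
by rewrite e big1 // => i _; apply: klinear0.
Qed.

End System.
End LinearCompactness.

(** * Periodic tails *)

Section Tails.
Variable A : string_algebra.
Implicit Types (w : word A) (e d : bool).

Definition sh e (n : nat) (i : int) : int := if e then i + n%:Z else i - n%:Z.
Definition ray e (p i : int) : bool := if e then p <= i else i <= p.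

Lemma sh_nb e d n i : sh e n (nb i d) = nb (sh e n i) d.
Proof. by case: e; case: d; rewrite /sh /nb; lia. Qed.

Lemma sh_add e m n i : sh e (m + n) i = sh e m (sh e n i).
Proof. by case: e; rewrite /sh; lia. Qed.

Lemma sh0 e i : sh e 0 i = i.
Proof. by case: e; rewrite /sh; lia. Qed.

Lemma ray_sh e p n i : ray e p i -> ray e p (sh e n i).
Proof. by case: e; rewrite /ray /sh; lia. Qed.

Lemma sh_opp e n i : - sh e n i = sh (~~ e) n (- i).
Proof. by case: e; rewrite /sh /=; lia. Qed.

Lemma ray_opp e p i : ray (~~ e) (- p) i = ray e p (- i).
Proof. by case: e; rewrite /ray /=; lia. Qed.

Lemma rayP e p i : reflect (exists n, i = sh e n p) (ray e p i).
Proof.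
apply: (iffP idP) => [h|[n ->]]; last by case: e; rewrite /ray /sh; lia.
by exists `|i - p|%N; move: h; case: e; rewrite /ray /sh; lia.
Qed.

Lemma ray_nb e p i : ray e p i -> ray e p (nb i e).
Proof. by case: e; rewrite /ray /nb; lia. Qed.

Lemma ray_nbV e p i : ray e p i -> i <> p -> ray e p (nb i (~~ e)).
Proof. by case: e; rewrite /ray /nb /=; lia. Qed.

Lemma ray_nbN e p : ray e p (nb p (~~ e)) = false.
Proof. by case: e; rewrite /ray /nb /=; lia. Qed.

(** In the direction [e], the first period begins at [p]; a letter before [p] that
    continued the repetition backwards is excluded.  For [b = true] the tail is
    contracting: the arrow which links the second period to the first one runs
    towards the first, while the arrow linking [p] to an earlier position, if there is
    one, runs towards [p].  For [b = false] both are reversed and the tail is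
    expanding.  That the two differ is what makes the shift by one period, cut
    off at [p], compatible with the action of the arrows. *)
Record tail w e (p : int) (L : nat) (b : bool) : Prop := Tail {
  tail_L : (0 < L)%N;
  tail_pos : forall i, ray e p i -> is_pos w i;
  tail_step : forall i, ray e p i -> step w (sh e L i) e = step w i e;
  tail_wrap : exists a, step w (sh e L p) (~~ e) = Some (a, ~~ b);
  tail_start : forall z, step w p (~~ e) = Some z -> z.2 = b
}.

Lemma tail_inv w e p L b : tail (word_inv w) e p L b -> tail w (~~ e) (- p) L b.
Proof.
move=> [h1 h2 h3 h4 h5]; split=> //.
- by move=> i; rewrite ray_opp => /h2; rewrite is_pos_inv opprK.
- by move=> i; rewrite ray_opp => /h3; rewrite !step_inv sh_opp opprK.
- by have [a] := h4; rewrite step_inv sh_opp => ?; exists a.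
- by move=> z; rewrite -step_inv; apply: h5.
Qed.

Lemma right_tail_tail w p u a b : is_string w -> right_tail w p u ->
  onth u (size u).-1 = Some (a, b) -> tail w true p (size u) b.
Proof.
move=> hw [hinf hp [u0 _] hu hb] hlast.
have hpos i : p <= i -> is_pos w i.
  by move: hp; rewrite /is_pos hinf; case: (lo w) => [l|] //; lia.
have hl (k : nat) : letter_at w (p + k%:Z) = onth u (k %% size u)%N.
  by rewrite /letter_at !hpos ?hu //; lia.
have hwrap : step w (sh true (size u) p) false = Some (a, ~~ b).
  rewrite /step /sh; have -> : p + (size u)%:Z - 1 = p + (size u).-1%:Z by lia.
  by rewrite hl modn_small ?hlast //; lia.
split=> //.
- move=> i /rayP[n ->]; rewrite /step /sh.
  have -> : p + n%:Z + (size u)%:Z = p + (n + size u)%N%:Z by lia.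
  by rewrite !hl modnDr.
- by exists a.
- move=> z hz /=; apply/eqP; apply: contraTT isT => zb.
  have h0 : step w p true = onth u 0 by have := hl 0%N; rewrite addr0 mod0n.
  have [x hx] : exists x, onth u 0 = Some x by clear -u0; case: u u0 => [//|x u] _; exists x.
  have hL : step w (sh true (size u) p) true = Some x.
    by rewrite /step /sh hl modnn.
  have E : z = (a, ~~ b).
    apply: (step_unique hw hw _ hL hz hwrap); first by rewrite h0.
    by move: zb; rewrite /=; case: (z.2) (b) => [] [].
  have [_ hp' _ _] := step_ends hw hz.
  case: hb => [hlo|[_ []]].
    by move: hp'; rewrite /is_pos /nb /= hlo; lia.
  rewrite hlast; move: hz; rewrite /step /letter_at /=; case: ifP => // _.
  case: (lett w (p - 1)) => [[y c]|] //= [hy]; rewrite E in hy.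
  by case: hy => <- hc; rewrite -(negbK c) hc negbK.
Qed.

Lemma contracting_tail w e : is_string w -> contracting w e ->
  exists p L, tail w e p L true.
Proof.
move=> hw; case: e => [[p [u [a [h1 h2]]]]|[p [u [a [h1 h2]]]]].
  by exists p, (size u); apply: right_tail_tail h2.
exists (- p), (size u); apply: (tail_inv (e := true)).
by apply: right_tail_tail h2 => //; apply: word_inv_string.
Qed.

Section TailTheory.
Variables (w : word A) (e : bool) (p : int) (L : nat) (b : bool).
Hypotheses (hw : is_string w) (ht : tail w e p L b).

Lemma tail_stepM k i : ray e p i -> step w (sh e (k * L) i) e = step w i e.
Proof.
move=> hi; elim: k => [|k IH]; first by rewrite mul0n sh0.
by rewrite mulSn sh_add (tail_step ht) //; apply: ray_sh.
Qed.

Lemma tail_vertM k i : ray e p i -> vert w (sh e (k * L) i) = vert w i.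
Proof.
move=> hi; have [l hl] := step_some hw (tail_pos ht hi) (tail_pos ht (ray_nb hi)).
have [_ _ <- _] := step_ends hw hl.
by rewrite -(tail_stepM k hi) in hl; have [_ _ <- _] := step_ends hw hl.
Qed.

Lemma tail_stepM_back k i : ray e p i -> i <> p ->
  step w (sh e (k * L) i) (~~ e) = step w i (~~ e).
Proof.
move=> hi ip; have hj := ray_nbV hi ip.
have := tail_stepM k hj; rewrite sh_nb !step_nbn.
case: (step w (sh _ _ _) (~~ e)) => [l|]; case: (step w i (~~ e)) => [l'|] //= h.
have hl : letter_inv l = letter_inv l' by apply: Some_inj.
by rewrite -(letter_invK l) hl letter_invK.
Qed.

Lemma tail_wrapM k : (0 < k)%N -> exists a, step w (sh e (k * L) p) (~~ e) = Some (a, ~~ b).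
Proof.
case: k => // k _; have [a ha] := tail_wrap ht; exists a.
rewrite mulSn addnC sh_add tail_stepM_back //.
  by apply: ray_sh; case: (e); rewrite /ray.
by have := tail_L ht; case: (e); rewrite /sh; lia.
Qed.

End TailTheory.
End Tails.

Section Retraction.
Variables (K : fieldType) (A : string_algebra) (w : word A) (M : lmodType (algebra K A)).
Variables (e : bool) (p : int) (L : nat).
Hypotheses (hw : is_string w) (ht : tail w e p L true).

(** Along a contracting tail the arrows between consecutive periods act by the
    backward shift of sequences, so replacing the coefficients by the finite
    parts of these sequences is a module homomorphism: the string module is a
    retract of the module of all families. *)
Lemma contracting_retraction (h : int -> M -> K) :
  (forall i, klinear (h i)) -> (forall i, hom_at w h i) ->
  exists h' : int -> M -> K, [/\ forall i, klinear (h' i), forall i, hom_at w h' i,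
    forall m, exists n, forall i, beyond e n i -> h' i m = 0,
    forall m, (exists n, forall i, beyond e n i -> h i m = 0) -> h'^~ m =1 h^~ m &
    forall i, ~~ ray e p i -> h' i =1 h i].
Proof.
move=> hl hh; have [phi [phiD phiZ phi_fin phi_ev]] := eventual_functional K.
have phi0 : phi (fun=> 0) = 0 by apply: (phi_fin 0%N).
pose s i m k := h (sh e (k * L) i) m.
have L0 := tail_L ht.
(* the values at the positions beyond [i] congruent to it modulo [L] form the sequence
   [s i m], which [phi] replaces by the value at [i] of its finite part *)
pose h' i m := if ray e p i then phi (s i m) else h i m.
exists h'; split.
- move=> i; rewrite /h'; case: (ray e p i); last exact: hl.
  split=> [m n|k m].
    by rewrite -phiD; congr phi; apply/funext => k; rewrite /s (hl _).1.
  by rewrite -phiZ; congr phi; apply/funext => j; rewrite /s (hl _).2.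
- move=> i; case hi: (ray e p i); last first.
    apply: hom_at_eq (hh i) => [m|d x hx m]; first by rewrite /h' hi.
    rewrite /h'; case hn: (ray e p (nb i d)) => //; exfalso.
    have [de ip] : d = e /\ nb i d = p.
      by move: hi hn; case: (e); case: (d); rewrite /ray /nb; split=> //; lia.
    have := step_nb_some hx; rewrite ip de => /(tail_start ht).
    by [].
  split=> [v m|x m]; rewrite /h' hi.
    rewrite (tail_pos ht hi) /=; case: ifP => hv.
      by congr phi; apply/funext => k; rewrite /s (hh _).1 (tail_vertM hw ht) // hv
        (tail_pos ht) //; apply: ray_sh.
    by rewrite -phi0; congr phi; apply/funext => k; rewrite /s (hh _).1
      (tail_vertM hw ht) // hv andbF.
  transitivity (\sum_d phi (fun k => if step w (sh e (k * L) i) d == Some (x, true)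
      then h (nb (sh e (k * L) i) d) m else 0)).
    rewrite big_bool /= -phiD; congr phi; apply/funext => k.
    by rewrite /s (hh _).2 big_bool.
  apply: eq_bigr => d _; case: (eqVneq d e) => [->|de].
    rewrite (ray_nb hi) -[RHS](_ : phi (fun k => if step w i e == Some (x, true)
        then s (nb i e) m k else 0) = _).
      by congr phi; apply/funext => k; rewrite (tail_stepM ht) // /s sh_nb.
    by case: ifP => _; rewrite ?phi0.
  have -> : d = ~~ e by move: de; case: (d); case: (e).
  case: (eqVneq i p) => [ip|ip].
    rewrite ip ray_nbN -[RHS](_ : phi (fun k => if k is 0%N then
      if step w p (~~ e) == Some (x, true) then h (nb p (~~ e)) m else 0 else 0) = _).
      congr phi; apply/funext => -[|k]; first by rewrite mul0n sh0.
      have [a ->] := tail_wrapM ht (ltn0Sn k).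
      by case: eqP => // -[].
    by rewrite (phi_fin 1%N) // => -[].
  have ip' : i <> p by apply/eqP.
  rewrite (ray_nbV hi ip') -[RHS](_ : phi (fun k => if step w i (~~ e) == Some (x, true)
      then s (nb i (~~ e)) m k else 0) = _).
    by congr phi; apply/funext => k; rewrite (tail_stepM_back ht) // /s sh_nb.
  by case: ifP => _; rewrite ?phi0.
- move=> m; have /choice[N hN] (r : nat) := phi_ev (s (sh e r p) m).
  (* every position far out differs by many periods from one of the first [L] *)
  pose B := (\max_(r < L) N r).+1; exists (sh e (B * L) p) => i hi.
  have [t it] : exists t, i = sh e (t + B * L)%N p.
    exists `|i - sh e (B * L) p|%N; move: hi; rewrite /beyond /sh.
    by case: (e); move: (B * L)%N => c; lia.
  rewrite /h' it; have -> : ray e p (sh e (t + B * L) p) by apply/rayP; exists (t + B * L)%N.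
  rewrite -[RHS](hN (t %% L)%N (t %/ L + B)%N).
    congr phi; apply/funext => j; rewrite /s -!sh_add; congr (h (sh e _ p) m).
    by rewrite {1}(divn_eq t L) !mulnDl; lia.
  rewrite /B; have := leq_bigmax (F := fun r : 'I_L => N r) (Ordinal (ltn_pmod t L0)).
  by move=> /leq_trans; apply; rewrite addnS leqW ?leq_addl.
- move=> m [n hn] i; rewrite /h'; case: ifP => // hi.
  rewrite (phi_fin (`|n - i|%N)); first by rewrite /s mul0n sh0.
  move=> k hk; apply: hn; move: hk; rewrite /beyond /sh; have : (k <= k * L)%N by rewrite leq_pmulr.
  by move: (k * L)%N => c; case: (e); lia.
- by move=> i /negPf hi m; rewrite /h' hi.
Qed.

End Retraction.

(** * Pure-injectivity of string modules *)

Section Relations.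
Variables (K : fieldType) (A : string_algebra) (w : word A).
Local Notation R := (algebra K A).

(** The conditions [hom_at] as linear relations over the algebra: such a relation
    [s] asks the sum of the [h q.1 (q.2 *: m)] over [q] in [s] to vanish. *)
Inductive hom_rel (i : int) : seq (int * R) -> Prop :=
| HomRelVtx v : hom_rel i
    [:: (i, vtx K v); (i, if is_pos w i && (vert w i == v) then -1 else 0)]
| HomRelArr x : hom_rel i
    ((i, arr K x) :: [seq (nb i e, if step w i e == Some (x, true) then -1 else 0)
                     | e <- [:: true; false]]).

Variable M : lmodType R.

Definition hom_rel_eval (h : int -> M -> K) (s : seq (int * R)) (m : M) : K :=
  \sum_(q <- s) h q.1 (q.2 *: m).

Lemma hom_at_rel (h : int -> M -> K) i : (forall i, klinear (h i)) ->
  hom_at w h i <-> forall s m, hom_rel i s -> hom_rel_eval h s m = 0.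
Proof.
move=> hl.
have sgn (b : bool) j m : h j ((if b then -1 else 0 : R) *: m) = - (if b then h j m else 0).
  by case: b; rewrite ?scaleN1r ?scale0r ?klinearN ?klinear0 ?oppr0.
split=> [[hv hx] s m|H].
  case=> [v|x]; rewrite /hom_rel_eval /= !big_cons big_nil /= !sgn.
    by rewrite hv addr0 subrr.
  by rewrite hx big_bool /= addr0 -opprD subrr.
split=> [v m|x m].
  have := H _ m (HomRelVtx i v).
  rewrite /hom_rel_eval /= !big_cons big_nil /= !sgn addr0 => /eqP.
  by rewrite subr_eq0 => /eqP.
have := H _ m (HomRelArr i x).
rewrite /hom_rel_eval /= !big_cons big_nil /= !sgn addr0 -opprD => /eqP.
by rewrite subr_eq0 big_bool => /eqP.
Qed.

Definition hom_form (s : seq (int * R)) (m : M) : seq (int * M) :=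
  [seq (q.1, q.2 *: m) | q <- s].

Lemma hom_form_scale k s m : form_scale k (hom_form s m) = hom_form s (scalar A k *: m).
Proof.
rewrite /form_scale /hom_form -map_comp; apply: eq_map => q /=.
by rewrite !scalerA scalar_comm.
Qed.

Lemma hom_form_eval h s m : form_eval h (hom_form s m) = hom_rel_eval h s m.
Proof. by rewrite /form_eval big_map. Qed.

End Relations.

Section PureInjective.
Variables (K : fieldType) (A : string_algebra).
Local Notation R := (algebra K A).

(** A homomorphism to the module of all families extends along a pure embedding:
    by linear compactness only finitely many of the conditions on the extension
    matter at a time, and these form a finite system of linear equations over the
    algebra with constants in the submodule. *)
Lemma extend_family (w : word A) (X Y : lmodType R) (f : {linear X -> Y})
    (g : int -> X -> K) :
  pure_embedding f -> (forall i, klinear (g i)) -> (forall i, hom_at w g i) ->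
  exists h : int -> Y -> K, [/\ forall i, klinear (h i), forall i, hom_at w h i &
    forall i x, h i (f x) = g i x].
Proof.
move=> fpure gl gh.
pose rel (s : seq (int * R)) := s = [::] \/ exists i, hom_rel w i s.
pose E (F : seq (int * Y)) c := exists s y i x,
  [/\ rel s, F = hom_form s y ++ [:: (i, f x)] & c = g i x].
have [||h [hl hE]] := @consistent_solvable _ _ Y E.
- move=> k F c [s [y [i [x [hs -> ->]]]]].
  exists s, (scalar A k *: y), i, (scalar A k *: x); split=> //; last by rewrite (gl i).2.
  by rewrite -hom_form_scale /form_scale map_cat /= linearZ_LR.
- move=> S hS e.
  have /choice[z hz] (p : seq (int * Y) * K) : exists z : seq (int * R) * Y * int * X,
      p \in S -> [/\ rel z.1.1.1, p.1 = hom_form z.1.1.1 z.1.1.2 ++ [:: (z.1.2, f z.2)] &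
        p.2 = g z.1.2 z.2].
    case: (pselect (p \in S)) => [pS|npS]; last by exists ([::], 0, 0, 0).
    by have [s [y [i [x ?]]]] := hS _ pS; exists (s, y, i, x).
  pose p0 : seq (int * Y) * K := ([::], 0); pose n := size S.
  pose t (k : 'I_n) := z (nth p0 S k).
  have ht (k : 'I_n) : [/\ rel (t k).1.1.1,
      (nth p0 S k).1 = hom_form (t k).1.1.1 (t k).1.1.2 ++ [:: ((t k).1.2, f (t k).2)] &
      (nth p0 S k).2 = g (t k).1.2 (t k).2] by apply: hz; apply: mem_nth.
  pose J := undup (flatten [seq (t k).1.2 :: [seq q.1 | q <- (t k).1.1.1] | k <- enum 'I_n]).
  have tJ k : (t k).1.2 \in J.
    rewrite mem_undup; apply/flattenP; eexists; first by apply/mapP; exists k; rewrite ?mem_enum.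
    by rewrite inE eqxx.
  have qJ k q : q \in (t k).1.1.1 -> q.1 \in J.
    move=> hq; rewrite mem_undup; apply/flattenP; eexists.
      by apply/mapP; exists k; rewrite ?mem_enum.
    by rewrite inE map_f ?orbT.
  pose r j (k : 'I_n) : R := - \sum_(q <- (t k).1.1.1 | q.1 == j) q.2.
  pose c j : X := \sum_(k < n | (t k).1.2 == j) (t k).2.
  have sys j : \sum_(k < n) r j k *: (t k).1.1.2 = f (c j).
    have : form_fun (flatten [seq p.1 | p <- S]) j = 0 by rewrite e.
    rewrite /form_fun big_flatten big_map (big_nth p0) big_mkord.
    under eq_bigr => k _.
      have [_ -> _] := ht k.
      rewrite big_cat big_map /= big_mkcond /= big_cons big_nil /=.
      over.
    rewrite big_split /= => /eqP; rewrite addr_eq0 => /eqP h.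
    rewrite /c raddf_sum [RHS]big_mkcond /=.
    transitivity (- \sum_(k < n) \sum_(q <- (t k).1.1.1)
        (if q.1 == j then q.2 *: (t k).1.1.2 else 0)).
      rewrite -sumrN; apply: eq_bigr => k _; rewrite /r scaleNr; congr (- _).
      by rewrite scaler_suml big_mkcond.
    rewrite h opprK; apply: eq_bigr => k _; by case: ifP => // _; rewrite addr0.
  (* for each of the finitely many positions [j] one equation over the algebra, with
     unknowns the elements of [Y] occurring in the relations *)
  have [|x hx] := fpure (size J) n (fun a k => r J`_a k) (fun a => c J`_a).
    by exists (fun k => (t k).1.1.2) => a; apply: sys.
  transitivity (\sum_(j <- J) g j (c j)).
    rewrite (big_nth p0) big_mkord.
    under [RHS]eq_bigr => j _ do rewrite (klinear_sum _ _ _ (gl j)).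
    rewrite (exchange_big_dep predT) //=; apply: eq_bigr => k _.
    have [_ _ ->] := ht k; rewrite big_mkcond (bigD1_seq (t k).1.2) ?undup_uniq //=.
    by rewrite eqxx big1 ?addr0 // => j hj; rewrite eq_sym (negPf hj).
  rewrite (big_nth 0) big_mkord.
  under eq_bigr => a _.
    rewrite -hx (klinear_sum _ _ _ (gl _)).
    over.
  rewrite /= exchange_big /= big1 // => k _.
  rewrite -(big_mkord predT (fun a => g J`_a (r J`_a k *: x k))) -(big_nth 0 predT (fun j => g j (r j k *: x k))).
  under eq_bigr => j _.
    rewrite /r scaleNr klinearN // scaler_suml (klinear_sum _ _ _ (gl _)).
    over.
  rewrite sumrN (exchange_big_dep predT) //=.
  apply/eqP; rewrite oppr_eq0; apply/eqP.
  transitivity (hom_rel_eval g (t k).1.1.1 (x k)).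
    rewrite /hom_rel_eval big_seq [RHS]big_seq; apply: eq_bigr => q hq.
    rewrite big_mkcond (bigD1_seq q.1) ?undup_uniq ?(qJ k) //=.
    by rewrite eqxx big1 ?addr0 // => j hj; rewrite eq_sym (negPf hj).
  have [[->|[i hi]] _ _] := ht k; first by rewrite /hom_rel_eval big_nil.
  exact: ((hom_at_rel w i gl).1 (gh i) _ (x k) hi).
exists h; split=> // [i|i x].
  apply/(hom_at_rel w i hl) => s y hs; rewrite -hom_form_eval.
  have := hE (hom_form s y ++ [:: (0, f 0)]) 0.
  rewrite /form_eval big_cat big_seq1 /= linear0 (klinear0 (hl 0)) addr0; apply.
  exists s, y, 0, 0; rewrite linear0 (klinear0 (gl 0)); split=> //.
  by right; exists i.
have := hE [:: (i, f x)] (g i x); rewrite /form_eval big_seq1; apply.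
by exists [::], 0, i, x; split=> //; left.
Qed.

(** On each contracting side the extension to the module of all families is
    pushed back to the string module by the retraction. *)
Lemma string_module_pure_injective (w : string A) : pure_injective (string_module K w).
Proof.
move=> X Y f g fpure; pose gc i x := coord (g x) i.
have gl i : klinear (gc i) by have [] := hom_coord g i.
have gh i : hom_at w gc i by have [] := hom_coord g i.
have [h [hl hh hg]] := extend_family fpure gl gh.
pose fin e (a : int -> K) := exists n, forall i, beyond e n i -> a i = 0.
have retract e (h1 : int -> Y -> K) : (forall i, klinear (h1 i)) -> (forall i, hom_at w h1 i) ->
    (forall i x, h1 i (f x) = gc i x) ->
    exists h2 : int -> Y -> K, [/\ forall i, klinear (h2 i), forall i, hom_at w h2 i,
      forall i x, h2 i (f x) = gc i x,
      contracting w e -> forall y, fin e (h2^~ y) &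
      forall y, fin (~~ e) (h1^~ y) -> fin (~~ e) (h2^~ y)].
  move=> l1 hm1 e1; case: (pselect (contracting w e)) => [ce|nce]; last by exists h1.
  have [p [L ht]] := contracting_tail (wd_string w) ce.
  have [h2 [l2 hm2 fin2 fix2 off2]] := contracting_retraction (wd_string w) ht l1 hm1.
  exists h2; split=> // [i x|y [n hn]].
    rewrite (fix2 (f x)) ?e1 //.
    have /is_familyP[_ /(_ e ce)[n hn]] := coord_family (g x).
    by exists n => j hj; rewrite e1; apply: hn.
  pose n' := if e then Num.min n (p - 1) else Num.max n (p + 1).
  exists n' => i hi; rewrite off2; first by apply: hn; move: hi; rewrite /n'; case: (e) => /=; lia.
  by move: hi; rewrite /n' /ray; case: (e) => /=; lia.
have [h1 [l1 hm1 e1 fin1 _]] := retract true h hl hh hg.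
have [h2 [l2 hm2 e2 fin2 keep2]] := retract false h1 l1 hm1 e1.
have [|F hF] := @hom_of_coord _ _ w Y h2 l2 hm2.
  move=> y; apply/is_familyP; split=> [i hi|[] c].
  - by apply: hom_at_pos (hm2 i) hi.
  - exact: keep2 (fin1 c y).
  - exact: fin2.
by exists F => x; apply: coord_inj => i; rewrite hF e2.
Qed.

End PureInjective.

(** * The order on positions *)

Section LocalRules.
Variables (K : fieldType) (A : string_algebra) (y : string A).

Lemma arr_act_in x i d (m : string_module K y) :
  step y i d = Some (x, true) -> coord (arr K x *: m) i = coord m (nb i d).
Proof.
move=> hi; rewrite arr_act (bigD1 d) //= hi eqxx big1 ?addr0 // => d' dd.
case: eqP => // /(step_inj (wd_string y) hi) h; by rewrite h eqxx in dd.
Qed.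

Lemma arr_act_out x i (m : string_module K y) :
  (forall d, step y i d <> Some (x, true)) -> coord (arr K x *: m) i = 0.
Proof. by move=> h; rewrite arr_act big1 // => d _; case: eqP => // /h. Qed.

Variables (v : string A) (F : {linear string_module K v -> string_module K y}).
Local Notation c i j := (coord (F (zvec K v j)) i).

(** If [z_j] is a multiple of an arrow then so is its image. *)
Lemma coeff_in i j d x : step v j d = Some (x, true) -> c i j != 0 ->
  exists2 d', step y i d' = Some (x, true) & c (nb i d') (nb j d) = c i j.
Proof.
move=> hj; have := arr_zvec K (step_nb_some hj); rewrite nbK => e.
rewrite -e linearZ_LR; case: (pselect (exists d', step y i d' = Some (x, true))).
  by move=> [d' hd'] _; exists d' => //; rewrite (arr_act_in _ hd').
by move=> n; rewrite arr_act_out ?eqxx // => d' hd'; apply: n; exists d'.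
Qed.

(** An arrow which kills [z_j] also kills its image. *)
Lemma coeff_out i j d x : step y i d = Some (x, false) -> c i j != 0 ->
  exists2 d', step v j d' = Some (x, false) & c (nb i d) (nb j d') = c i j.
Proof.
move=> hi; have := arr_act_in (F (zvec K v j)) (step_nb_some hi); rewrite nbK => <-.
rewrite -linearZ_LR; case: (pselect (exists d', step v j d' = Some (x, false))).
  move=> [d' hd'] _; exists d' => //.
  by rewrite (arr_zvec K hd').
by move=> n; rewrite arr_zvec0 ?linear0 ?eqxx // => d' hd'; apply: n; exists d'.
Qed.

Lemma coeff_pos i j : c i j != 0 -> is_pos y i /\ is_pos v j.
Proof.
move=> h; split; apply: contraTT h => h; rewrite negbK.
  by have /is_familyP[-> //] := coord_family (F (zvec K v j)).
suff -> : zvec K v j = 0 by rewrite linear0.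
by apply: coord_inj => k; rewrite coord_zvec; case: eqP => // ->; rewrite (negPf h).
Qed.

End LocalRules.

Section Order.
Variable A : string_algebra.
Implicit Types (w : word A) (S : nat -> option (letter A)).

(** Follow the walks from [j] and from [i] to the point where they part.  If an image
    of [z_j] has a nonzero coefficient at [z_i], then an arrow arriving in the first
    walk also arrives in the second, since the image of [z_j] is a multiple of it,
    and an arrow leaving in the second walk also leaves in the first, since it
    does not kill that image.  This is the increase of the rank of the letter. *)
Definition rank (x : option (letter A)) : nat :=
  if x is Some l then (if l.2 then 2 else 0)%N else 1%N.

Definition lexle S S' : Prop := S =1 S' \/
  exists2 k, (forall k', (k' < k)%N -> S k' = S' k') & (rank (S k) < rank (S' k))%N.

Lemma lexle_trans S1 S2 S3 : lexle S1 S2 -> lexle S2 S3 -> lexle S1 S3.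
Proof.
move=> [e12|[k hk rk]] [e23|[l hl rl]].
- by left=> i; rewrite e12.
- by right; exists l => [i il|]; rewrite e12 // hl.
- by right; exists k => [i ik|]; rewrite -e23 // hk.
right; case: (ltngtP k l) => [kl|lk|kl].
- by exists k => [i ik|]; [rewrite hk // hl // (ltn_trans ik)|rewrite -hl].
- by exists l => [i il|]; [rewrite hk ?hl // (ltn_trans il)|rewrite hk].
- by subst l; exists k => [i ik|]; [rewrite hk // hl|apply: ltn_trans rk rl].
Qed.

Lemma lexle_anti S1 S2 : lexle S1 S2 -> lexle S2 S1 -> S1 =1 S2.
Proof.
move=> [//|[k hk rk]] [e|[l hl rl]]; first by move=> i; rewrite e.
case: (ltngtP k l) => [kl|lk|kl].
- by move: rk; rewrite hl // ltnn.
- by move: rl; rewrite hk // ltnn.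
- by subst l; move: (ltn_trans rk rl); rewrite ltnn.
Qed.

Definition side w i e (k : nat) : option (letter A) := step w (sh e k i) e.

Lemma side_nb w i e k : side w (nb i e) e k = side w i e k.+1.
Proof. by rewrite /side -addn1 sh_add; congr (step w _ e); case: e; rewrite /nb /sh; lia. Qed.

(** The order on the positions of [w] along which endomorphisms move: an image of
    [z_j] can have a nonzero coefficient at [z_i] only if [i] is at least [j]. *)
Definition pos_le w (j i : int) : Prop :=
  exists f : bool, forall e, lexle (side w j e) (side w i (e (+) f)).

Lemma pos_le_trans w i j k : pos_le w i j -> pos_le w j k -> pos_le w i k.
Proof.
move=> [f hf] [g hg]; exists (f (+) g) => e; apply: lexle_trans (hf e) _.
by rewrite addbA; apply: hg.
Qed.

Definition infinite w : Prop := lo w = None \/ hi w = None.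
Definition aperiodic w : Prop := forall s : int, s <> 0 ->
  ~ forall i, letter_at w (i + s) = letter_at w i.

Lemma letter_at_convex w a b c : is_string w -> letter_at w a -> letter_at w b ->
  a <= c <= b -> letter_at w c.
Proof.
move=> hw; case Ea: (letter_at w a) => [l|] // _; case Eb: (letter_at w b) => [l'|] // _ hc.
have [p1 _ _ _] := letter_ends hw Ea; have [_ p2 _ _] := letter_ends hw Eb.
have p3 : is_pos w c && is_pos w (c + 1).
  by move: p1 p2; rewrite /is_pos; case: (lo w) => [?|]; case: (hi w) => [?|]; lia.
have [p4 p5] := andP p3; have [m [hm _ _]] := str_walk hw p4 p5.
by rewrite /letter_at p3 hm.
Qed.

Lemma infinite_letters w : is_string w -> infinite w ->
  exists e, exists p : int, forall i, beyond e p i -> letter_at w i.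
Proof.
move=> hw hinf; have [i0 hi0] := str_nonempty hw.
have L i : is_pos w i -> is_pos w (i + 1) -> letter_at w i.
  by move=> h1 h2; have [l [hl _ _]] := str_walk hw h1 h2; rewrite /letter_at h1 h2 hl.
case: hinf => h.
  exists false, (i0 - 1) => i /= ile; apply: L; move: hi0; rewrite /is_pos h;
    case: (hi w) => [?|] //; lia.
exists true, i0 => i /= ile; apply: L; move: hi0; rewrite /is_pos h; case: (lo w) => [?|] //; lia.
Qed.

(** A reflection of the walk fixes a position or a letter.  The walk is reduced, so it
    does not turn back at a position, and a letter is not its own inverse. *)
Lemma no_reflection w i j : is_string w -> infinite w ->
  ~ forall e, side w j e =1 side w i (~~ e).
Proof.
move=> hw hinf hs.
have refl a : letter_at w a = omap (@letter_inv A) (letter_at w (i + j - 1 - a)).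
  case: (lerP j a) => h.
    have := hs true (absz (a - j)%R); rewrite /side /step /sh /=.
    have -> : j + (absz (a - j)%R)%:Z = a by lia.
    by have -> : i - (absz (a - j)%R)%:Z - 1 = i + j - 1 - a by lia.
  have := hs false (absz (j - 1 - a)%R); rewrite /side /step /sh /=.
  have -> : j - (absz (j - 1 - a)%R)%:Z - 1 = a by lia.
  have -> : i + (absz (j - 1 - a)%R)%:Z = i + j - 1 - a by lia.
  by move=> <-; case: (letter_at w a) => //= l; rewrite letter_invK.
have refl' a : letter_at w a = letter_at w (i + j - 1 - a) :> bool.
  by rewrite refl; case: (letter_at _ _).
(* [c] is the letter fixed by the reflection, or the one before the fixed position *)
have [c hc] : exists c, letter_at w c = None /\ (c + c = i + j - 1 \/ c + c + 1 = i + j - 1).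
  have [c hc] : exists c : int, c + c = i + j - 1 \/ c + c + 1 = i + j - 1.
    exists (((i + j - 1) %/ 2)%Z); lia.
  exists c; split=> //; have := refl c; case E: (letter_at w c) => [l|] //.
  case: hc => hc.
    have -> : i + j - 1 - c = c by lia.
    by rewrite E /=; case: (l) => x [] [].
  have -> : i + j - 1 - c = c + 1 by lia.
  move=> h; case: (str_reduced hw E); move: h.
  by case: (letter_at w (c + 1)) => [m|] //= [->]; rewrite letter_invK.
have [e [p hp]] := infinite_letters hw hinf.
suff : letter_at w c by rewrite hc.1.
pose n : int := `|p| + `|c| + `|i| + `|j| + 1.
apply: (@letter_at_convex _ (c - n) (c + n)) => //; last by rewrite /n; lia.
  case: e hp => hp; last by apply: hp => /=; rewrite /n; lia.
  by rewrite refl'; apply: hp => /=; rewrite /n; lia.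
case: e hp => hp; first by apply: hp => /=; rewrite /n; lia.
by rewrite refl'; apply: hp => /=; rewrite /n; lia.
Qed.

Lemma pos_le_anti w i j : is_string w -> infinite w -> aperiodic w ->
  pos_le w j i -> pos_le w i j -> i = j.
Proof.
move=> hw hinf hap [f hf] [g hg].
case: (eqVneq f g) => fg; last first.
  case: (no_reflection (i := j) (j := j) hw hinf) => e.
  have H d : lexle (side w j d) (side w j (~~ d)).
    have := lexle_trans (hf d) (hg (d (+) f)); rewrite -addbA.
    have -> : f (+) g = true by move: fg; case: (f); case: (g).
    by rewrite addbT.
  by apply: lexle_anti (H e) _; rewrite -{2}(negbK e).
have E e : side w j e =1 side w i (e (+) f).
  by apply: lexle_anti (hf e) _; have := hg (e (+) f); rewrite -addbA -fg addbb addbF.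
case: f {hf hg} E fg => E _.
  by case: (no_reflection (i := i) (j := j) hw hinf) => e k; rewrite E addbT.
apply: contrapT => ij; apply: (hap (i - j)) => [|a]; first by lia.
case: (lerP j a) => h.
  have := E true (absz (a - j)%R); rewrite /side /step /sh /=.
  have -> : j + (absz (a - j)%R)%:Z = a by lia.
  by have -> : i + (absz (a - j)%R)%:Z = a + (i - j) by lia.
have := E false (absz (j - 1 - a)%R); rewrite /side /step /sh /=.
have -> : j - (absz (j - 1 - a)%R)%:Z - 1 = a by lia.
have -> : i - (absz (j - 1 - a)%R)%:Z - 1 = a + (i - j) by lia.
case: (letter_at w a) => [l|]; case: (letter_at w _) => [l'|] //= h'.
have : letter_inv l = letter_inv l' by apply: Some_inj.
by move=> /(can_inj (@letter_invK A)) ->.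
Qed.

Lemma step_none w i e n : is_pos w i -> step w i e = None -> is_string w ->
  step w (sh e n i) e = None.
Proof.
move=> hi h hw; case E: (step w (sh e n i) e) => [l|] //.
have [_ h' _ _] := step_ends hw E.
have [l' hl'] : exists l', step w i e = Some l'; last by rewrite hl' in h.
apply: (step_some hw hi); move: hi h'; rewrite /is_pos /nb /sh.
by case: (lo w) => [?|]; case: (hi w) => [?|]; case: (e); lia.
Qed.

End Order.

Section CoefficientOrder.
Variables (K : fieldType) (A : string_algebra) (y v : string A).
Variable F : {linear string_module K v -> string_module K y}.
Local Notation c i j := (coord (F (zvec K v j)) i).

(** The walks from [j] in [v] and from [i] in [y], in the directions [d] and [d'],
    share no letter in the wrong way: neither returns along the other. *)
Let uncrossed i j d d' : Prop :=
  (forall l, step v j d = Some l -> step y i (~~ d') <> Some l) /\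
  (forall l, step v j (~~ d) = Some l -> step y i d' <> Some l).

Lemma coeff_step i j d d' : c i j != 0 -> uncrossed i j d d' ->
  [\/ (rank (step v j d) < rank (step y i d'))%N,
      step v j d = None /\ step y i d' = None |
      exists l, [/\ step v j d = Some l, step y i d' = Some l &
                    c (nb i d') (nb j d) = c i j]].
Proof.
move=> hc [u1 u2].
have other (a b : bool) : a <> b -> a = ~~ b by case: a; case: b.
case Ev: (step v j d) => [[x []]|].
- have [d'' h1 h2] := coeff_in Ev hc.
  case: (eqVneq d'' d') h1 h2 => [->|/eqP/other ->] h1 h2; last by case: (u1 _ Ev h1).
  by constructor 3; exists (x, true).
- case Ey: (step y i d') => [[z []]|]; [by constructor 1| |by constructor 1].
  have [d'' h1 h2] := coeff_out Ey hc; rewrite -Ev -Ey.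
  case: (eqVneq d'' d) h1 h2 => [->|/eqP/other ->] h1 h2; last by case: (u2 _ h1 Ey).
  by constructor 3; exists (z, false).
- case Ey: (step y i d') => [[z []]|]; [by constructor 1| |by constructor 2].
  have [d'' h1 h2] := coeff_out Ey hc.
  case: (eqVneq d'' d) h1 h2 => [->|/eqP/other ->] h1 h2; last by case: (u2 _ h1 Ey).
  by rewrite h1 in Ev.
Qed.

Lemma side_lexle i j d d' : c i j != 0 -> uncrossed i j d d' ->
  lexle (side v j d) (side y i d').
Proof.
move=> hc hu; case: (pselect (side v j d =1 side y i d')) => [e|ne]; first by left.
suff [k hk rk] : exists2 k, (forall k', (k' < k)%N -> side v j d k' = side y i d' k') &
   (rank (side v j d k) < rank (side y i d' k))%N by right; exists k.
have {ne} [n hn] : exists n, side v j d n <> side y i d' n.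
  by apply: contrapT => h; apply: ne => n; apply: contrapT => hn; apply: h; exists n.
elim: n i j hc hu hn => [|n IH] i j hc hu hn;
  have [E|[E E']|[l [El El' hc']]] := coeff_step hc hu.
- by exists 0%N; rewrite /side ?sh0.
- by case: hn; rewrite /side !sh0 E E'.
- by case: hn; rewrite /side !sh0 El El'.
- by exists 0%N; rewrite /side ?sh0.
- have [pi pj] := coeff_pos hc; case: hn; rewrite /side.
  by rewrite !step_none //; apply: wd_string.
- have [|||k hk rk] := IH (nb i d') (nb j d); rewrite ?hc' //.
  + split=> m; rewrite ?negbK.
      move=> h; rewrite (step_nb_some El') => -[e]; subst m.
      by case: (step_reduced (wd_string v) h); rewrite (step_nb_some El).
    rewrite (step_nb_some El) => -[<-] h.
    by case: (step_reduced (wd_string y) h); rewrite (step_nb_some El').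
  + by rewrite !side_nb.
  exists k.+1; last by rewrite -!side_nb.
  by move=> [|k'] hk'; [rewrite /side !sh0 El El'|rewrite -!side_nb hk].
Qed.

Lemma coeff_orientation i j : c i j != 0 ->
  exists f : bool, forall e, lexle (side v j e) (side y i (e (+) f)).
Proof.
move=> hc.
case: (pselect (exists d d' l, step v j d = Some l /\ step y i d' = Some l)) => [|no].
  move=> [d [d' [l [h h']]]]; exists (d (+) d') => e; apply: side_lexle => //.
  have [->|->] : e = d \/ e = ~~ d by case: (e); case: (d); auto.
    rewrite addKb; split=> m hm.
      by rewrite h in hm; case: hm => <-; exact: (step_reduced (wd_string y) h').
    by rewrite h' => -[hl]; subst m; exact: (step_reduced (wd_string v) h).
  rewrite addNb addKb; split=> m; rewrite ?negbK.
    by move=> hm; rewrite h' => -[hl]; subst m; exact: (step_reduced (wd_string v) h).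
  by rewrite h => -[<-]; exact: (step_reduced (wd_string y) h').
exists false => e; rewrite addbF; apply: side_lexle => //.
by split=> l h h'; apply: no; [exists e, (~~ e), l|exists (~~ e), e, l].
Qed.

End CoefficientOrder.

Lemma coeff_pos_le (K : fieldType) (A : string_algebra) (w : string A)
    (F : {linear string_module K w -> string_module K w}) i j :
  coord (F (zvec K w j)) i != 0 -> pos_le w j i.
Proof. exact: coeff_orientation. Qed.

(** * Power series in the shift of an expanding tail *)

Section Shifts.
Variables (K : fieldType) (A : string_algebra).

Lemma hom_at_sum (w : word A) (M : lmodType (algebra K A)) N (a : nat -> K)
    (h : nat -> int -> M -> K) i : (forall t, hom_at w (h t) i) ->
  hom_at w (fun i m => \sum_(t < N) a t * h t i m) i.
Proof.
move=> hh; split=> [v m|x m].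
  under eq_bigr => t _ do rewrite (hh t).1.
  case: ifP => // _; by rewrite big1 // => t _; rewrite mulr0.
under eq_bigr => t _ do rewrite (hh t).2 mulr_sumr.
rewrite exchange_big /=; apply: eq_bigr => e _; case: ifP => // _.
by rewrite big1 // => t _; rewrite mulr0.
Qed.

Variables (w : string A) (e : bool) (p : int) (L : nat).
Hypotheses (ht : tail w e p L false) (hc : ~ contracting w e).
Local Notation C := (string_module K w).

Definition back t (i : int) : int := sh (~~ e) (t * L) i.

(** The [t]-th power of the shift by one period along an expanding tail, which
    for positive [t] kills the basis vectors off the tail. *)
Definition shift_fam t (a : int -> K) (i : int) : K :=
  if ray e p (back t i) || (t == 0)%N then a (back t i) else 0.

Lemma back_nb t i d : back t (nb i d) = nb (back t i) d.
Proof. exact: sh_nb. Qed.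

Lemma sh_back t i : sh e (t * L) (back t i) = i.
Proof. by rewrite /back /sh; case: (e) => /=; lia. Qed.

Lemma back_sh t i : back t (sh e (t * L) i) = i.
Proof. by rewrite /back /sh; case: (e) => /=; lia. Qed.

Lemma back0 i : back 0 i = i. Proof. exact: sh0. Qed.

Lemma ray_back t i : ray e p (back t i) -> ray e p i.
Proof. by move=> h; rewrite -(sh_back t i); apply: ray_sh. Qed.

Lemma shift_fam_hom t (m : C) i : hom_at w (fun i (m : C) => shift_fam t (coord m) i) i.
Proof.
have hw := wd_string w.
have eL : hom_at w (fun i (m : C) => coord m i) i by split=> *; rewrite ?vtx_act ?arr_act.
case: t => [|t].
  by apply: hom_at_eq eL => [m'|d x _ m']; rewrite /shift_fam orbT back0.
rewrite /shift_fam; set s := t.+1; have s0 : (0 < s)%N by [].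
case hr: (ray e p (back s i)).
  have vi : vert w i = vert w (back s i).
    by rewrite -{1}(sh_back s i) (tail_vertM hw ht).
  have si : step w i e = step w (back s i) e.
    by rewrite -{1}(sh_back s i) (tail_stepM ht).
  split=> [v m'|x m'].
    by rewrite hr orTb vtx_act vi (tail_pos ht hr) (tail_pos ht (ray_back hr)).
  rewrite hr orTb arr_act; apply: eq_bigr => d _.
  case: (eqVneq d e) => [->|de].
    by rewrite si back_nb (ray_nb hr).
  have -> : d = ~~ e by move: de; case: (d); case: (e).
  case: (eqVneq (back s i) p) => [ip|/eqP ip].
    rewrite back_nb ip ray_nbN if_same; case: eqP => // /(tail_start ht).
    by [].
  have sV : step w i (~~ e) = step w (back s i) (~~ e).
    by rewrite -{1}(sh_back s i) (tail_stepM_back ht).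
  by rewrite sV back_nb (ray_nbV hr).
apply: hom_at_eq (hom_at0 w C i) => [m'|d x hx m']; first by rewrite hr.
rewrite orbF; case hn: (ray e p (back s (nb i d))) => //; exfalso.
have [de ip] : d = e /\ back s (nb i d) = p.
  move: hr hn; rewrite back_nb; move: (back s i) => q.
  by case: (e); case: (d); rewrite /ray /nb; split=> //; lia.
have := step_nb_some hx; rewrite -[nb i d](sh_back s) ip de.
by have [a ->] := tail_wrapM ht s0.
Qed.

Definition shift_bound (i : int) : nat := (absz (i - p)%R).+1.

Lemma shift_fam_bound (a : int -> K) t i : (shift_bound i <= t)%N -> shift_fam t a i = 0.
Proof.
have L0 := tail_L ht; move=> h; rewrite /shift_fam; case: eqP => [t0|_].
  by move: h; rewrite t0 /shift_bound.
rewrite orbF; case: ifP => // hr; exfalso.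
have : (t <= t * L)%N by rewrite leq_pmulr.
move: hr h; rewrite /back /ray /sh /shift_bound; move: (t * L)%N => q.
by case: (e) => /=; lia.
Qed.

Definition series_fam (c : nat -> K) (a : int -> K) (i : int) : K :=
  \sum_(t < shift_bound i) c t * shift_fam t a i.

Lemma series_famE c a i N : (shift_bound i <= N)%N ->
  series_fam c a i = \sum_(t < N) c t * shift_fam t a i.
Proof.
move=> h; rewrite /series_fam (big_ord_widen _ (fun t => c t * shift_fam t a i) h).
rewrite big_mkcond; apply: eq_bigr => t _; case: ifP => // /negbT.
by rewrite -leqNgt => /shift_fam_bound ->; rewrite mulr0.
Qed.

(** Power series in the shift act on the module of an expanding tail. *)
Lemma shift_series (c : nat -> K) : exists S : {linear C -> C}, forall m i,
  coord (S m) i = series_fam c (coord m) i.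
Proof.
apply: hom_of_coord => [i|i|m].
- split=> [m n|k m]; rewrite /series_fam.
    rewrite -big_split; apply: eq_bigr => t _ /=; rewrite -mulrDr; congr (_ * _).
    by rewrite /shift_fam; case: ifP; rewrite ?addr0.
  rewrite mulr_sumr; apply: eq_bigr => t _; rewrite mulrCA; congr (_ * _).
  by rewrite /shift_fam; case: ifP => _; rewrite ?mulr0 ?scalar_act.
- pose N := maxn (shift_bound i) (maxn (shift_bound (nb i true)) (shift_bound (nb i false))).
  apply: hom_at_eq (hom_at_sum N c (fun t => shift_fam_hom t 0 i)) => [m|d x _ m].
    by rewrite (@series_famE _ _ _ N) // leq_max leqnn.
  by rewrite (@series_famE _ _ _ N) // !leq_max; case: d; rewrite leqnn ?orbT.
- have /is_familyP[m0 mf] := coord_family m.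
  apply/is_familyP; split=> [i hi|d hd].
    rewrite /series_fam big1 // => t _; rewrite /shift_fam; case: ifP; rewrite ?mulr0 //.
    case/orP=> [/ray_back/(tail_pos ht)|/eqP ->]; first by rewrite (negPf hi).
    by rewrite back0 m0 // mulr0.
  have de : d = ~~ e.
    by case: (eqVneq d e) hd => [->//|]; case: (d); case: (e).
  have [n hn] := mf _ hd; pose n' := if d then Num.max n (p + 1) else Num.min n (p - 1).
  exists n' => i hi; rewrite /series_fam big1 // => t _; rewrite /shift_fam.
  have hin : beyond d n i by move: hi; rewrite /n'; case: (d) => /=; lia.
  have hr : ray e p i = false.
    move: hi; rewrite /n' de /ray; case: (e) => /=; lia.
  case: ifP; rewrite ?mulr0 //; case/orP=> [/ray_back|/eqP ->]; first by rewrite hr.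
  by rewrite back0 hn // mulr0.
Qed.

Lemma series_zvec (c : nat -> K) (S : {linear C -> C}) j : ray e p j ->
  (forall m i, coord (S m) i = series_fam c (coord m) i) ->
  (forall t, coord (S (zvec K w j)) (sh e (t * L) j) = c t) /\
  forall i, (forall t, i <> sh e (t * L) j) -> coord (S (zvec K w j)) i = 0.
Proof.
have L0 := tail_L ht => hj hS; split=> [t|i hi]; rewrite hS.
  have tb : (t < shift_bound (sh e (t * L) j))%N.
    have : (t <= t * L)%N by rewrite leq_pmulr.
    move: hj; rewrite /shift_bound /ray /sh; move: (t * L)%N => q.
    by case: (e); lia.
  rewrite /series_fam (bigD1 (Ordinal tb)) //= big1 ?addr0 => [|s /eqP st].
    by rewrite /shift_fam back_sh hj eqxx (tail_pos ht) // mulr1.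
  rewrite /shift_fam; case: (eqVneq (back _ _) j) => [bs|_]; last by rewrite if_same mulr0.
  case: st; apply: val_inj => /=; apply/eqP; rewrite -(eqn_pmul2r L0); apply/eqP.
  move: bs; rewrite /back /sh; move: (t * L)%N (s * L)%N => q q'; case: (e) => /=; lia.
rewrite /series_fam big1 // => t _; rewrite /shift_fam coord_zvec.
case: (eqVneq (back _ _) j) => [bs|_]; last by rewrite if_same mulr0.
by case: (hi t); rewrite -bs sh_back.
Qed.

Lemma pos_lt_sh j : ray e p j -> pos_le w j (sh e L j).
Proof.
move=> hj; have [S hS] := shift_series (fun t => (t == 1)%:R).
have [h _] := series_zvec hj hS; apply: (coeff_pos_le (F := S)).
by have := h 1%N; rewrite mul1n => ->; rewrite oner_neq0.
Qed.

End Shifts.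

(** * Indecomposability of string modules *)

Lemma exists_minimal (I : finType) (T : pred I) (r : rel I) x :
  irreflexive r -> transitive r -> T x ->
  exists2 x0, T x0 & forall y, T y -> ~~ r y x0.
Proof.
move=> irr tr Tx; pose c y := #|[pred z | T z && r z y]|.
case: (arg_minnP c Tx) => x0 Tx0 min; exists x0 => // y Ty; apply/negP => ryx.
have := min y Ty; rewrite leqNgt => /negP; apply; apply: proper_card.
apply/properP; split.
  by apply/fintype.subsetP => z; rewrite !inE => /andP[-> /tr]; apply.
by exists y; rewrite !inE ?Ty ?ryx // irr.
Qed.

(** Every infinite side of the string runs into a tail on which the type of the
    module, direct sum or direct product, agrees with that of the tail. *)
Definition tame_side (A : string_algebra) (w : word A) (e : bool) : Prop :=
  [\/ exists n : int, forall i, beyond e n i -> ~~ is_pos w i, contracting w e |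
      ~ contracting w e /\ exists p L, tail w e p L false].

Section Indecomposable.
Variables (K : fieldType) (A : string_algebra) (w : string A).
Local Notation C := (string_module K w).

Hypotheses (hinf : infinite w) (hap : aperiodic w) (hside : forall e, tame_side w e).

Lemma coord0 i : coord (0 : C) i = 0. Proof. by []. Qed.

Lemma coord_sum (I : Type) (s : seq I) (P : pred I) (F : I -> C) i :
  coord (\sum_(k <- s | P k) F k) i = \sum_(k <- s | P k) coord (F k) i.
Proof. by apply: (big_morph (fun m : C => coord m i)). Qed.

(** [r] lies strictly above [z_j] in a way that every endomorphism respects. *)
Definition above (j : int) (r : C) : Prop :=
  forall (E : {linear C -> C}) i, coord (E r) i != 0 -> pos_le w j i /\ i <> j.

Definition has_lead (m : C) (j : int) : Prop := coord m j != 0 /\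
  exists2 r, above j r & m = scalar A (coord m j) *: zvec K w j + r.

Definition leading (m : C) : Prop := m = 0 \/ exists j, has_lead m j.

Lemma coord_zvec1 j (m : C) : coord m j != 0 -> coord (zvec K w j) j = 1.
Proof.
move=> h; rewrite coord_zvec eqxx; case hj: (is_pos w j) => //.
by move: h; have /is_familyP[->] := coord_family m; rewrite ?hj ?eqxx.
Qed.

Lemma has_lead_coord m j (E : {linear C -> C}) i : has_lead m j ->
  coord (E m) i != 0 -> pos_le w j i.
Proof.
move=> [hj [r hr ->]]; rewrite linearD linearZ_LR coordD scalar_act => h.
case: (eqVneq (coord (E r) i) 0) => [r0|/hr[] //].
by apply: (coeff_pos_le (F := E)); apply: contraNneq h => ->; rewrite mulr0 add0r r0.
Qed.

Lemma has_lead_diag m j (E : {linear C -> C}) : has_lead m j ->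
  coord (E m) j = coord m j * coord (E (zvec K w j)) j.
Proof.
move=> [hj [r hr e]]; rewrite {1}e linearD linearZ_LR coordD scalar_act.
case: (eqVneq (coord (E r) j) 0) => [->|/hr[_ //]]; by rewrite addr0.
Qed.

Definition off (e : bool) (N : nat) (i : int) : bool :=
  if e then N%:Z < i else i < - N%:Z.

(** On an expanding tail, the part of a family in one residue class is the first
    nonzero term followed by a power series in the shift applied to the next
    vector of the class; on the other sides it is eventually zero. *)
Lemma side_leading e (m : C) : exists N0 L : nat, (0 < L)%N /\
  forall N r mr, (N0 <= N)%N ->
    (forall i, coord mr i = if off e N i && (absz i %% L == r)%N then coord m i else 0) ->
    leading mr.
Proof.
have /is_familyP[m0 mf] := coord_family m.
have triv : (exists n, forall i, beyond e n i -> coord m i = 0) -> exists N0 L : nat,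
   (0 < L)%N /\ forall N r mr, (N0 <= N)%N ->
    (forall i, coord mr i = if off e N i && (absz i %% L == r)%N then coord m i else 0) ->
    leading mr.
  move=> [n hn]; exists (absz n), 1%N; split=> // N r mr hN hmr; left.
  apply: coord_inj => i; rewrite hmr coord0; case: ifP => // /andP[ho _]; apply: hn.
  by move: ho hN; rewrite /off; case: (e) => /=; lia.
have [[n hn]|hc|[hc [p [L ht]]]] := hside e.
- by apply: triv; exists n => i /hn; apply: m0.
- by apply: triv; apply: mf.
have L0 := tail_L ht; exists (absz p), L; split=> // N r mr hN hmr.
have shabs k : absz (sh e k 0) = k by rewrite /sh; case: (e); lia.
have offsh k : off e N (sh e k 0) = (N < k)%N by rewrite /off /sh; case: (e); lia.
have shoff i : off e N i -> i = sh e (absz i) 0 by rewrite /off /sh; case: (e); lia.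
case: (pselect (exists k, coord mr (sh e k 0) != 0)) => [ex|nex]; last first.
  left; apply: coord_inj => i; rewrite coord0; apply/eqP; apply: contrapT => /negP hi.
  apply: nex; exists (absz i); rewrite -shoff //.
  by apply: contraNT hi; rewrite hmr => /negPf ->.
right; case: (ex_minnP ex) => k hk kmin.
have [kN kr] : (N < k)%N /\ (k %% L)%N = r.
  move: hk; rewrite hmr offsh shabs; case: ifP; last by rewrite eqxx.
  by move=> /andP[? /eqP].
set j := sh e k 0 in hk *; exists j; split=> //.
have jray : ray e p j by rewrite /j /ray /sh; move: kN hN; case: (e); lia.
have jray' : ray e p (sh e L j) by apply: ray_sh.
have [S hS] := shift_series ht hc (fun t => coord mr (sh e (t * L) (sh e L j))).
have [S1 S2] := series_zvec ht jray' hS.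
exists (S (zvec K w (sh e L j))).
  move=> E i hi; have le1 : pos_le w (sh e L j) i.
    exact: (coeff_pos_le (F := E \o S)).
  have le2 := pos_lt_sh K ht hc jray; split; first exact: pos_le_trans le2 le1.
  move=> ij; rewrite ij in le1; have := pos_le_anti (wd_string w) hinf hap le2 le1.
  by rewrite /sh; case: (e); lia.
apply: coord_inj => i; rewrite coordD scalar_act coord_zvec.
case: (eqVneq i j) => [->|ij].
  have -> : is_pos w j by apply: tail_pos ht _ jray.
  by rewrite S2 ?mulr1 ?addr0 // => t; rewrite /sh; case: (e); lia.
rewrite mulr0 add0r; case: (pselect (exists t, i = sh e (t * L) (sh e L j))) => [[t ->]|nt].
  by rewrite S1.
rewrite S2 => [|t it]; last by apply: nt; exists t.
apply/eqP; apply: contrapT => /negP hi; apply: nt.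
move: (hi); rewrite hmr; case: ifP => [/andP[ho /eqP ir] _|]; last by rewrite eqxx.
have := kmin (absz i); rewrite -shoff // => /(_ hi) ki.
have ki' : (k < absz i)%N.
  rewrite ltn_neqAle ki andbT; apply: contraNneq ij => kE; by rewrite (shoff i ho) -kE.
have := divn_eq (absz i) L; have := divn_eq k L; rewrite ir kr => e1 e2.
have lt : (k %/ L < absz i %/ L)%N.
  by rewrite ltnNge; apply/negP => h; move: ki'; rewrite e1 e2 ltnNge leq_add2r leq_mul2r h orbT.
exists (absz i %/ L - (k %/ L).+1)%N; rewrite {1}(shoff i ho) /j -!sh_add; congr (sh e _ 0).
rewrite {1}e2 {2}e1 mulnBl mulSn.
have : ((k %/ L).+1 * L <= absz i %/ L * L)%N by rewrite leq_mul2r lt orbT.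
by rewrite mulSn; move: (absz i %/ L * L)%N (k %/ L * L)%N => a b; lia.
Qed.

Lemma restrict_family (m : C) (P : pred int) :
  (fun i => if P i then coord m i else 0) \in is_family w.
Proof.
have /is_familyP[m0 mf] := coord_family m.
apply/is_familyP; split=> [i /m0 ->|e /mf[n hn]]; first by rewrite if_same.
by exists n => i /hn ->; rewrite if_same.
Qed.

(** The support of a nonzero element has a position at which every endomorphism
    acts by its diagonal coefficient: a minimal one among the finitely many
    first positions of the residue classes. *)
Lemma diagonal_position (m : C) : m != 0 -> exists2 i, coord m i != 0 &
  forall E : {linear C -> C}, coord (E m) i = coord m i * coord (E (zvec K w i)) i.
Proof.
move=> mn0.
have [N1 [L1 [l1 h1]]] := side_leading true m; case: L1 l1 h1 => // L1 _ h1.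
have [N2 [L2 [l2 h2]]] := side_leading false m; case: L2 l2 h2 => // L2 _ h2.
pose N := maxn N1 N2.
(* the positions in the middle are treated one by one, those far out by residue
   classes, so that finitely many classes result *)
pose I : finType := ('I_(N + N).+1 + ('I_L1.+1 + 'I_L2.+1))%type.
pose cl (i : int) : I := if - N%:Z <= i <= N%:Z then inl (inord (absz (i + N%:Z)%R))
  else if 0 <= i then inr (inl (inord (absz i %% L1.+1)))
  else inr (inr (inord (absz i %% L2.+1))).
pose mr (k : I) : C := StringModule (restrict_family m (fun i => cl i == k)).
have mrE k i : coord (mr k) i = if cl i == k then coord m i else 0 by [].
have msum : m = \sum_k mr k.
  apply: coord_inj => i; rewrite coord_sum (bigD1 (cl i)) // mrE eqxx big1.
    by rewrite /= addr0.
  by move=> k /= hk; rewrite eq_sym (negPf hk).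
have lead k : leading (mr k).
  case: k => [a|[b|c]].
  - have out i : cl i = inl a -> i = a%:Z - N%:Z.
      rewrite /cl; case: ifP => [hi [<-]|_]; last by case: ifP.
      by rewrite inordK; lia.
    pose j : int := a%:Z - N%:Z.
    case: (eqVneq (coord (mr (inl a)) j) 0) => [j0|jn0].
      left; apply: coord_inj => i; rewrite coord0 mrE; case: eqP => // c.
      by rewrite -j0 mrE /j -(out i c) c eqxx.
    right; exists j; split=> //; exists 0 => [E i|]; first by rewrite linear0 coord0 eqxx.
    apply: coord_inj => i; rewrite coordD coord0 addr0 scalar_act.
    case: (eqVneq i j) => [->|ij]; first by rewrite (coord_zvec1 jn0) mulr1.
    by rewrite coord_zvec (negPf ij) mulr0 mrE; case: eqP => // /out ij'; rewrite ij' eqxx in ij.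
  - apply: (h1 N b) => [|i]; first exact: leq_maxl.
    rewrite mrE /cl /off; case: (boolP (- N%:Z <= i <= N%:Z)) => hi; first by have -> : (N%:Z < i) = false by lia.
    case: (boolP (0 <= i)) => hi'; last by have -> : (N%:Z < i) = false by lia.
    have -> : (N%:Z < i) = true by lia.
    by congr (if _ then _ else _); apply/eqP/eqP => [[<-]|h];
      rewrite ?inordK ?ltn_pmod // h inord_val.
  - apply: (h2 N c) => [|i]; first exact: leq_maxr.
    rewrite mrE /cl /off; case: (boolP (- N%:Z <= i <= N%:Z)) => hi; first by have -> : (i < - N%:Z) = false by lia.
    case: (boolP (0 <= i)) => hi'; first by have -> : (i < - N%:Z) = false by lia.
    have -> : (i < - N%:Z) = true by lia.
    by congr (if _ then _ else _); apply/eqP/eqP => [[<-]|h];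
      rewrite ?inordK ?ltn_pmod // h inord_val.
have /choice[j hj] (k : I) : exists j, mr k != 0 -> has_lead (mr k) j.
  by case: (lead k) => [->|[j ?]]; [exists 0; rewrite eqxx|exists j].
pose r (k l : I) := `[< pos_le w (j k) (j l) /\ j k <> j l >].
have rirr : irreflexive r by move=> k; apply/negP => /asboolP[].
have rtr : transitive r.
  move=> b a c /asboolP[le1 ne1] /asboolP[le2 ne2]; apply/asboolP; split.
    exact: pos_le_trans le1 le2.
  by move=> e; apply: ne1; apply: (pos_le_anti (wd_string w) hinf hap _ le1); rewrite e.
have [k0 hk0] : exists k, mr k != 0.
  apply: contrapT => h; case/eqP: mn0; rewrite msum big1 // => k _.
  by apply/eqP; apply: contrapT => /negP hk; apply: h; exists k.
have [k hk kmin] := exists_minimal (T := fun k => mr k != 0) rirr rtr hk0.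
have hl := hj k hk; have cjk : cl (j k) = k.
  by have [+ _] := hl; rewrite mrE; case: (eqVneq (cl (j k)) k) => // _; rewrite eqxx.
have cjE : coord (mr k) (j k) = coord m (j k) by rewrite mrE cjk eqxx.
exists (j k) => [|E]; first by rewrite -cjE; have [] := hl.
rewrite {1}msum linear_sum coord_sum (bigD1 k) //= big1 ?addr0 => [|l lk].
  by rewrite (has_lead_diag E hl) cjE.
apply/eqP; apply: contrapT => /negP hc.
have ml : mr l != 0 by apply: contraNneq hc => ->; rewrite linear0.
have hl' := hj l ml; case/negP: (kmin l ml); apply/asboolP; split.
  exact: has_lead_coord hl' hc.
move=> e; have [+ _] := hl'; by rewrite mrE e cjk [k == l]eq_sym (negPf lk) eqxx.
Qed.

(** Passing to a neighbour along an arrow preserves the diagonal coefficient. *)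
Lemma diagonal_const (E : {linear C -> C}) i j : is_pos w i -> is_pos w j ->
  coord (E (zvec K w i)) i = coord (E (zvec K w j)) j.
Proof.
have H k : is_pos w k -> is_pos w (k + 1) ->
    coord (E (zvec K w k)) k = coord (E (zvec K w (k + 1))) (k + 1).
  move=> p1 p2; have [[x []] hl] := step_some (e := true) (wd_string w) p1 p2.
    have := arr_zvec K (step_nb_some hl); rewrite nbK => <-.
    by rewrite linearZ_LR (arr_act_in _ hl).
  by rewrite -(arr_zvec K hl) linearZ_LR (arr_act_in _ (step_nb_some hl)) nbK.
wlog ij : i j / i <= j => [W pi pj|].
  by case: (lerP i j) => ij; [apply: W|apply/esym; apply: W => //; lia].
have -> : j = i + (absz (j - i)%R)%:Z by lia.
elim: (absz _) => [|n IH] pi pj; first by rewrite addr0.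
have pn : is_pos w (i + n%:Z).
  by move: pi pj; rewrite /is_pos; case: (lo w) => [?|]; case: (hi w) => [?|]; lia.
rewrite IH // H //; have e : i + n%:Z + 1 = i + n.+1%:Z by lia.
  by rewrite e.
by rewrite e.
Qed.

(** The projection onto a direct summand has the same diagonal coefficient at all
    positions.  At the position given by [diagonal_position], an element of the
    summand forces this coefficient to be 1, an element of the complement forces
    it to be 0. *)
Lemma string_module_indecomposable : indecomposable (string_module K w).
Proof.
split.
  have [i hi] := str_nonempty (wd_string w); exists (zvec K w i).
  apply/eqP => h; have := coord_zvec K w i i; rewrite h eqxx hi coord0 => /eqP.
  by rewrite eq_sym oner_eq0.
move=> M1 M2 [f [g fg gf]].
case: (pselect (forall m : M1, m = 0)) => [|n1]; first by left.
case: (pselect (forall m : M2, m = 0)) => [|n2]; first by right.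
have [m1 m10] : exists m1 : M1, m1 != 0.
  by apply: contrapT => h; apply: n1 => m; apply/eqP; apply: contrapT => /negP ?; apply: h; exists m.
have [m2 m20] : exists m2 : M2, m2 != 0.
  by apply: contrapT => h; apply: n2 => m; apply/eqP; apply: contrapT => /negP ?; apply: h; exists m.
have gl : linear g.
  by move=> k a b; apply: (can_inj fg); rewrite linearP !gf.
pose G := mk_linear gl; have GE : forall x, G x = g x by [].
pose E0 (m : C) : C := g ((f m).1, 0).
have El : linear E0.
  move=> k a b; rewrite /E0 -gl; congr g.
  by rewrite linearP -[RHS]/(k *: (f a).1 + (f b).1, k *: (0 : M2) + 0) scaler0 addr0.
pose E := mk_linear El; have EE : forall x, E x = g ((f x).1, 0) by [].
have nz x : x != 0 -> g x != 0.
  by apply: contraNneq => h; rewrite -(gf x) h linear0.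
have x1 : g (m1, 0) != 0 by apply: nz; apply: contraNneq m10 => -[->].
have x2 : g (0, m2) != 0 by apply: nz; apply: contraNneq m20 => -[->].
have [i hi di] := diagonal_position x1; have [j hj dj] := diagonal_position x2.
have pos (m : C) k : coord m k != 0 -> is_pos w k.
  by apply: contraNT => h; have /is_familyP[-> //] := coord_family m.
have li : coord (E (zvec K w i)) i = 1.
  by apply: (mulfI hi); rewrite -di EE gf mulr1.
have lj : coord (E (zvec K w j)) j = 0.
  by apply: (mulfI hj); rewrite -dj EE gf mulr0 -[g _]/(G 0) linear0.
have := diagonal_const E (pos _ _ hi) (pos _ _ hj).
by rewrite li lj => /eqP; rewrite oner_eq0.
Qed.

End Indecomposable.

(** * Chain conditions on spaces of functionals *)

Section ChainConditions.
Variables (K : fieldType).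

(** A matrix of maximal rank among those whose rows lie in the subspace. *)
Lemma subspace_matrix n (P : 'rV[K]_n -> Prop) :
  P 0 -> (forall a u v, P u -> P v -> P (a *: u + v)) ->
  exists B : 'M[K]_n, forall v, P v <-> (v <= B)%MS.
Proof.
move=> P0 Plin.
have [r _ [B [hB rB]] max] : exists2 r, True &
    exists2 B : 'M[K]_n, (forall v, (v <= B)%MS -> P v) /\ \rank B = r &
    forall B' : 'M[K]_n, (forall v, (v <= B')%MS -> P v) -> (\rank B' <= r)%N.
  pose Q r := `[< exists2 B : 'M[K]_n, forall v, (v <= B)%MS -> P v & \rank B = r >].
  have exQ : exists r, Q r.
    exists 0%N; apply/asboolP; exists 0; last exact: mxrank0.
    by move=> v; rewrite submx0 => /eqP ->.
  have ubQ r : Q r -> (r <= n)%N by move=> /asboolP[B _ <-]; apply: rank_leq_row.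
  case: (ex_maxnP exQ ubQ) => r /asboolP[B hB rB] max; exists r => //; exists B => //.
  by move=> B' hB'; apply: max; apply/asboolP; exists B'.
exists B => v; split=> [Pv|]; last exact: hB.
have h := max (B + v)%MS; apply: contrapT => /negP nv.
have : (\rank (B + v)%MS <= r)%N.
  apply: h => u /sub_addsmxP[[a b] /= ->].
  have -> : b *m v = (b 0 0) *: v.
    by apply/rowP => k; rewrite !mxE big_ord1.
  by rewrite addrC; apply: Plin => //; apply: hB; rewrite submxMl.
rewrite -rB => le; have := mxrank_leqif_sup (addsmxSl B v).
move=> [le' e]; have : (\rank B == \rank (B + v)%MS) by rewrite eqn_leq le' le.
by rewrite e => /(submx_trans (addsmxSr B v)); rewrite (negPf nv).
Qed.

Variables (A : string_algebra) (M : lmodType (algebra K A)).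

Definition subspace (X : (M -> K) -> Prop) : Prop :=
  [/\ forall f, X f -> klinear f, X (fun=> 0) &
      forall a f g, X f -> X g -> X (fun m => a * f m + 1 * g m)].

Lemma finite_rank (X : nat -> (M -> K) -> Prop) :
  finite_dimensional M -> (forall n, subspace (X n)) ->
  exists d : nat -> nat, exists r : nat, [/\ forall n, (d n <= r)%N,
    forall n m, (forall f, X n f -> X m f) -> (d n <= d m)%N &
    forall n m, (forall f, X n f -> X m f) -> (d m <= d n)%N -> forall f, X m f -> X n f].
Proof.
move=> [s hs] hX; pose n := size s.
pose ev (f : M -> K) : 'rV[K]_n := \row_i f s`_i.
have ev_inj f g : klinear f -> klinear g -> ev f = ev g -> f = g.
  move=> hf hg /rowP e; apply/funext => m; have [k ->] := hs m.
  rewrite !klinear_sum //; apply: eq_bigr => i _; rewrite hf.2 hg.2.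
  by have := e i; rewrite !mxE => ->.
have /choice[B hB] (j : nat) : exists B : 'M[K]_n,
    forall v, (exists2 f, X j f & v = ev f) <-> (v <= B)%MS.
  have [_ X0 Xl] := hX j; apply: subspace_matrix.
    by exists (fun=> 0) => //; apply/rowP => i; rewrite !mxE.
  move=> a u v [f Xf ->] [g Xg ->]; exists (fun m => a * f m + 1 * g m); first exact: Xl.
  by apply/rowP => i; rewrite !mxE mul1r.
have sub j k : (forall f, X j f -> X k f) -> (B j <= B k)%MS.
  move=> h; apply/rV_subP => v /hB[f Xf ->]; apply/hB; exists f => //; exact: h.
exists (fun j => \rank (B j)), n; split=> [j|j k h|j k h le f Xf].
- exact: rank_leq_row.
- exact: mxrankS (sub _ _ h).
have [le' e] := mxrank_leqif_sup (sub _ _ h).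
have {e} e : (B k <= B j)%MS by rewrite -e eqn_leq le' le.
have /hB[g Xg eg] : (ev f <= B j)%MS by apply: submx_trans e; apply/hB; exists f.
have [Xkl _ _] := hX k; have [Xjl _ _] := hX j.
by rewrite (ev_inj f g (Xkl _ Xf) (Xjl _ Xg) eg).
Qed.

Lemma ascending_stable (X : nat -> (M -> K) -> Prop) :
  finite_dimensional M -> (forall n, subspace (X n)) ->
  (forall n f, X n f -> X n.+1 f) -> exists D, forall n f, X n f -> X D f.
Proof.
move=> fd hX asc; have [d [r [dr mono stab]]] := finite_rank fd hX.
have up n m : (n <= m)%N -> forall f, X n f -> X m f.
  elim: m => [|m IH]; first by rewrite leqn0 => /eqP ->.
  by rewrite leq_eqVlt => /orP[/eqP ->//|/IH h] f /h /asc.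
have ex : exists k, `[< exists n, d n = k >] by exists (d 0%N); apply/asboolP; exists 0%N.
have ub k : `[< exists n, d n = k >] -> (k <= r)%N by move=> /asboolP[n <-].
case: (ex_maxnP ex ub) => k /asboolP[D dD] max; exists D => n f Xf.
have [nD|Dn] := leqP n D; first exact: up nD f Xf.
apply: (stab D n) Xf; first exact: up (ltnW Dn).
by rewrite dD; apply: max; apply/asboolP; exists n.
Qed.

Lemma descending_stable (X : nat -> (M -> K) -> Prop) :
  finite_dimensional M -> (forall n, subspace (X n)) ->
  (forall n f, X n.+1 f -> X n f) -> exists D, forall n f, X D f -> X n f.
Proof.
move=> fd hX desc; have [d [r [dr mono stab]]] := finite_rank fd hX.
have down n m : (n <= m)%N -> forall f, X m f -> X n f.
  elim: m => [|m IH]; first by rewrite leqn0 => /eqP ->.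
  by rewrite leq_eqVlt => /orP[/eqP ->//|/IH h] f /desc /h.
have ex : exists k, `[< exists n, d n = k >] by exists (d 0%N); apply/asboolP; exists 0%N.
case: (ex_minnP ex) => k /asboolP[D dD] min; exists D => n f Xf.
have [nD|Dn] := leqP n D; first exact: down nD f Xf.
apply: (stab n D) Xf; first exact: down (ltnW Dn).
by rewrite dD; apply: min; apply/asboolP; exists n.
Qed.

End ChainConditions.

(** * Cutting families along a tail *)

Section Cuts.
Variables (K : fieldType) (A : string_algebra).

Lemma hom_at_transfer (w w' : word A) (M : lmodType (algebra K A))
    (h h' : int -> M -> K) i i' :
  h' i' =1 h i -> is_pos w' i' = is_pos w i -> (is_pos w i -> vert w' i' = vert w i) ->
  (forall d x m, (if step w' i' d == Some (x, true) then h' (nb i' d) m else 0) =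
                 (if step w i d == Some (x, true) then h (nb i d) m else 0)) ->
  hom_at w h i -> hom_at w' h' i'.
Proof.
move=> e ep ev es [h1 h2]; split=> [v m|x m]; rewrite !e ?h1 ?h2 ?ep.
  by case: (boolP (is_pos w i)) => //= /ev ->.
by apply: eq_bigr => d _; rewrite es.
Qed.

Lemma klinear_if (M : lmodType (algebra K A)) (b : bool) (f g : M -> K) :
  klinear f -> klinear g -> klinear (fun m => if b then f m else g m).
Proof. by case: b. Qed.

Lemma klinear_sub (M : lmodType (algebra K A)) (f g : M -> K) :
  klinear f -> klinear g -> klinear (fun m => 1 * f m + -1 * g m).
Proof. exact: klinear_comb. Qed.

Variables (w : word A) (e : bool) (p : int) (L : nat).
Hypothesis hw : is_string w.
Local Notation q k := (sh e (k * L) p).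

Lemma ray_q (ht : (0 < L)%N) j k : ray e (q j) (q k) = (j <= k)%N.
Proof. by rewrite -(leq_pmul2r ht) /ray /sh; case: (e); lia. Qed.

Lemma ray_origin n : ray e p (sh e n p).
Proof. by apply/rayP; exists n. Qed.

Lemma ray_refl (i : int) : ray e i i. Proof. by rewrite /ray; case: e. Qed.

Lemma ray_trans (i j k : int) : ray e i j -> ray e j k -> ray e i k.
Proof. by rewrite /ray; case: e; lia. Qed.

Lemma ray_sh2 n (i j : int) : ray e (sh e n i) (sh e n j) = ray e i j.
Proof. by rewrite /ray /sh; case: e; lia. Qed.

Lemma ray_shV n (i j : int) : ray e (sh (~~ e) n i) (sh (~~ e) n j) = ray e i j.
Proof. by rewrite /ray /sh; case: e => /=; lia. Qed.

(** Entering the ray from [i] by one step is possible only through its origin. *)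
Lemma ray_enter o i d : ~~ ray e o i -> ray e o (nb i d) -> d = e /\ nb i d = o.
Proof. by rewrite /ray /nb; case: e; case: d; split=> //; lia. Qed.

Lemma ray_leave o i d : ray e o i -> ~~ ray e o (nb i d) -> d = ~~ e /\ i = o.
Proof. by rewrite /ray /nb; case: e; case: d => /=; split=> //; lia. Qed.

Section Contracting.
Variables (M N : lmodType (algebra K A)) (f : {linear M -> N}).
Hypotheses (ht : tail w e p L true) (fd : finite_dimensional N).

Let L0 := tail_L ht.

(** A family on the first [j] periods of the tail which starts from zero, dies on
    the image of [f], and is compatible with the action short of the end [q j]. *)
Definition killed_strip (d : int -> N -> K) (j : nat) : Prop :=
  [/\ forall i, klinear (d i), forall i x, d i (f x) = 0,
      forall i, ~~ ray e p i -> d i =1 (fun=> 0) &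
      forall i, ray e p i -> ~~ ray e (q j) i -> hom_at w d i].

Definition strip_end j (u : N -> K) : Prop := exists2 d, killed_strip d j & d (q j) = u.

Lemma strip_end_subspace j : subspace (strip_end j).
Proof.
split.
- by move=> u [d [h _ _ _] <-].
- exists (fun _ _ => 0) => //; split=> // [i|i _ _]; first exact: klinear_cst0.
  exact: hom_at0.
- move=> a u v [d [h1 h2 h3 h4] <-] [d' [h1' h2' h3' h4'] <-].
  exists (fun i m => a * d i m + 1 * d' i m) => //; split.
  + by move=> i; apply: klinear_comb.
  + by move=> i x; rewrite h2 h2' !mulr0 addr0.
  + by move=> i hi m; rewrite h3 // h3' // !mulr0 addr0.
  + by move=> i hi hi'; apply: hom_at_comb; [apply: h4|apply: h4'].
Qed.

(** Before [p] a contracting tail admits the value zero, so the part of a family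
    beginning with any later period can be moved back to [p]. *)
Lemma hom_at_shift_back (h d : int -> N -> K) s i : (0 < s)%N -> ray e p i ->
  (forall j, ~~ ray e p j -> d j =1 (fun=> 0)) -> d i =1 h (sh e (s * L) i) ->
  (forall c, ray e p (nb i c) -> d (nb i c) =1 h (sh e (s * L) (nb i c))) ->
  hom_at w h (sh e (s * L) i) -> hom_at w d i.
Proof.
move=> s0 hi hd di dn; apply: hom_at_transfer => //.
- by rewrite !(tail_pos ht) //; apply: ray_sh.
- by rewrite (tail_vertM hw ht).
- move=> c x m; case hn: (ray e p (nb i c)).
    rewrite dn // sh_nb; case: (eqVneq c e) hn => [-> _|ce hn]; first by rewrite (tail_stepM ht).
    have -> : c = ~~ e by move: ce; case: (c); case: (e).
    case: (eqVneq i p) => [ip|/eqP ip]; last by rewrite (tail_stepM_back ht).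
    by move: hn; rewrite ip; have -> : c = ~~ e by [move: ce; case: (c); case: (e)]; rewrite ray_nbN.
  have [-> ip] := ray_leave hi (negbT hn); rewrite hd ?if_same ?hn //; last first.
    by rewrite ip ray_nbN.
  by rewrite ip; have [a ->] := tail_wrapM ht s0; case: eqP => // -[].
Qed.

Lemma strip_end_descending j u : strip_end j.+1 u -> strip_end j u.
Proof.
move=> [d [h1 h2 h3 h4] <-]; pose d' i m := if ray e p i then d (sh e (1 * L) i) m else 0.
exists d'; last by apply/funext => m; rewrite /d' ray_origin -sh_add -mulnDl add1n.
split.
- by move=> i; apply: klinear_if => //; apply: klinear_cst0.
- by move=> i x; rewrite /d' h2 if_same.
- by move=> i /negPf hi m; rewrite /d' hi.
- move=> i hi hi'; apply: (@hom_at_shift_back d d' 1 i) => //.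
  + by move=> k /negPf hk m; rewrite /d' hk.
  + by move=> m; rewrite /d' hi.
  + by move=> c hc m; rewrite /d' hc.
  + apply: h4; first exact: ray_sh.
    by rewrite -(addn1 j) mulnDl addnC sh_add ray_sh2.
Qed.

(** Along a contracting tail a family can be made to vanish from some point on
    without losing its composite with [f], once that composite vanishes: the
    tail of the family is subtracted after being continued back to [p], which is
    possible because the chain of the spaces [strip_end j] becomes stationary. *)
Lemma contracting_cut : exists D, forall (g : int -> M -> K) (h : int -> N -> K) m k,
  (0 < m)%N -> (m + D <= k)%N -> (forall i, klinear (h i)) ->
  (forall i, ray e (q m) i -> g i =1 (fun=> 0)) ->
  (forall i, ray e p i -> ~~ ray e (q k) i -> hom_at w h i) ->
  (forall i x, ray e p i -> ~~ ray e (nb (q k) e) i -> h i (f x) = g i x) ->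
  exists h' : int -> N -> K, [/\ forall i, klinear (h' i),
    forall i, ~~ ray e p i -> h' i =1 h i,
    forall i, ray e (q k) i -> h' i =1 (fun=> 0),
    forall i, ray e p i \/ hom_at w h i -> hom_at w h' i &
    forall i x, ray e p i -> h' i (f x) = g i x].
Proof.
have [D hD] := descending_stable fd strip_end_subspace strip_end_descending.
exists D => g h m k m0 mDk hl g0 hh hf.
have mk : (m <= k)%N by apply: leq_trans mDk; apply: leq_addr.
have qE : sh e (m * L) (q (k - m)) = q k by rewrite -sh_add -mulnDl subnKC.
have pq j i : ray e (q j) i -> ray e p i by apply: ray_trans; apply/rayP; exists (j * L)%N.
(* [h] from [q m] on, where [g] is already zero, moved back to [p] *)
have end1 : strip_end (k - m) (h (q k)).
  pose d i x := if ray e p i && ~~ ray e (nb (q (k - m)) e) i then h (sh e (m * L) i) x else 0.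
  have below i : ~~ ray e (nb (q k) e) (sh e (m * L) i) = ~~ ray e (nb (q (k - m)) e) i.
    by rewrite -qE -sh_nb ray_sh2.
  exists d; last first.
    apply/funext => x; rewrite /d qE (pq (k - m)%N) ?ray_refl //.
    by have -> : ~~ ray e (nb (q (k - m)) e) (q (k - m)) by case: (e); rewrite /ray /nb; lia.
  split.
  - by move=> i; rewrite /d; case: (_ && _) => //; apply: klinear_cst0.
  - move=> i x; rewrite /d; case: ifP => // /andP[hi hi'].
    by rewrite hf ?below //; [rewrite g0 // ray_sh2|apply: ray_sh].
  - by move=> i /negPf hi x; rewrite /d hi.
  - move=> i hi hi'.
    have ii : ray e p i && ~~ ray e (nb (q (k - m)) e) i.
      by rewrite hi; move: hi'; rewrite /ray /nb; case: (e); lia.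
    apply: (@hom_at_shift_back h d m i) => //.
    + by move=> c /negPf hc x; rewrite /d hc.
    + by move=> x; rewrite /d ii.
    + move=> c hc x; rewrite /d hc.
      have -> // : ~~ ray e (nb (q (k - m)) e) (nb i c).
      by move: hi'; rewrite /ray /nb; case: (e); case: (c); lia.
    + apply: hh; first exact: ray_sh.
      by rewrite -qE ray_sh2.
have [d [d1 d2 d3 d4] dq] : strip_end k (h (q k)).
  apply: hD; have := end1; have : (D <= k - m)%N by lia.
  elim: (k - m)%N => [|n IH]; first by rewrite leqn0 => /eqP ->.
  by rewrite leq_eqVlt => /orP[/eqP ->//|/IH h'] /strip_end_descending.
(* [d] reaches the same value at [q k] over the whole length of the tail *)
pose h' i x := if ray e (q k) i then 0 else 1 * h i x + -1 * d i x.
have h'E i : ~~ ray e (nb (q k) e) i -> h' i =1 (fun x => 1 * h i x + -1 * d i x).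
  move=> hi x; rewrite /h'; case: ifP => // hi'.
  have -> : i = q k by move: hi hi'; rewrite /ray /nb; case: (e); lia.
  by rewrite dq mul1r mulN1r subrr.
have out i : ~~ ray e p i -> h' i =1 h i.
  move=> hi x; rewrite /h' d3 // mulr0 addr0 mul1r.
  by case: ifP => // /pq; rewrite (negPf hi).
exists h'; split=> //.
- by move=> i; apply: klinear_if; [apply: klinear_cst0|apply: klinear_sub].
- by move=> i hi x; rewrite /h' hi.
- move=> i hi; case hp: (ray e p i); last first.
    case: hi => [|hi]; first by rewrite hp.
    apply: hom_at_eq hi => [x|c y hy x]; first by rewrite out ?hp.
    case hn: (ray e p (nb i c)); last by rewrite out ?hn.
    have [ce ip] := ray_enter (negbT hp) hn.
    by have := step_nb_some hy; rewrite ip ce => /(tail_start ht).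
  case hk: (ray e (q k) i); last first.
    apply: (@hom_at_eq _ _ _ _ (fun i x => 1 * h i x + -1 * d i x)).
    + by move=> x; rewrite /h' hk.
    + move=> c y _ x; rewrite h'E //; move: hk; rewrite /ray /nb; case: (e); case: (c); lia.
    + by apply: hom_at_comb; [apply: hh|apply: d4]; rewrite ?hk.
  apply: hom_at_eq (hom_at0 w N i) => [x|c y hy x]; first by rewrite /h' hk.
  rewrite /h'; case: ifP => // hn.
  have [ce ip] := ray_leave hk (negbT hn).
  have k0 : (0 < k)%N by lia.
  by move: hy; rewrite ce ip; have [a ->] := tail_wrapM ht k0.
- move=> i x hi; rewrite /h'; case: ifP => hk.
    rewrite g0 //; apply: ray_trans hk; by rewrite (ray_q L0).
  rewrite d2 mulr0 addr0 mul1r hf //; move: hk; rewrite /ray /nb; case: (e); lia.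
Qed.

End Contracting.

Section Expanding.
Variable M : lmodType (algebra K A).
Hypotheses (ht : tail w e p L false) (fd : finite_dimensional M).

Let L0 := tail_L ht.

(** The condition at [q j] which a family satisfies if it continues beyond. *)
Definition inner_end (d : int -> M -> K) (j : nat) : Prop :=
  forall x m, step w (q j) (~~ e) = Some (x, true) -> d (q j) (arr K x *: m) = d (nb (q j) (~~ e)) m.

Definition initial_strip (d : int -> M -> K) (j : nat) : Prop :=
  [/\ forall i, klinear (d i), forall i, ~~ ray e p i -> d i =1 (fun=> 0),
      forall i, ray e p i -> ~~ ray e (q j) i -> hom_at w d i & inner_end d j].

Definition initial_end j (u : M -> K) : Prop := exists2 d, initial_strip d j & d (q j) = u.

Lemma initial_end_subspace j : subspace (initial_end j).
Proof.
split.
- by move=> u [d [h _ _ _] <-].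
- exists (fun _ _ => 0) => //; split=> // [i|i _ _]; first exact: klinear_cst0.
  exact: hom_at0.
- move=> a u v [d [h1 h2 h3 h4] <-] [d' [h1' h2' h3' h4'] <-].
  exists (fun i m => a * d i m + 1 * d' i m) => //; split.
  + by move=> i; apply: klinear_comb.
  + by move=> i hi m; rewrite h2 // h2' // !mulr0 addr0.
  + by move=> i hi hi'; apply: hom_at_comb; [apply: h3|apply: h3'].
  + by move=> x m hx; rewrite h4 // h4'.
Qed.

(** A strip beginning at [p] can be moved forward by whole periods and then
    continued by zero to the left, since the arrow that wraps around arrives. *)
Lemma initial_strip_shift d j s : (0 < j)%N -> (0 < s)%N -> initial_strip d j ->
  exists d' : int -> M -> K, [/\ forall i, klinear (d' i),
    forall i, ~~ ray e (q s) i -> d' i =1 (fun=> 0),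
    forall i, ~~ ray e (q (s + j)) i -> hom_at w d' i, inner_end d' (s + j) &
    d' (q (s + j)) = d (q j)].
Proof.
move=> j0 s0 [h1 h2 h3 h4].
pose bk i := sh (~~ e) (s * L) i.
have bkK i : sh e (s * L) (bk i) = i by rewrite /bk /sh; case: (e) => /=; lia.
have bkr i : ray e p (bk i) = ray e (q s) i by rewrite /ray /bk /sh; case: (e) => /=; lia.
have bknb i c : bk (nb i c) = nb (bk i) c by exact: sh_nb.
have bkq : bk (q (s + j)) = q j by rewrite mulnDl /bk /sh; case: (e) => /=; lia.
pose d' i m := if ray e (q s) i then d (bk i) m else 0.
have qjp : q j <> p by move: (leq_mul j0 L0); rewrite /sh; case: (e); lia.
have rqj : ray e p (q j) by apply/rayP; exists (j * L)%N.
exists d'; split.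
- by move=> i; apply: klinear_if => //; apply: klinear_cst0.
- by move=> i /negPf hi m; rewrite /d' hi.
- move=> i hi; case hr: (ray e (q s) i); last first.
    apply: hom_at_eq (hom_at0 w M i) => [m|c x hx m]; first by rewrite /d' hr.
    rewrite /d'; case: ifP => // hn; have [ce iq] := ray_enter (negbT hr) hn.
    have := step_nb_some hx; rewrite iq ce; have [a ->] := tail_wrapM ht s0; by [].
  have hb : ray e p (bk i) by rewrite bkr.
  have hb' : ~~ ray e (q j) (bk i) by rewrite -bkq /bk ray_shV.
  apply: hom_at_transfer (h3 _ hb hb').
  + by move=> m; rewrite /d' hr.
  + by rewrite !(tail_pos ht) // -(bkK i); apply: ray_sh.
  + by move=> _; rewrite -{1}(bkK i) (tail_vertM hw ht).
  + move=> c x m; rewrite /d' bknb -bkr bknb.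
    case: (eqVneq c e) => [->|ce].
      by rewrite (ray_nb hb) -{1}(bkK i) (tail_stepM ht).
    have -> : c = ~~ e by move: ce; case: (c); case: (e).
    case: (eqVneq (bk i) p) => [ip|/eqP ip].
      rewrite ip ray_nbN if_same; case: eqP => // /(tail_start ht) //.
    by rewrite (ray_nbV hb ip) -{1}(bkK i) (tail_stepM_back ht).
- move=> x m; rewrite /d' -!bkr bknb bkq rqj (ray_nbV rqj qjp) => hx.
  by apply: h4; rewrite -hx -bkq -{2}(bkK (q (s + j))) (tail_stepM_back ht) // bkq.
- by apply/funext => m; rewrite /d' -bkr bkq rqj.
Qed.

Lemma initial_end_ascending j u : initial_end j.+1 u -> initial_end j.+2 u.
Proof.
move=> [d hd <-]; have [d' [k1 k2 k3 k4 k5]] := initial_strip_shift (ltn0Sn j) (ltn0Sn 0) hd.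
exists d' => //; split=> // i hi; last by move=> hi'; apply: k3.
by apply: k2; apply: contra hi; apply: ray_trans; apply/rayP; exists (1 * L)%N.
Qed.

(** Along an expanding tail a homomorphism can be made to vanish from some point
    on without being changed before any given point: the functional occurring
    there is also reached from zero within a bounded number of periods. *)
Lemma expanding_cut (g : int -> M -> K) n :
  (forall i, klinear (g i)) -> (forall i, hom_at w g i) ->
  exists2 g' : int -> M -> K, (forall i, klinear (g' i)) /\ (forall i, hom_at w g' i) &
    (forall i, ~~ ray e (q n) i -> g' i =1 g i) /\
    exists k, forall i, ray e (q k) i -> g' i =1 (fun=> 0).
Proof.
move=> gl gh.
have [D hD] := @ascending_stable K A M (fun j => initial_end j.+1) fd
  (fun j => initial_end_subspace j.+1) (@initial_end_ascending).
pose s := n.+1; pose k := (s + D.+1)%N.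
have : initial_end k.-1.+1 (g (q k)).
  exists (fun i m => if ray e p i then g i m else 0); last first.
    by apply/funext => m; rewrite (_ : ray _ _ _ = true) //; apply/rayP; exists (k * L)%N.
  have qkp : q k <> p by rewrite /k /s mulnDl mulSn /sh; case: (e); move: L0; lia.
  have rqk : ray e p (q k) by apply/rayP; exists (k * L)%N.
  split.
  - by move=> i; apply: klinear_if => //; apply: klinear_cst0.
  - by move=> i /negPf hi m; rewrite hi.
  - move=> i hi _; apply: hom_at_eq (gh i) => [m|c x hx m]; first by rewrite hi.
    case: ifP => // /negbT hn; have [ce ip] := ray_leave hi hn.
    by move: hx; rewrite ce ip => /(tail_start ht).
  - move=> x m hx; rewrite rqk (ray_nbV rqk qkp) (gh _).2 (bigD1 (~~ e)) //= hx eqxx.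
    rewrite big1 ?addr0 // => c ce; case: eqP => // /(step_inj hw hx) h.
    by rewrite h eqxx in ce.
move=> /hD[d hd dq].
have [d' [k1 k2 k3 k4 k5]] := initial_strip_shift (ltn0Sn D) (ltn0Sn n) hd.
rewrite -/s -/k in k3 k4 k5; rewrite dq in k5.
pose g' i m := if ray e (q k) i then 0 else 1 * g i m + -1 * d' i m.
have g'E i : ~~ ray e (nb (q k) e) i -> g' i =1 (fun x => 1 * g i x + -1 * d' i x).
  move=> hi x; rewrite /g'; case: ifP => // hi'.
  have -> : i = q k by move: hi hi'; rewrite /ray /nb; case: (e); lia.
  by rewrite k5 mul1r mulN1r subrr.
exists g'; split.
- by move=> i; apply: klinear_if; [apply: klinear_cst0|apply: klinear_sub].
- move=> i; case hk: (ray e (q k) i); last first.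
    apply: (@hom_at_eq _ _ _ _ (fun i x => 1 * g i x + -1 * d' i x)).
    + by move=> x; rewrite /g' hk.
    + move=> c y _ x; rewrite g'E //; move: hk; rewrite /ray /nb; case: (e); case: (c); lia.
    + by apply: hom_at_comb => //; apply: k3; rewrite hk.
  apply: hom_at_eq (hom_at0 w M i) => [x|c y hy x]; first by rewrite /g' hk.
  rewrite /g'; case: ifP => // /negbT hn; have [ce ip] := ray_leave hk hn.
  rewrite ce ip in hy *; rewrite -(k4 _ x hy) k5.
  have := (gh (q k)).2 y x; rewrite (bigD1 (~~ e)) //= hy eqxx big1 ?addr0 => [->|c' ce'].
    by rewrite mul1r mulN1r subrr.
  by case: eqP => // /(step_inj hw hy) h; rewrite h eqxx in ce'.
- move=> i hi m; have nk : ~~ ray e (q k) i.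
    by apply: contra hi; apply: ray_trans; rewrite (ray_q L0) /k /s; lia.
  rewrite /g' (negPf nk) k2 ?mulr0 ?addr0 ?mul1r //.
  by apply: contra hi; apply: ray_trans; rewrite (ray_q L0).
- by exists k => i hi m; rewrite /g' hi.
Qed.

End Expanding.
End Cuts.

(** * Morphisms that do not factor, seen in a window *)

Section Witness.
Variables (K : fieldType) (A : string_algebra) (w : string A).
Local Notation C := (string_module K w).
Variables (M N : lmodType (algebra K A)) (f : {linear M -> N}).
Hypotheses (fdM : finite_dimensional M) (fdN : finite_dimensional N).
Hypothesis (hside : forall e, tame_side w e).

Let hw := wd_string w.

Lemma uniformly_zero (g : int -> M -> K) e : (forall i, klinear (g i)) ->
  (forall x, exists k, forall i, beyond e k i -> g i x = 0) ->
  exists k, forall i, beyond e k i -> g i =1 (fun=> 0).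
Proof.
move=> gl hg; have [s hs] := fdM.
have [k hk] : exists k, forall x, x \in s -> forall i, beyond e k i -> g i x = 0.
  elim: s {hs} => [|x s [k hk]]; first by exists 0.
  have [k' hk'] := hg x; exists (if e then Num.max k k' else Num.min k k').
  move=> z; rewrite inE => /orP[/eqP ->|zs] i hi; [apply: hk'|apply: hk => //];
    by move: hi; case: (e) => /=; lia.
exists k => i hi x; have [c ->] := hs x.
rewrite klinear_sum //; apply: big1 => j _.
by rewrite (gl i).2 hk ?mulr0 //; apply: mem_nth.
Qed.

Section Solutions.
Variable g : int -> M -> K.
Hypotheses (gl : forall i, klinear (g i)) (gh : forall i, hom_at w g i).
Hypothesis gfin : forall e, contracting w e ->
  exists k, forall i, beyond e k i -> g i =1 (fun=> 0).

Definition partial_ext (P : int -> bool) (h : int -> N -> K) : Prop :=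
  [/\ forall i, klinear (h i), forall i, P i -> hom_at w h i &
      forall i x, P i -> h i (f x) = g i x].

(** On a side which is finite or contracting, partial extensions reaching far
    enough can be replaced by ones which vanish from some point on and are
    complete on that side. *)
Lemma side_cut e : exists (cl : bool) (k k2 : int) (n0 : nat),
  (cl = false -> ~ contracting w e) /\
  forall (P : int -> bool) h, (forall i, (absz i < n0)%N -> P i) -> partial_ext P h ->
  exists h', [/\ partial_ext (fun i => P i || (cl && beyond e k i)) h',
    forall i, ~~ beyond e k2 i -> h' i =1 h i &
    cl -> forall i, beyond e k i -> h' i =1 (fun=> 0)].
Proof.
have contr : contracting w e -> exists (k k2 : int) (n0 : nat),
    forall (P : int -> bool) h, (forall i, (absz i < n0)%N -> P i) -> partial_ext P h ->
    exists h', [/\ partial_ext (fun i => P i || beyond e k i) h',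
    forall i, ~~ beyond e k2 i -> h' i =1 h i &
    forall i, beyond e k i -> h' i =1 (fun=> 0)].
  move=> hc; have [p [L ht]] := contracting_tail hw hc.
  have [D hD] := contracting_cut hw f ht fdN.
  have [k0 hk0] := gfin hc; have L0 := tail_L ht.
  pose m := (absz (k0 - p)%R).+1; pose k := (m + D)%N.
  have gm i : ray e (sh e (m * L) p) i -> g i =1 (fun=> 0).
    move=> hi; apply: hk0; move: hi; rewrite /ray /sh /beyond.
    have : (m <= m * L)%N by rewrite leq_pmulr.
    by rewrite {1}/m; move: (m * L)%N => c; case: (e); lia.
  exists (sh e (k * L) p), p, (absz p + k * L).+3 => P h hP [hl hh hf].
  have inP i : ray e p i -> ~~ ray e (nb (sh e (k * L) p) e) i -> P i.
    by move=> h1 h2; apply: hP; move: h1 h2; rewrite /ray /sh /nb; move: (k * L)%N => c; case: (e); lia.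
  have [i h1 h2|i x h1 h2|h' [l1 l2 l3 l4 l5]] := hD g h m k (ltn0Sn _) (leqnn _) hl gm.
  - apply: hh; apply: inP => //; move: h2; rewrite /ray /nb; case: (e); lia.
  - by apply: hf; apply: inP.
  have rayk i : beyond e (sh e (k * L) p) i -> ray e p i.
    by rewrite /beyond /ray /sh; move: (k * L)%N => c; case: (e); lia.
  exists h'; split.
  - split=> // [i /orP[/hh|/rayk]|i x hi]; [by move=> ?; apply: l4; right|by move=> ?; apply: l4; left|].
    case hr: (ray e p i); first exact: l5.
    have {}hi : P i by case/orP: hi => // /rayk; rewrite hr.
    by rewrite l2 ?hr // hf.
  - by move=> i hi; apply: l2.
  - by move=> i hi; apply: l3.
case: (hside e) => [[n hn]|hc|[hc _]].
- exists true, n, n, 0%N; split=> // P h _ [hl hh hf].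
  pose h' i x := if beyond e n i then 0 else h i x.
  have same i : is_pos w i -> h' i =1 h i.
    by move=> hi x; rewrite /h'; case: ifP => // /hn; rewrite hi.
  exists h'; split=> [|i /negPf hi x|_ i hi x]; rewrite /h' ?hi //.
  split.
  + by move=> i; apply: klinear_if => //; apply: klinear_cst0.
  + move=> i; case hi: (beyond e n i) => hP.
      apply: hom_at_eq (hom_at0 w N i) => [x|d y hy x]; first by rewrite hi.
      by have [] := step_ends hw hy; rewrite (negPf (hn _ hi)).
    apply: hom_at_eq (hh i _) => [x|d y hy x|]; first by rewrite hi.
      by have [_ pd _ _] := step_ends hw hy; rewrite -/(h' _ _) same.
    by case/orP: hP => //; rewrite hi.
  + move=> i x; case hi: (beyond e n i) => hP; last by apply: hf; rewrite andbF orbF in hP.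
    by rewrite (hom_at_pos _ (gl i) (gh i)) // hn.
- have [k [k2 [n0 H]]] := contr hc; exists true, k, k2, n0; split=> // P h hP /(H P h hP).
  by move=> [h' [p1 p2 p3]]; exists h'.
- exists false, 0, 0, 0%N; split=> // P h _ hs; exists h; split=> //.
  by case: hs => h1 h2 h3; split=> // [i|i x]; rewrite orbF; [apply: h2|apply: h3].
Qed.

(** Linear compactness glues partial extensions.  To end up in the string module, they
    are first cut off on the contracting sides, beyond a position which does
    not depend on the window; vanishing there is a linear condition too. *)
Lemma windows_extend :
  (forall n : nat, exists h, partial_ext (fun i => (absz i < n)%N) h) ->
  exists h : int -> N -> K, [/\ forall i, klinear (h i), forall i, hom_at w h i,
    forall i x, h i (f x) = g i x &
    forall e, contracting w e -> exists k, forall i, beyond e k i -> h i =1 (fun=> 0)].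
Proof.
move=> hwin.
have [c1 [k1 [l1 [n1 [hc1 cut1]]]]] := side_cut true.
have [c2 [k2 [l2 [n2 [hc2 cut2]]]]] := side_cut false.
(* the cut on the left changes the family only up to [l2] *)
pose b1 := Num.max k1 (l2 + 1).
pose Z i := (c1 && (b1 <= i)) || (c2 && (i <= k2)).
have win n : exists2 h, partial_ext (fun i => (absz i < n)%N || Z i) h &
    forall i, Z i -> h i =1 (fun=> 0).
  have [h hh] := hwin (n + (n1 + n2))%N.
  have [|h1 [p1 e1 z1]] := cut1 _ h _ hh; first by move=> i hi; lia.
  have [|h2 [p2 e2 z2]] := cut2 _ h1 _ p1; first by move=> i hi; lia.
  exists h2.
    case: p2 => q1 q2 q3; split=> // [i hi|i x hi]; [apply: q2|apply: q3];
      by move: hi; rewrite /Z /b1 /=; case: (c1); case: (c2) => /=; lia.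
  move=> i /orP[/andP[hc hi]|/andP[hc hi]] x; last by apply: z2.
  by rewrite e2 ?z1 //; move: hi; rewrite /b1 /=; lia.
pose E (F : seq (int * N)) c := exists i, [\/
  exists s y, [/\ hom_rel w i s, F = hom_form s y & c = 0],
  exists x, F = [:: (i, f x)] /\ c = g i x |
  exists y, [/\ Z i, F = [:: (i, y)] & c = 0]].
have [||h [hl hE]] := @finitely_solvable K A N E.
- move=> k F c [i [[s [y [hs -> ->]]]|[x [-> ->]]|[y [hi -> ->]]]]; exists i.
  + by constructor 1; exists s, (scalar A k *: y); rewrite hom_form_scale mulr0.
  + by constructor 2; exists (scalar A k *: x); rewrite /form_scale /= linearZ_LR (gl i).2.
  + by constructor 3; exists (scalar A k *: y); rewrite mulr0.
- move=> S hS.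
  have /choice[o ho] (q : seq (int * N) * K) : exists i : int, q \in S -> [\/
      exists s y, [/\ hom_rel w i s, q.1 = hom_form s y & q.2 = 0],
      exists x, q.1 = [:: (i, f x)] /\ q.2 = g i x |
      exists y, [/\ Z i, q.1 = [:: (i, y)] & q.2 = 0]].
    case: (pselect (q \in S)) => [/hS[i hi]|]; [by exists i|by exists 0].
  pose n := (\max_(q <- S) absz (o q)).+1.
  have on q : q \in S -> (absz (o q) < n)%N.
    by move=> qS; rewrite ltnS; apply: (leq_bigmax_seq (F := fun q => absz (o q))).
  have [h [hl hh hf] hz] := win n; exists h; split=> // q qS.
  have := ho q qS; case=> [[s [y [hs -> ->]]]|[x [-> ->]]|[y [hi -> ->]]].
  + rewrite hom_form_eval; apply: (hom_at_rel w (o q) hl).1 => //.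
    by apply: hh; rewrite on.
  + by rewrite /form_eval big_seq1 hf // on.
  + by rewrite /form_eval big_seq1 hz.
exists h; split=> // [i|i x|e he].
- apply/(hom_at_rel w i hl) => s y hs; rewrite -hom_form_eval; apply: hE.
  by exists i; constructor 1; exists s, y.
- have := hE [:: (i, f x)] (g i x); rewrite /form_eval big_seq1; apply.
  by exists i; constructor 2; exists x.
- have hz i : Z i -> h i =1 (fun=> 0).
    move=> hi y; have := hE [:: (i, y)] 0; rewrite /form_eval big_seq1; apply.
    by exists i; constructor 3; exists y.
  case: e he => he.
    have {}hc1 : c1 by case: (c1) hc1 => // /(_ erefl).
    by exists b1 => i /= hi; apply: hz; rewrite /Z hc1 hi.
  have {}hc2 : c2 by case: (c2) hc2 => // /(_ erefl).
  by exists k2 => i /= hi; apply: hz; rewrite /Z hc2 hi orbT.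
Qed.

End Solutions.

(** Only expanding sides, on which [g] may have infinite support, need a change. *)
Lemma side_truncate e n (g : int -> M -> K) :
  (forall i, klinear (g i)) -> (forall i, hom_at w g i) ->
  (contracting w e -> exists k, forall i, beyond e k i -> g i =1 (fun=> 0)) ->
  exists2 g' : int -> M -> K, (forall i, klinear (g' i)) /\ (forall i, hom_at w g' i) &
    (forall i, ~~ beyond e (sh e n 0) i -> g' i =1 g i) /\
    exists k, forall i, beyond e k i -> g' i =1 (fun=> 0).
Proof.
move=> gl gh gfin; case: (hside e) => [[k hk]|hc|[hc [p [L ht]]]].
- exists g => //; split=> //; exists k => i /hk hi x; exact: hom_at_pos _ (gl i) (gh i) hi.
- by exists g => //; split=> //; apply: gfin.
have L0 := tail_L ht.
have [g' h1 [h2 [k h3]]] := expanding_cut hw ht fdM (n + absz p) gl gh.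
exists g' => //; split; last by exists (sh e (k * L) p) => i hi; apply: h3.
move=> i hi; apply: h2; move: hi; rewrite /beyond /ray /sh.
have : (n + absz p <= (n + absz p) * L)%N by rewrite leq_pmulr.
by move: ((n + absz p) * L)%N => c; case: (e); lia.
Qed.

(** By [windows_extend], the conditions at finitely many positions already prevent
    the factorization; truncating the homomorphism beyond these positions keeps
    the obstruction. *)
Lemma finite_witness (g : {linear M -> C}) :
  ~ (exists h : {linear N -> C}, forall m, h (f m) = g m) ->
  exists (n : nat) (g' : int -> M -> K), [/\ forall i, klinear (g' i),
    forall i, hom_at w g' i, forall i, (n <= absz i)%N -> g' i =1 (fun=> 0) &
    forall h : int -> N -> K, (forall i, klinear (h i)) ->
      (forall i, (absz i < n)%N -> hom_at w h i) ->
      ~ forall i x, (absz i < n)%N -> h i (f x) = g' i x].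
Proof.
move=> nf; pose gc i x := coord (g x) i.
have gl i : klinear (gc i) by have [] := hom_coord g i.
have gh i : hom_at w gc i by have [] := hom_coord g i.
have gfin e : contracting w e -> exists k, forall i, beyond e k i -> gc i =1 (fun=> 0).
  move=> hc; apply: uniformly_zero => // x.
  by have /is_familyP[_ h] := coord_family (g x); apply: h.
have [n hn] : exists n : nat, ~ exists h, partial_ext gc (fun i => (absz i < n)%N) h.
  apply: contrapT => hno.
  have [n|h [hl hh hf hfin]] := windows_extend gl gh gfin.
    by apply: contrapT => h; apply: hno; exists n.
  have [m|H HE] := @hom_of_coord _ _ w N h hl hh.
    apply/is_familyP; split=> [i hi|e /hfin[k hk]]; last by exists k => i /hk.
    exact: hom_at_pos _ (hl i) (hh i) hi.
  by apply: nf; exists H => m; apply: coord_inj => i; rewrite HE hf.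
have [g1 [gl1 gh1] [eq1 [k1 z1]]] := side_truncate n gl gh (gfin true).
have [|g2 [gl2 gh2] [eq2 [k2 z2]]] := @side_truncate false n g1 gl1 gh1.
  move=> hc; have [k hk] := gfin false hc.
  exists (Num.min k (- 1)) => i hi x; rewrite eq1 ?hk //; move: hi; rewrite /beyond /sh; lia.
pose n' := (n + absz k1 + absz k2).+1.
exists n', g2; split=> // [i hi x|h hl hh hf].
  case: (lerP 0 i) => h0; last by rewrite z2 //; move: hi; rewrite /n' /=; lia.
  by rewrite eq2 ?z1 //; move: hi; rewrite /n' /beyond /sh; lia.
apply: hn; exists h; split=> // [i hi|i x hi]; first by apply: hh; rewrite /n'; lia.
rewrite hf ?eq2 ?eq1 //; move: hi; rewrite /n' /beyond /sh; lia.
Qed.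

(** A homomorphism with finite support and a finite obstruction are both visible in a
    window of [w], so they can be transferred to any string sharing this window. *)
Lemma not_factoring_nearby (g : {linear M -> C}) :
  ~ (exists h : {linear N -> C}, forall m, h (f m) = g m) ->
  exists n : nat, forall (y : string A) (s : int),
    (forall i, (absz i <= n)%N -> is_pos y (i + s) = is_pos w i) ->
    (forall i, (absz i <= n)%N -> is_pos w i -> vert y (i + s) = vert w i) ->
    (forall i d, (absz i <= n)%N -> step y (i + s) d = step w i d) ->
    exists g' : {linear M -> string_module K y},
      ~ exists h : {linear N -> string_module K y}, forall m, h (f m) = g' m.
Proof.
move=> /finite_witness[n [g0 [gl gh gz nfac]]]; exists n => y s hp hv hs.
have nbs i d : nb (i + s) d = nb i d + s by rewrite /nb; case: d; lia.
pose gy j x := g0 (j - s) x.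
have gyE i : gy (i + s) =1 g0 i by move=> x; rewrite /gy addrK.
have [|j|m|G GE] := @hom_of_coord _ _ y M gy.
- by move=> j; apply: gl.
- rewrite -(subrK s j); move: (j - s) => i.
  case: (leqP (absz i) n) => hi.
    apply: hom_at_transfer (gh i); [exact: gyE|by rewrite hp|exact: hv|].
    by move=> d x m; rewrite hs // nbs gyE.
  apply: hom_at_eq (hom_at0 y M (i + s)) => [m|d x _ m]; first by rewrite gyE gz // ltnW.
  by rewrite nbs gyE gz //; move: hi; rewrite /nb; case: (d); lia.
- apply: (@finite_family _ _ _ _ (s - n%:Z) (s + n%:Z)) => j hj; last by rewrite /gy gz //; lia.
  case: (leqP n (absz (j - s)%R)) => h; first by rewrite /gy gz.
  apply: hom_at_pos _ (gl _) (gh _) _; rewrite -hp ?subrK //; exact: ltnW.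
exists G => -[h hh]; pose hc i x := coord (h x) (i + s).
apply: (nfac hc) => [i|i hi|i x hi].
- by have [] := hom_coord h (i + s).
- have hi' : (absz i <= n)%N := ltnW hi.
  have [_ H] := hom_coord h (i + s); apply: hom_at_transfer H => //.
  + by rewrite hp.
  + by rewrite hp // => pi; rewrite hv.
  + by move=> d x m; rewrite hs // nbs.
- by rewrite /hc hh GE gyE.
Qed.

End Witness.

(** * Quotients and universal modules *)

Local Open Scope quotient_scope.

Section QuotientModule.
Variables (R : pzRingType) (X : lmodType R) (S : X -> Prop) (hS : submodule S).

Definition mem_sub of submodule S : {pred X} := fun x => `[< S x >].

Lemma mem_sub_zmod_closed (h : submodule S) : zmod_closed (mem_sub h).
Proof.
split=> [|x y /asboolP hx /asboolP hy]; apply/asboolP; first exact: h.1.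
exact: (submoduleB h).
Qed.
HB.instance Definition _ h :=
  GRing.isZmodClosed.Build X (mem_sub h) (mem_sub_zmod_closed h).

Definition quotm : Type := {ideal_quot (mem_sub hS)}.
HB.instance Definition _ := GRing.Zmodule.on quotm.

Definition qpi (x : X) : quotm := \pi_{ideal_quot (mem_sub hS)} x.
Definition qrepr (q : quotm) : X := repr (q : {ideal_quot (mem_sub hS)}).

Lemma qreprK q : qpi (qrepr q) = q. Proof. exact: reprK. Qed.

Lemma qpi_eq x y : qpi x = qpi y <-> S (x - y).
Proof.
split=> [/eqP|h]; last apply/eqP.
  by rewrite /qpi -Quotient.idealrBE => /asboolP.
by rewrite /qpi -Quotient.idealrBE; apply/asboolP.
Qed.

Lemma qpiD : {morph qpi : x y / x + y}.
Proof. by move=> x y; rewrite /qpi !piE. Qed.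

Definition qscale (r : R) (q : quotm) : quotm := qpi (r *: qrepr q).

Lemma qscale_pi r x : qscale r (qpi x) = qpi (r *: x).
Proof.
apply/qpi_eq; rewrite -scalerBr; apply: (submoduleZ hS).
by apply/qpi_eq; rewrite qreprK.
Qed.

Lemma qscaleA r s q : qscale r (qscale s q) = qscale (r * s) q.
Proof. by rewrite -(qreprK q) !qscale_pi scalerA. Qed.
Lemma qscale1 : left_id 1 qscale.
Proof. by move=> q; rewrite -(qreprK q) qscale_pi scale1r. Qed.
Lemma qscaleDr : right_distributive qscale +%R.
Proof.
by move=> r p q; rewrite -(qreprK q) -(qreprK p) -qpiD !qscale_pi scalerDr qpiD.
Qed.
Lemma qscaleDl q : {morph qscale^~ q : r s / r + s}.
Proof. by move=> r s; rewrite -(qreprK q) !qscale_pi scalerDl qpiD. Qed.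
HB.instance Definition _ := GRing.Zmodule_isLmodule.Build R quotm
  qscaleA qscale1 qscaleDr qscaleDl.

Lemma qpi_linear : linear (qpi : X -> quotm).
Proof. by move=> r x y; rewrite qpiD -qscale_pi. Qed.

End QuotientModule.

Section PPModules.
Variables (K : fieldType) (A : string_algebra).
Local Notation R := (algebra K A).

Lemma quotient_map (X : lmodType R) (S : X -> Prop) : submodule S ->
  exists (N : lmodType R) (q : {linear X -> N}), [/\ forall n, exists x, q x = n,
    forall x, S x -> q x = 0 &
    forall (T : lmodType R) (u : {linear X -> T}), (forall x, S x -> u x = 0) ->
      exists h : {linear N -> T}, forall x, h (q x) = u x].
Proof.
move=> hS; exists (quotm hS), (mk_linear (qpi_linear hS)); split.
- by move=> n; exists (qrepr n); apply: qreprK.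
- move=> x Sx; rewrite -[LHS]/(qpi hS x) -(linear0 (mk_linear (qpi_linear hS))).
  by apply/(qpi_eq hS); rewrite subr0.
- move=> T u hu; pose h (n : quotm hS) := u (qrepr n).
  have hpi x : h (qpi hS x) = u x.
    apply/eqP; rewrite -subr_eq0 -linearB; apply/eqP/hu/(qpi_eq hS); exact: qreprK.
  have hlin : linear h.
    move=> r m n; rewrite -(qreprK m) -(qreprK n) -qpi_linear !hpi.
    exact: linearP.
  by exists (mk_linear hlin).
Qed.

Lemma fdP (M : lmodType R) : finite_dimensional M <->
  exists (I : finType) (b : I -> M), forall m, exists k : I -> K,
    m = \sum_i scalar A (k i) *: b i.
Proof.
split=> [[s hs]|[I [b hb]]].
  exists 'I_(size s), (fun i : 'I_(size s) => s`_i) => m; have [k ->] := hs m.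
  by exists (fun i : 'I_(size s) => k i).
exists [seq b i | i <- enum I] => m; have [k ->] := hb m.
case: (pickP (fun _ : I => true)) => [i0 _|I0]; last first.
  exists (fun=> 0); rewrite big1 => [|i _]; last by have := I0 i.
  by rewrite big1 // => i _; rewrite scalar0 scale0r.
exists (fun j => k (nth i0 (enum I) j)); rewrite size_map.
rewrite -(big_mkord predT (fun j => scalar A (k (nth i0 (enum I) j)) *: [seq b i | i <- enum I]`_j)).
transitivity (\sum_(i <- enum I) scalar A (k i) *: b i); first by rewrite big_enum.
rewrite (big_nth i0); apply: eq_big_nat => j /andP[_ hj].
by congr (_ *: _); rewrite -[RHS]/(nth 0 (map b (enum I)) j) (nth_map i0 0 b hj).
Qed.

Lemma fd_prod (M N : lmodType R) :
  finite_dimensional M -> finite_dimensional N -> finite_dimensional (M * N)%type.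
Proof.
move=> /fdP[I [b hb]] /fdP[J [c hc]]; apply/fdP.
exists (I + J)%type, (fun x => match x with inl i => (b i, 0) | inr j => (0, c j) end) => -[m n].
have [k ->] := hb m; have [l ->] := hc n.
exists (fun x => match x with inl i => k i | inr j => l j end).
rewrite big_sumType /=.
have E1 : \sum_i scalar A (k i) *: ((b i, 0) : M * N) = (\sum_i scalar A (k i) *: b i, 0).
  rewrite (big_morph (fun x : M => (x, 0 : N)) (id1 := 0) (op1 := +%R)) //.
    by apply: eq_bigr => i _; rewrite -[LHS]/(scalar A (k i) *: b i, scalar A (k i) *: (0 : N)) scaler0.
  by move=> x y; rewrite -[RHS]/(x + y, 0 + 0) addr0.
have E2 : \sum_j scalar A (l j) *: ((0, c j) : M * N) = (0, \sum_j scalar A (l j) *: c j).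
  rewrite (big_morph (fun x : N => (0 : M, x)) (id1 := 0) (op1 := +%R)) //.
    by apply: eq_bigr => i _; rewrite -[LHS]/(scalar A (l i) *: (0 : M), scalar A (l i) *: c i) scaler0.
  by move=> x y; rewrite -[RHS]/(0 + 0, x + y) addr0.
by rewrite E1 E2 -[RHS]/(_ + 0, 0 + _) addr0 add0r.
Qed.

Lemma fd_image (M N : lmodType R) (q : {linear M -> N}) :
  finite_dimensional M -> (forall n, exists m, q m = n) -> finite_dimensional N.
Proof.
move=> /fdP[I [b hb]] hq; apply/fdP; exists I, (fun i => q (b i)) => n.
have [m <-] := hq n; have [k ->] := hb m; exists k.
by rewrite linear_sum; apply: eq_bigr => i _; rewrite linearZ_LR.
Qed.

Lemma fd_regular : finite_dimensional (R^o : lmodType R).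
Proof.
apply/fdP; exists (nzpath A), (fun p => path_elt K (val p)) => r.
by exists (fun p => r p); rewrite {1}(algebra_sum r).
Qed.

(** The module freely obtained from [M] by making [m0] a multiple of [r0]. *)
Lemma multiple_module (M : lmodType R) (m0 : M) (r0 : R) : finite_dimensional M ->
  exists (N : lmodType R) (j : {linear M -> N}), finite_dimensional N /\
    forall (T : lmodType R) (g : {linear M -> T}),
      (exists h : {linear N -> T}, forall m, h (j m) = g m) <->
      exists t, g m0 = r0 *: t.
Proof.
move=> fd; pose X : lmodType R := (M * R^o)%type.
pose S (x : X) := exists r, x = (r *: m0, - (r * r0)).
have hS : submodule S.
  split; first by exists 0; rewrite scale0r mul0r oppr0.
  move=> q _ _ [r ->] [s ->]; exists (q * r + s).
  rewrite -[LHS]/(q *: (r *: m0) + s *: m0, q * - (r * r0) + - (s * r0)).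
  by rewrite scalerDl -scalerA mulrDl opprD mulrN mulrA.
have [N [q [qs q0 qu]]] := quotient_map hS.
have il : linear (fun m : M => (m, 0) : X).
  by move=> r m n; rewrite -[RHS]/(r *: m + n, r *: (0 : R^o) + 0) scaler0 addr0.
have jl : linear (fun m : M => q (m, 0)) by move=> r m n; rewrite il linearP.
exists N, (mk_linear jl); split.
  by apply: fd_image qs; apply: fd_prod => //; apply: fd_regular.
move=> T g; split=> [[h hh]|[t ht]].
  exists (h (q (0, 1))); rewrite -hh -[mk_linear jl m0]/(q (m0, 0)) -!linearZ_LR; congr (h _).
  apply/eqP; rewrite -subr_eq0 -linearB; apply/eqP/q0; exists 1.
  rewrite -[LHS]/(m0 - r0 *: (0 : M), 0 - r0 * 1) scaler0 subr0 sub0r mulr1.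
  by rewrite scale1r mul1r.
pose u (x : X) := g x.1 + (x.2 : R) *: t.
have ul : linear u.
  move=> r x y; rewrite -[LHS]/(g (r *: x.1 + y.1) + (r * (x.2 : R) + (y.2 : R)) *: t).
  by rewrite linearP scalerDl -scalerA addrACA /u scalerDr.
have [x [r ->]|h hh] := qu T (mk_linear ul).
  rewrite -[LHS]/(g (r *: m0) + (- (r * r0)) *: t) linearZ_LR ht scalerA.
  by rewrite scaleNr subrr.
exists h => m; rewrite hh -[LHS]/(g m + (0 : R) *: t) scale0r addr0 //.
Qed.

(** The morphism from [M] to the product of the universal modules in which [m0] is a
    multiple of [r0] and in which [m1] vanishes, respectively.  A map from a
    product is a sum of maps from its factors. *)
Lemma split_module (M : lmodType R) (m0 m1 : M) (r0 : R) : finite_dimensional M ->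
  exists (N : lmodType R) (f : {linear M -> N}), finite_dimensional N /\
    forall (T : lmodType R) (g : {linear M -> T}),
      (exists h : {linear N -> T}, forall m, h (f m) = g m) <->
      exists g1 g2 : {linear M -> T}, [/\ forall m, g m = g1 m + g2 m,
        exists t, g1 m0 = r0 *: t & g2 m1 = 0].
Proof.
move=> fd; have [N1 [j1 [fd1 h1]]] := multiple_module m0 r0 fd.
have [N2 [j2 [fd2 h2]]] := multiple_module m1 0 fd.
have fl : linear (fun m => (j1 m, j2 m) : (N1 * N2)%type).
  by move=> r m n; rewrite !linearP.
exists (N1 * N2)%type, (mk_linear fl); split; first exact: fd_prod.
move=> T g; split=> [[h hh]|[g1 [g2 [gE /h1[k1 hk1] g20]]]].
  have l1 : linear (fun n1 : N1 => h (n1, 0)).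
    move=> r a b; rewrite -linearP; congr (h _).
    by rewrite -[RHS]/(r *: a + b, r *: (0 : N2) + 0) scaler0 addr0.
  have l2 : linear (fun n2 : N2 => h (0, n2)).
    move=> r a b; rewrite -linearP; congr (h _).
    by rewrite -[RHS]/(r *: (0 : N1) + 0, r *: a + b) scaler0 addr0.
  pose g1 : {linear M -> T} := mk_linear l1 \o j1.
  pose g2 : {linear M -> T} := mk_linear l2 \o j2.
  exists g1, g2; split.
  - move=> m; rewrite -hh -[mk_linear fl m]/(j1 m, j2 m).
    rewrite -[g1 m]/(h (j1 m, 0)) -[g2 m]/(h (0, j2 m)) -linearD; congr (h _).
    by rewrite -[RHS]/(j1 m + 0, 0 + j2 m) addr0 add0r.
  - by apply/h1; exists (mk_linear l1).
  - have [|t ->] := (h2 T g2).1 _; first by exists (mk_linear l2).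
    by rewrite scale0r.
have [|k2 hk2] := (h2 T g2).2 _; first by exists 0; rewrite scale0r.
have kl : linear (fun n : (N1 * N2)%type => k1 n.1 + k2 n.2).
  by move=> r a b; rewrite /= !linearP scalerDr addrACA.
by exists (mk_linear kl) => m; rewrite gE -hk1 -hk2.
Qed.

End PPModules.

(** * Image substrings and splitting of morphisms *)

Section FiniteStrings.
Variables (K : fieldType) (A : string_algebra).

Lemma finite_string_sum (w : string A) l n (m : string_module K w) :
  (forall i, is_pos w i -> l <= i <= l + n%:Z) ->
  m = \sum_(k < n.+1) scalar A (coord m (l + k%:Z)) *: zvec K w (l + k%:Z).
Proof.
move=> hw; apply: coord_inj => i; rewrite coord_sum.
under eq_bigr => k _ do rewrite scalar_act coord_zvec.
case: (boolP (is_pos w i)) => hi; last first.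
  rewrite big1 => [|k _]; last by rewrite andbF mulr0.
  by have /is_familyP[->] := coord_family m.
have lin := hw i hi; have hk : (absz (i - l)%R < n.+1)%N by lia.
rewrite (bigD1 (Ordinal hk)) //= big1 => [|k /eqP kne].
  have -> : l + (absz (i - l)%R)%:Z = i by lia.
  by rewrite eqxx mulr1 addr0.
case: eqP => [e|_]; last by rewrite mulr0.
by case: kne; apply: val_inj => /=; lia.
Qed.

Lemma finite_string_fd (w : string A) l n :
  (forall i, is_pos w i -> l <= i <= l + n%:Z) ->
  finite_dimensional (string_module K w).
Proof.
move=> hw; apply/fdP; exists 'I_n.+1, (fun k : 'I_n.+1 => zvec K w (l + k%:Z)) => m.
by exists (fun k : 'I_n.+1 => coord m (l + k%:Z)); apply: finite_string_sum.
Qed.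

Lemma link_coeff (y v : string A) (F : {linear string_module K v -> string_module K y})
    i j d d' l : step v j d = Some l -> step y i d' = Some l ->
  coord (F (zvec K v (nb j d))) (nb i d') = coord (F (zvec K v j)) i.
Proof.
case: l => x [] hj hi.
  have := arr_zvec K (step_nb_some hj); rewrite nbK => <-.
  by rewrite linearZ_LR (arr_act_in _ hi).
by rewrite -(arr_zvec K hj) linearZ_LR (arr_act_in _ (step_nb_some hi)) nbK.
Qed.

End FiniteStrings.

Section ImageSubstrings.
Variables (K : fieldType) (A : string_algebra) (v : fword A) (hv : is_fstring v).
Let V : string A := String hv.
Let n := size v.2.
Local Notation z k := (zvec K V (Posz k)).

Lemma fin_pos i : is_pos (fin_word v) i = (0 <= i <= n%:Z).
Proof. by []. Qed.

Lemma fin_step k : step V (Posz k) true = onth v.2 k.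
Proof.
rewrite /step /letter_at !fin_pos /=.
case: (ltnP k n) => hk; first by have -> // : (k%:Z <= n%:Z) && (0 <= k%:Z + 1 <= n%:Z) by lia.
rewrite (onth_default hk); by have -> // : (k%:Z <= n%:Z) && (0 <= k%:Z + 1 <= n%:Z) = false by lia.
Qed.

Lemma fin_step0 : step V 0 false = None.
Proof. by rewrite /step /letter_at !fin_pos. Qed.

Lemma fin_module_sum (m : string_module K V) :
  m = \sum_(k < n.+1) scalar A (coord m k%:Z) *: z k.
Proof.
rewrite {1}(@finite_string_sum K A V 0 n m) => [|i]; last by rewrite fin_pos add0r.
by apply: eq_bigr => k _; rewrite add0r.
Qed.

Lemma fin_module_fd : finite_dimensional (string_module K V).
Proof. by apply: (@finite_string_fd K A V 0 n) => i; rewrite fin_pos add0r. Qed.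

(** Since modules do not see the orientation of a string, image substrings of [y] and
    of its inverse have to be treated together; [f] is the direction of reading. *)
Definition image_at (y : word A) (s : int) (f : bool) : Prop :=
  [/\ is_pos y s, vert y s = v.1,
      forall k, (k < n)%N -> step y (sh f k s) f = onth v.2 k,
      forall x, step y s (~~ f) <> Some (x, false) &
      forall x, step y (sh f n s) f <> Some (x, false)].

Lemma image_at_inv y s f : image_at (word_inv y) s f <-> image_at y (- s) (~~ f).
Proof.
have E k : step (word_inv y) (sh f k s) f = step y (sh (~~ f) k (- s)) (~~ f).
  by rewrite step_inv sh_opp.
have E0 : step (word_inv y) s (~~ f) = step y (- s) (~~ ~~ f) by rewrite step_inv.
rewrite /image_at is_pos_inv; split=> -[h1 h2 h3 h4 h5]; split=> //.
- by move=> k hk; rewrite -E h3.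
- by move=> x; rewrite -E0.
- by move=> x; rewrite -E.
- by move=> k hk; rewrite E h3.
- by move=> x; rewrite E0.
- by move=> x; rewrite E.
Qed.

Section InString.
Variable y : string A.
Let hy := wd_string y.

Lemma image_at_pos s f k : image_at y s f -> (k <= n)%N -> is_pos y (sh f k s).
Proof.
move=> [h1 _ h3 _ _]; case: k => [|k] hk; first by rewrite sh0.
have [l hl] : exists l, onth v.2 k = Some l. by apply: onth_some.
have := h3 k hk; rewrite hl => /(step_ends hy)[_ + _ _].
by have -> : nb (sh f k s) f = sh f k.+1 s by rewrite /nb /sh; case: (f); lia.
Qed.

Lemma image_at_vert s f k : image_at y s f -> (k <= n)%N ->
  vert y (sh f k s) = vert V (Posz k).
Proof.
move=> him; have [h1 h2 h3 _ _] := him; case: k => [|k] hk; first by rewrite sh0 h2.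
have [l hl] : exists l, onth v.2 k = Some l. by apply: onth_some.
have := h3 k hk; rewrite hl => /(step_ends hy)[_ _ _].
have -> : nb (sh f k s) f = sh f k.+1 s by rewrite /nb /sh; case: (f); lia.
move=> <-; have := hl; rewrite -fin_step => /(step_ends hv)[_ _ _ ->].
by congr (vert V _); rewrite /nb; lia.
Qed.

(** The vectors of an image substring span a submodule, as no arrow leaves it. *)
Lemma image_inclusion s f : image_at y s f ->
  exists g : {linear string_module K V -> string_module K y},
    forall k, (k <= n)%N -> coord (g (z k)) (sh f k s) = 1.
Proof.
move=> him; have [h1 h2 h3 h4 h5] := him.
pose ka (i : int) : int := if f then i - s else s - i.
have kaK k : ka (sh f k s) = k%:Z by rewrite /ka /sh; case: (f); lia.
have inv i : 0 <= ka i <= n%:Z -> exists2 k, (k <= n)%N & i = sh f k s.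
  by move=> h; exists (absz (ka i)); move: h; rewrite /sh /ka; case: (f); lia.
have out (m : string_module K V) i : ~~ (0 <= i <= n%:Z) -> coord m i = 0.
  by rewrite -fin_pos => hi; have /is_familyP[->] := coord_family m.
have [|i|m|g hg] := @hom_of_coord K A y (string_module K V) (fun i m => coord m (ka i)).
- by move=> i; split=> [m m'|k m]; rewrite ?coordD ?scalar_act.
- split=> [u m|x m].
    rewrite vtx_act; case: (boolP (0 <= ka i <= n%:Z)) => hi; last by rewrite out // !if_same.
    have [k kn ->] := inv i hi; rewrite kaK fin_pos (image_at_pos him) // (image_at_vert him) //.
    by have -> : 0 <= k%:Z <= n%:Z by lia.
  rewrite arr_act (reindex_inj (can_inj (addbK (~~ f)))); apply: eq_bigr => d _ /=.
  have -> : ka (nb i d) = nb (ka i) (d (+) ~~ f).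
    by rewrite /ka /nb; case: (f); case: (d) => /=; lia.
  case: (boolP (0 <= nb (ka i) (d (+) ~~ f) <= n%:Z)) => hn; last by rewrite (out _ _ hn) !if_same.
  congr (if _ then _ else _).
  case: (boolP (0 <= ka i <= n%:Z)) => hi.
    have [k kn ik] := inv i hi; rewrite ik kaK.
    case: (eqVneq d f) => [df|df].
      have -> : d (+) ~~ f = true by rewrite df; case: (f).
      rewrite fin_step df h3 //; move: hn; rewrite ik kaK df /nb; case: (f) => /=; lia.
    have -> : d (+) ~~ f = false by move: df; case: (f); case: (d).
    have -> : d = ~~ f by move: df; case: (f); case: (d).
    case: k kn ik => [|k] kn ik.
      move: hn; rewrite ik kaK /nb; have -> : d (+) ~~ f = false by move: df; case: (f); case: (d).
      lia.
    have e1 : nb (Posz k) true = Posz k.+1 by rewrite /nb; lia.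
    have e2 : nb (sh f k s) f = sh f k.+1 s by rewrite /nb /sh; case: (f); lia.
    by rewrite -e1 -[false]/(~~ true) step_nb fin_step -e2 step_nb h3.
  have no (w : word A) j c : is_string w -> ~~ is_pos w j -> (step w j c == Some (x, true)) = false.
    by move=> hw hj; apply/eqP => /(step_ends hw)[]; rewrite (negPf hj).
  rewrite (no V) //; apply/esym/eqP => hx; move: (step_nb_some hx).
  case: (eqVneq d f) => [df|df].
    have -> : nb i d = s.
      by move: hi hn; rewrite df /ka /nb; case: (f) => /=; lia.
    by rewrite df => /h4.
  have dE : d = ~~ f by move: df; case: (f); case: (d).
  have -> : nb i d = sh f n s.
    by move: hi hn; rewrite dE /ka /nb /sh; case: (f) => /=; lia.
  by rewrite dE negbK => /h5.
- apply: (@finite_family _ _ _ _ (s - n%:Z) (s + n%:Z)) => i hi.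
    apply: out; apply: contraNN hi => /inv[k kn ->]; exact: image_at_pos.
  by apply: out; apply: contraNN hi; rewrite /ka; case: (f); lia.
exists g => k kn; rewrite hg kaK coord_zvec eqxx fin_pos.
by have -> : 0 <= k%:Z <= n%:Z by lia.
Qed.

(** The inclusion is not a sum of a morphism of which the coefficient at the first
    vertex vanishes and one of which that at the last vertex does: each of the
    two has the same coefficient at all vertices of the occurrence. *)
Lemma image_not_split s f (r0 : algebra K A) : image_at y s f ->
  (forall t : string_module K y, coord (r0 *: t) s = 0) ->
  exists g : {linear string_module K V -> string_module K y},
    ~ exists g1 g2 : {linear string_module K V -> string_module K y},
      [/\ forall m, g m = g1 m + g2 m, exists t, g1 (z 0) = r0 *: t & g2 (z n) = 0].
Proof.
move=> him hr; have [g hg] := image_inclusion him; exists g.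
move=> [g1 [g2 [gE [t ht] g2n]]].
have diag (F : {linear string_module K V -> string_module K y}) k : (k <= n)%N ->
    coord (F (z k)) (sh f k s) = coord (F (z 0)) s.
  elim: k => [|k IH] hk; first by rewrite sh0.
  have [_ _ h3 _ _] := him; have [l hl] : exists l, onth v.2 k = Some l. by apply: onth_some.
  rewrite -IH ?(ltnW hk) // -(@link_coeff K A y V F (sh f k s) k%:Z true f l) ?fin_step ?h3 //.
  congr (coord (F (zvec K V _)) _); first by rewrite /nb; lia.
  by rewrite /nb /sh; case: (f); lia.
have := hg n (leqnn n); rewrite gE coordD g2n coord0 addr0 diag // ht hr.
by move=> /eqP; rewrite eq_sym oner_eq0.
Qed.

Lemma fin_pos_nat j : is_pos V j -> exists2 k : nat, (k <= n)%N & j = k%:Z.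
Proof. by rewrite fin_pos => hj; exists (absz j); lia. Qed.

Lemma zvec_off j : ~~ is_pos V j -> zvec K V j = 0.
Proof.
move=> hj; apply: coord_inj => i; rewrite coord_zvec coord0.
by case: eqP => // ->; rewrite (negPf hj).
Qed.

(** Coefficients of morphisms propagate along the simultaneous walks in [v] and
    [y]; so restricting them to a set of pairs of positions which is closed under
    simultaneous steps gives a morphism again. *)
Lemma mask_hom (F : {linear string_module K V -> string_module K y}) (P : int -> int -> bool) :
  (forall i j d d' l, step V j d = Some l -> step y i d' = Some l ->
     P (nb i d') (nb j d) = P i j) ->
  exists G : {linear string_module K V -> string_module K y},
    forall i j, coord (G (zvec K V j)) i = if P i j then coord (F (zvec K V j)) i else 0.
Proof.
move=> hP.
pose b j : string_module K y := StringModule (restrict_family (F (zvec K V j)) (fun i => P i j)).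
have bE j i : coord (b j) i = if P i j then coord (F (zvec K V j)) i else 0 by [].
pose G (m : string_module K V) := \sum_(k < n.+1) scalar A (coord m k%:Z) *: b k%:Z.
have GE m i : coord (G m) i = \sum_(k < n.+1) coord m k%:Z * coord (b k%:Z) i.
  by rewrite coord_sum; apply: eq_bigr => k _; rewrite scalar_act.
have GD : {morph G : m m' / m + m'}.
  move=> m m'; apply: coord_inj => i; rewrite coordD !GE -big_split.
  by apply: eq_bigr => k _; rewrite coordD mulrDl.
have GZ k m : G (scalar A k *: m) = scalar A k *: G m.
  apply: coord_inj => i; rewrite scalar_act !GE mulr_sumr.
  by apply: eq_bigr => j _; rewrite scalar_act mulrA.
have G0 : G 0 = 0 by have := GZ 0 0; rewrite !scalar0 !scale0r.
have GS (u : 'I_n.+1 -> string_module K V) : G (\sum_k u k) = \sum_k G (u k).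
  exact: (big_morph G GD G0).
have Gz j : G (zvec K V j) = b j.
  case: (boolP (is_pos V j)) => hj; last first.
    rewrite zvec_off // G0; apply: coord_inj => i; rewrite bE zvec_off // linear0 coord0.
    by rewrite if_same.
  have [k kn jk] := fin_pos_nat hj.
  apply: coord_inj => i; rewrite GE (bigD1 (Ordinal (kn : (k < n.+1)%N))) //= big1 => [|k' ne].
    by rewrite jk eqxx fin_pos -jk -fin_pos hj mul1r addr0.
  case: (eqVneq (Posz k') j) => [e|_]; last by rewrite mul0r.
  by case/eqP: ne; apply: val_inj => /=; move: e; rewrite jk => -[].
have lin : linear G.
  have Gsum (R : algebra K A) m : (forall j, is_pos V j -> G (R *: zvec K V j) = R *: G (zvec K V j)) ->
      G (R *: m) = R *: G m.
    move=> h; rewrite (fin_module_sum m) scaler_sumr !GS scaler_sumr.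
    apply: eq_bigr => k _; rewrite !(scalerA R) -!scalar_comm -!scalerA !GZ h //.
      by rewrite !scalerA scalar_comm.
    by rewrite fin_pos; move: (valP k) => /=; lia.
  apply: linear_of_gens => // [u m|x m]; apply: Gsum => j hj; apply: coord_inj => i.
    have E : coord (F (vtx K u *: zvec K V j)) i = coord (vtx K u *: F (zvec K V j)) i.
      by rewrite linearZ_LR.
    rewrite vtx_act Gz bE; move: E; rewrite vtx_act vtx_zvec; case: ifP => _ E.
      by rewrite Gz bE E; case: (_ && _); rewrite ?if_same.
    by rewrite G0 coord0; move: E; rewrite linear0 coord0; case: (_ && _) => // <-; rewrite if_same.
  rewrite Gz; case: (pselect (exists d, step V j d = Some (x, false))) => [[d hd]|no].
    rewrite (arr_zvec K hd) Gz bE.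
    case: (pselect (exists d', step y i d' = Some (x, true))) => [[d' hd']|no'].
      rewrite (arr_act_in _ hd') bE.
      have e := step_nb_some hd'; have := hP _ _ _ _ _ hd e; rewrite nbK => ->.
      by have := link_coeff F hd e; rewrite nbK => ->.
    rewrite arr_act_out; last by move=> d' h'; apply: no'; exists d'.
    by rewrite -(arr_zvec K hd) linearZ_LR arr_act_out ?if_same // => d' h'; apply: no'; exists d'.
  have no1 d : step V j d <> Some (x, false) by move=> h; apply: no; exists d.
  rewrite arr_zvec0 // G0 coord0.
  case: (pselect (exists d', step y i d' = Some (x, true))) => [[d' hd']|no'].
    rewrite (arr_act_in _ hd') bE -(arr_act_in _ hd') -linearZ_LR arr_zvec0 //.
    by rewrite linear0 coord0 if_same.
  by rewrite arr_act_out // => d' h'; apply: no'; exists d'.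
by exists (mk_linear lin) => i j; rewrite -bE -Gz.
Qed.

(** The pairs of positions at which a morphism is split.  The condition is invariant
    under simultaneous steps and empty at the last vertex of [v]; at the first
    vertex, where a morphism is nonzero, it singles out the image occurrences. *)
Definition suffix_match (i j : int) : Prop := exists f, forall k : nat,
  j <= k%:Z -> (k < n)%N -> step y (sh f (absz (k%:Z - j)%R) i) f = onth v.2 k.

Lemma suffix_match_step i j d d' l : step V j d = Some l -> step y i d' = Some l ->
  suffix_match i j -> suffix_match (nb i d') (nb j d).
Proof.
move=> hj hi [f hf]; have [pj pj' _ _] := step_ends hv hj.
have [k kn jk] := fin_pos_nat pj; subst j.
case: d hj pj' => hj pj'.
  have kn' : (k < n)%N by move: pj'; rewrite fin_pos /nb; lia.
  have fd : f = d'.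
    apply: (step_inj hy _ hi); have := hf k (lexx _) kn'; rewrite subrr sh0 => ->.
    by rewrite -fin_step.
  exists f => m hm mn; rewrite -hf //; last by move: hm; rewrite /nb; lia.
  congr (step y _ f); rewrite -fd; move: hm; rewrite /nb /sh; case: (f); lia.
have hk : (k <= n)%N by [].
exists (~~ d') => m hm mn.
have e1 : step V (nb k%:Z false) true = Some (letter_inv l) by exact: step_nb_some hj.
have e2 := step_nb_some hi.
case: k kn pj hj pj' hf hm hk e1 => [|k] kn pj hj pj' hf hm hk e1.
  by move: pj'; rewrite fin_pos /nb; lia.
have nbk : nb (Posz k.+1) false = Posz k by rewrite /nb; lia.
rewrite nbk in e1 hm *.
case: (eqVneq m k) => [->|mk]; first by rewrite subrr sh0 e2 -e1 fin_step.
have fE : f = ~~ d'.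
  have kn' : (k.+1 < n)%N by move: hm mk mn; lia.
  have := hf k.+1 (lexx _) kn'; rewrite subrr sh0 -fin_step => h.
  case: (eqVneq f d') => [fd|]; last by case: (f); case: (d').
  have h' : step V k.+1%:Z (~~ false) <> Some l by apply: (step_reduced hv); apply: hj.
  by case: h'; rewrite -h fd hi.
rewrite -hf; [|move: hm mk; lia|by []].
by rewrite -fE; congr (step y _ f); move: hm mk; rewrite -[d'](negbK) -fE /nb /sh; case: (f) => /=; lia.
Qed.

Lemma suffix_match_link i j d d' l : step V j d = Some l -> step y i d' = Some l ->
  suffix_match (nb i d') (nb j d) <-> suffix_match i j.
Proof.
move=> hj hi; split; last exact: suffix_match_step hj hi.
by move=> /(suffix_match_step (step_nb_some hj) (step_nb_some hi)); rewrite !nbK.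
Qed.

Lemma suffix_match_image (F : {linear string_module K V -> string_module K y}) i :
  suffix_match i 0 -> coord (F (z 0)) i != 0 -> exists f, image_at y i f.
Proof.
move=> [f hf] hc; exists f.
have match_ k : (k < n)%N -> step y (sh f k i) f = onth v.2 k.
  by move=> hk; rewrite -hf ?subr0.
have [pi _] := coeff_pos hc.
split=> // [|x hx|x hx].
- have : coord (F (vtx K v.1 *: z 0)) i = coord (vtx K v.1 *: F (z 0)) i by rewrite linearZ_LR.
  rewrite vtx_act vtx_zvec pi; have -> : vert V 0 == v.1 by [].
  by case: (eqVneq (vert y i) v.1) => // _ h; rewrite h eqxx in hc.
- have [d' h _] := coeff_out hx hc; case: d' h => h; last by rewrite fin_step0 in h.
  case: (ltnP 0 n) => n0; last by move: h; rewrite fin_step onth_default.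
  have := match_ 0%N n0; rewrite sh0 -fin_step h.
  by move: (step_reduced hy hx); rewrite negbK.
have along k : (k <= n)%N -> coord (F (z k)) (sh f k i) != 0.
  elim: k => [|k IH] hk; first by rewrite sh0.
  have [l hl] : exists l, onth v.2 k = Some l. by apply: onth_some.
  have := IH (ltnW hk); rewrite -(@link_coeff K A y V F (sh f k i) k%:Z true f l) ?fin_step ?match_ //.
  have -> : nb (Posz k) true = Posz k.+1 by rewrite /nb; lia.
  by have -> : nb (sh f k i) f = sh f k.+1 i by rewrite /nb /sh; case: (f); lia.
have [d' h _] := coeff_out hx (along n (leqnn n)).
case: d' h => h; first by rewrite fin_step onth_default in h.
have [k nk] : exists k, n = k.+1.
  by case: (n) h => [|k] h; [rewrite fin_step0 in h|exists k].
have kn : (k < n)%N by rewrite nk.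
have e1 : nb (Posz k) true = Posz n by rewrite nk /nb; lia.
have e2 : nb (sh f k i) f = sh f n i by rewrite nk /nb /sh; case: (f); lia.
have := step_nb V k true; rewrite e1 h fin_step -match_ // -step_nb e2 => hx'.
by case: (step_reduced hy hx).
Qed.

(** The first summand is [g] restricted to the pairs with [suffix_match].  It agrees with
    [g] at the last vertex.  The image of the first vertex is supported on
    starting points of image occurrences of [v], and if the arrow [x] ends at each of
    these, then such an element is a multiple of [x]. *)
Lemma no_image_split (r0 : algebra K A) :
  (forall s f, ~ image_at y s f) \/
  (exists2 x, r0 = arr K x & forall s f, image_at y s f -> step y s (~~ f) = Some (x, true)) ->
  forall g : {linear string_module K V -> string_module K y},
  exists g1 g2 : {linear string_module K V -> string_module K y},
    [/\ forall m, g m = g1 m + g2 m, exists t, g1 (z 0) = r0 *: t & g2 (z n) = 0].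
Proof.
move=> hr g; pose P i j := `[< suffix_match i j >].
have hP i j d d' l : step V j d = Some l -> step y i d' = Some l ->
    P (nb i d') (nb j d) = P i j.
  by move=> hj hi; apply/asboolP/asboolP => /(suffix_match_link hj hi).
have [g1 hg1] := mask_hom g hP.
have g2l : linear (fun m => g m - g1 m).
  by move=> r a b; rewrite [g _]linearP [g1 _]linearP scalerBr opprD addrACA.
exists g1, (mk_linear g2l); split.
- by move=> m; rewrite -[mk_linear g2l m]/(g m - g1 m) addrC subrK.
- case: hr => [no|[x -> hx]].
    exists 0; rewrite scaler0; apply: coord_inj => i; rewrite coord0 hg1.
    case: ifP => // /asboolP hm; apply/eqP; apply: contrapT => /negP hc.
    by have [f hf] := suffix_match_image hm hc; apply: no hf.
  pose c := coord (g1 (z 0)).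
  (* the preimage of [g1 (z 0)] under [x], with the coefficients moved back along [x] *)
  pose t i := \sum_(d : bool) if step y i d == Some (x, false) then c (nb i d) else 0.
  have tfam : t \in is_family y.
    have /is_familyP[_ cf] := coord_family (g1 (z 0)).
    apply/is_familyP; split=> [i hi|e /cf[k hk]].
      rewrite /t big1 // => d _; case: eqP => // /(step_ends hy)[].
      by rewrite (negPf hi).
    exists (if e then k + 1 else k - 1) => i hi; rewrite /t big1 // => d _.
    rewrite /c hk ?if_same //; move: hi; rewrite /nb; case: (e); case: (d) => /=; lia.
  exists (StringModule tfam); apply: coord_inj => i.
  case: (pselect (exists d, step y i d = Some (x, true))) => [[d hd]|nod].
    have hd' := step_nb_some hd.
    rewrite (arr_act_in _ hd) /= /t (bigD1 (~~ d)) //= hd' eqxx nbK big1 ?addr0 //.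
    move=> d'' dd; case: eqP => // /(step_inj hy hd') h; by rewrite h eqxx in dd.
  rewrite arr_act_out; last by move=> d h; apply: nod; exists d.
  rewrite hg1; case: ifP => // /asboolP hm; apply/eqP; apply: contrapT => /negP hc.
  by have [f hf] := suffix_match_image hm hc; apply: nod; exists (~~ f); apply: hx.
- apply: coord_inj => i; rewrite -[mk_linear g2l _]/(g (z n) - g1 (z n)).
  rewrite -[LHS]/(coord (g (z n)) i - coord (g1 (z n)) i) hg1.
  have -> : P i n by apply/asboolP; exists true => k h1 h2; move: h1 h2; lia.
  by rewrite subrr.
Qed.
End InString.
End ImageSubstrings.

(** * Substrings and periodicity *)

Section Substrings.
Variable A : string_algebra.
Implicit Types (w : word A) (u : seq (letter A)).

Lemma letter_at_None w i : ~~ (is_pos w i && is_pos w (i + 1)) -> letter_at w i = None.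
Proof. by rewrite /letter_at => /negPf ->. Qed.

Lemma fin_letter (v : fword A) i : letter_at (fin_word v) i = if i is Posz k then onth v.2 k else None.
Proof.
rewrite /letter_at /is_pos /=; case: i => k //=.
case: (ltnP k (size v.2)) => hk; last by rewrite onth_default // if_same.
by have -> : (k%:Z <= (size v.2)%:Z) && (0 <= k%:Z + 1 <= (size v.2)%:Z) by lia.
Qed.

Lemma substring_string w i u : is_string w -> is_pos w i -> is_pos w (i + (size u)%:Z) ->
  occurs w i u -> is_fstring (vert w i, u).
Proof.
move=> hw pi pe occ.
have vertE k : (k <= size u)%N -> vert (fin_word (vert w i, u)) k%:Z = vert w (i + k%:Z).
  case: k => [|k] hk; first by rewrite /= /walk_vert /= addr0.
  have [l hl] : exists l, onth u k = Some l. by apply: onth_some.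
  have := occ k hk; rewrite hl => /(letter_ends hw)[_ _ _].
  have -> : i + k%:Z + 1 = i + k.+1%:Z by lia.
  have e1 : k.+1%:Z - 1 = k%:Z by lia.
  by move=> <-; rewrite /vert /fin_word /walk_vert e1 /= hl.
have letE j : letter_at (fin_word (vert w i, u)) j = if (0 <= j) && (j < (size u)%:Z)
    then letter_at w (i + j) else None.
  rewrite fin_letter; case: j => k //=.
  case: (ltnP k (size u)) => hk; last by rewrite onth_default // ifF //; lia.
  by rewrite -occ // ifT //; lia.
split.
- by exists 0; rewrite /is_pos /=.
- move=> j h1 h2; have [k jk] : exists k : nat, j = k%:Z.
    by exists (absz j); move: h1; rewrite /is_pos /=; lia.
  have hk : (k < size u)%N by move: h2; rewrite jk /is_pos /=; lia.
  have [l hl] : exists l, onth u k = Some l. by apply: onth_some.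
  exists l; have := occ k hk; rewrite hl => /(letter_ends hw)[_ _ e1 e2].
  split; first by rewrite jk /= hl.
    by rewrite jk vertE ?(ltnW hk).
  have -> : j + 1 = k.+1%:Z by rewrite jk; lia.
  by rewrite vertE // e2; congr (vert w _); lia.
- move=> j l; rewrite !letE; case: ifP => // _ h; case: ifP => // _.
  by have := str_reduced hw h; rewrite addrA.
- move=> j [|x u'] s occ' hs; last first.
    have h0 : 0 <= j.
      have := occ' 0%N (ltn0Sn _); rewrite letE addr0; case: ifP => // /andP[] //.
    have occ2 : occurs w (i + j) (x :: u').
      move=> k hk; have := occ' k hk; rewrite letE; case: ifP => _ h.
        by rewrite -h addrA.
      by move: hk; rewrite -onthTE -h.
    exact: (str_nonzero hw occ2 hs).
  suff -> : s = [::] by apply: in_ideal0.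
  by case: hs => /(congr1 size); rewrite ?/letters_inv ?size_rev ?size_map => /esym/size0nil.
Qed.

Lemma right_ext_periodic w L p : (forall i, p <= i -> lett w (i + L%:Z) = lett w i) ->
  forall k i, p <= i -> lett w (i + (k * L)%N%:Z) = lett w i.
Proof.
move=> h k i hi; elim: k => [|k IH]; first by rewrite addr0.
have -> : i + (k.+1 * L)%N%:Z = i + (k * L)%N%:Z + L%:Z by rewrite mulSn; lia.
by rewrite h //; lia.
Qed.

Lemma onth_flatten_nseq (T : Type) (v : seq T) n k : (k < n * size v)%N ->
  onth (flatten (nseq n v)) k = onth v (k %% size v)%N.
Proof.
elim: n k => [|n IH] k //; rewrite mulSn => hk /=; rewrite onth_cat.
case: ltnP => h; first by rewrite modn_small.
rewrite IH; last by lia.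
by rewrite -{2}(subnK h) modnDr.
Qed.

Lemma size_flatten_nseq (T : Type) (v : seq T) n : size (flatten (nseq n v)) = (n * size v)%N.
Proof. by rewrite size_flatten /shape map_nseq sumn_nseq mulnC. Qed.

(** An eventually periodic aperiodic string has a tail with primitive period: one
    takes the least period occurring and the first position from which on the
    string has it. *)
Lemma right_tail_exists w (L0 : nat) p0 : is_string w -> hi w = None -> aperiodic w ->
  (0 < L0)%N -> (forall i, p0 <= i -> lett w (i + L0%:Z) = lett w i) ->
  exists p u, right_tail w p u.
Proof.
move=> hw hinf hap L00 hper.
pose per L p := is_pos w p /\ forall i, p <= i -> lett w (i + L%:Z) = lett w i.
have [q0 hq0] := str_nonempty hw.
have up i j : is_pos w i -> i <= j -> is_pos w j.
  by rewrite /is_pos hinf; case: (lo w) => [?|]; lia.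
have exL : exists L, `[< (0 < L)%N /\ exists p, per L p >].
  exists L0; apply/asboolP; split=> //; exists (Num.max p0 q0); split.
    by apply: (up q0) => //; lia.
  by move=> i hi; apply: hper; lia.
case: (ex_minnP exL) => L /asboolP[Lgt0 [p1 hp1]] minL.
(* an aperiodic string does not have the period [L] from arbitrarily early positions on *)
have [q hq] : exists q, forall p, per L p -> q <= p.
  case El: (lo w) => [l|].
    by exists l => p [hp _]; move: hp; rewrite /is_pos El => /andP[].
  have [q nq] : exists q, ~ per L q.
    apply: contrapT => h; apply: (hap L%:Z) => [|i]; first by lia.
    have [_ H] : per L i by apply: contrapT => n; apply: h; exists i.
    by rewrite /letter_at /is_pos El hinf /= H.
  exists q => p hp; rewrite leNgt; apply/negP => pq; apply: nq; split.
    by rewrite /is_pos El hinf.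
  by move=> i hi; apply: hp.2; lia.
have exk : exists k : nat, `[< per L (q + k%:Z) >].
  exists (absz (p1 - q)%R); apply/asboolP; have := hq _ hp1.
  by move=> ?; have -> : q + (absz (p1 - q)%R)%:Z = p1 by lia.
case: (ex_minnP exk) => k /asboolP hk mink; set p := q + k%:Z in hk.
have [pp hpp] := hk.
have some j : p <= j -> exists l, lett w j = Some l.
  move=> hj; have [l [e _ _]] := str_walk hw (up _ _ pp hj) (up _ _ pp (ler_wpDr ler01 hj)).
  by exists l.
have [x0 _] := some p (lexx p).
pose u := [seq odflt x0 (lett w (p + j%:Z)) | j <- iota 0 L].
have su : size u = L by rewrite size_map size_iota.
have hu j : (j < L)%N -> lett w (p + j%:Z) = onth u j.
  move=> hj; rewrite /u onth_map.
  have -> : onth (iota 0 L) j = Some j by rewrite onthE (nth_map 0%N) ?size_iota // nth_iota.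
  have hpj : p <= p + j%:Z by lia.
  by rewrite /=; have [l ->] := some _ hpj.
have hlett j : lett w (p + j%:Z) = onth u (j %% L)%N.
  rewrite -hu ?ltn_pmod // {1}(divn_eq j L) addnC PoszD addrA.
  by apply: (right_ext_periodic hpp); rewrite lerDl.
exists p, u; split=> //.
- split; rewrite ?su // => -[v [n [n1 uE]]].
  have sv : L = (n * size v)%N by rewrite -su uE size_flatten_nseq.
  have v0 : (0 < size v)%N by move: Lgt0; rewrite sv muln_gt0 => /andP[].
  have : (L <= size v)%N.
    apply: minL; apply/asboolP; split=> //; exists p; split=> // i hi.
    have H j : lett w (p + j%:Z) = onth v (j %% size v)%N.
      rewrite hlett uE onth_flatten_nseq -?sv ?ltn_pmod //.
      by rewrite modn_dvdm // sv dvdn_mull.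
    have -> : i = p + (absz (i - p)%R)%:Z by lia.
    have -> : p + (absz (i - p)%R)%:Z + (size v)%:Z = p + (absz (i - p)%R + size v)%N%:Z by lia.
    by rewrite !H modnDr.
  by rewrite sv -{2}(mul1n (size v)) leq_pmul2r // leqNgt n1.
- by move=> j; rewrite hlett su.
- case: (boolP (is_pos w (p - 1))) => hp1'; last first.
    left; move: pp hp1'; rewrite /is_pos hinf; case: (lo w) => [l|] //= h1 h2.
    by congr Some; move: h1 h2; lia.
  right; split=> // e; suff : per L (p - 1).
    move=> hper'; have k0 : (0 < k)%N by have := hq _ hper'; rewrite /p; lia.
    have := mink k.-1; have <- : p - 1 = q + k.-1%:Z by rewrite /p; lia.
    by move=> /(_ (introT (asboolP _) hper')); lia.
  split=> // i hi; case: (eqVneq i (p - 1)) => [->|ne]; last by apply: hpp; lia.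
  have -> : p - 1 + L%:Z = p + L.-1%:Z by lia.
  by rewrite hlett modn_small ?e ?su // prednK.
Qed.

Lemma right_tame_side w p u : is_string w -> right_tail w p u -> tame_side w true.
Proof.
move=> hw ht; have [_ _ [u0 _] _ _] := ht.
have [[a b] hab] : exists l, onth u (size u).-1 = Some l.
  by apply: onth_some; rewrite prednK.
case: b hab => hab; first by constructor 2; exists p, u, a.
case: (pselect (contracting w true)) => hc; first by constructor 2.
by constructor 3; split=> //; exists p, (size u); apply: right_tail_tail hab.
Qed.

Lemma tame_side_inv w e : tame_side (word_inv w) e -> tame_side w (~~ e).
Proof.
move=> [[n hn]|hc|[hc [p [L ht]]]].
- constructor 1; exists (- n) => i hi; rewrite -[i]opprK -is_pos_inv; apply: hn.
  by move: hi; case: e => /=; lia.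
- by constructor 2; rewrite -contracting_inv.
- constructor 3; rewrite -contracting_inv; split=> //.
  by exists (- p), L; apply: tail_inv.
Qed.

Lemma aperiodic_inv w : aperiodic w -> aperiodic (word_inv w).
Proof.
move=> hap s s0 h; apply: (hap (- s)) => [|i]; first by lia.
have := h (- i - 1); rewrite !letter_at_inv.
have -> : - (- i - 1 + s) - 1 = i - s by lia.
have -> : - (- i - 1) - 1 = i by lia.
case: (letter_at w i) => [l|]; case: (letter_at w _) => [l'|] //= e.
have : letter_inv l' = letter_inv l by apply: Some_inj.
by move=> /(can_inj (@letter_invK A)) ->.
Qed.

Lemma one_sided_aperiodic w l : is_string w -> lo w = Some l -> hi w = None -> aperiodic w.
Proof.
move=> hw hl hh s s0 h.
have pl i : is_pos w i = (l <= i) by rewrite /is_pos hl hh andbT.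
have out i : i < l -> letter_at w i = None.
  by move=> hi; apply: letter_at_None; rewrite pl; lia.
have [x [hx _ _]] : exists x, [/\ lett w l = Some x, left_end x = vert w l & right_end x = vert w (l + 1)].
  by apply: str_walk; rewrite ?pl //; lia.
have hx' : letter_at w l = Some x by rewrite /letter_at !pl hx; have -> : (l <= l) && (l <= l + 1) by lia.
case: (ltrP s 0) => hs; first by have := h l; rewrite hx' out //; lia.
by have := h (l - s); rewrite subrK hx' out //; lia.
Qed.

End Substrings.

(** * Isomorphism classes and dimension *)

Section Dimension.
Variables (K : fieldType) (A : string_algebra).
Local Notation R := (algebra K A).

(** Infinitely many vectors [z_i] would give a left inverse of a matrix with more rows
    than columns. *)
Lemma infinite_not_fd (w : string A) : infinite w -> ~ finite_dimensional (string_module K w).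
Proof.
move=> hinf [s hs]; have [e [p hp]] := infinite_letters (wd_string w) hinf.
pose n := size s; pose x (k : nat) := sh e k p.
have px k : is_pos w (x k).
  have : letter_at w (x k) by apply: hp; rewrite /x /sh; case: (e) => /=; lia.
  by rewrite /letter_at; case: ifP => // /andP[].
have xinj k l : x k = x l -> k = l by rewrite /x /sh; case: (e); lia.
have /choice[c hc] (k : nat) := hs (zvec K w (x k)).
pose X : 'M[K]_(n.+1, n) := \matrix_(k, j) c k j.
pose Y : 'M[K]_(n, n.+1) := \matrix_(j, l) coord s`_j (x l).
have XY : X *m Y = 1%:M.
  apply/matrixP => k l; rewrite !mxE.
  have := congr1 (fun m => coord m (x l)) (hc k).
  rewrite coord_sum; under eq_bigr => j _ do rewrite scalar_act.
  rewrite coord_zvec px andbT => h.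
  under eq_bigr => j _ do rewrite !mxE.
  rewrite -h eq_sym; congr (_%:R); congr nat_of_bool.
  by apply/eqP/eqP => [/xinj/val_inj|->].
have := mxrankM_maxl X Y; rewrite XY mxrank1 => /leq_trans/(_ (rank_leq_col X)).
by rewrite ltnn.
Qed.

Lemma isomorphic_refl (M : lmodType R) : isomorphic M M.
Proof. by exists idfun; exists id. Qed.

Lemma inverse_linear (M N : lmodType R) (f : {linear M -> N}) (g : N -> M) :
  cancel f g -> cancel g f -> linear g.
Proof. by move=> fg gf r a b; apply: (can_inj fg); rewrite linearP !gf. Qed.

Lemma isomorphic_sym (M N : lmodType R) : isomorphic M N -> isomorphic N M.
Proof.
by move=> [f [g fg gf]]; exists (mk_linear (inverse_linear fg gf)); exists f.
Qed.

Lemma isomorphic_trans (M N P : lmodType R) :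
  isomorphic M N -> isomorphic N P -> isomorphic M P.
Proof. by move=> [f bf] [g bg]; exists (g \o f); apply: bij_comp. Qed.

Lemma isomorphic_fd (M N : lmodType R) : isomorphic M N ->
  finite_dimensional M -> finite_dimensional N.
Proof.
by move=> [f [g fg gf]] fd; apply: (fd_image (q := f)) fd _ => n; exists (g n).
Qed.

Lemma modules_iso (x : Zg K A) M N : modules x M -> modules x N -> isomorphic M N.
Proof.
have [P [_ _ hP]] := modulesP x; move=> /hP h1 /hP h2.
exact: isomorphic_trans (isomorphic_sym h1) h2.
Qed.

Lemma modules_closed (x : Zg K A) M N : modules x M -> isomorphic M N -> modules x N.
Proof.
have [P [_ _ hP]] := modulesP x; move=> /hP h1 h2; apply/hP.
exact: isomorphic_trans h1 h2.
Qed.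

Lemma not_factoring_modules (M N : lmodType R) (f : {linear M -> N}) (x : Zg K A) X :
  modules x X -> not_factoring f x <->
  exists g : {linear M -> X}, ~ exists h : {linear N -> X}, forall m, h (f m) = g m.
Proof.
move=> hX; split=> [[Y hY [g ng]]|[g ng]]; last by exists X => //; exists g.
have [a [b ab ba]] := modules_iso hY hX; exists (a \o g) => -[h hh]; apply: ng.
exists (mk_linear (inverse_linear ab ba) \o h) => m /=.
by apply: (can_inj ab); rewrite ba hh.
Qed.

Lemma fd_point_finite (x : Zg K A) (y : string A) :
  U x -> modules x (string_module K y) -> infinite y.
Proof.
move=> [_ hU] hy; rewrite /infinite.
case El: (lo y) => [l|]; last by left.
case Eh: (hi y) => [h|]; last by right.
case: (hU _ hy); apply: (@finite_string_fd _ _ _ l (absz (h - l)%R)) => i.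
by rewrite /is_pos El Eh; lia.
Qed.

End Dimension.

(** * Eventually periodic words built from bands *)

Section ConcreteWords.
Variable A : string_algebra.
Implicit Types (w y : word A) (b c v : fword A).

Lemma tail_lett_finite c b n k : (k < size c.2 + n * size b.2)%N ->
  tail_lett c b k = onth (c.2 ++ flatten (nseq n b.2)) k.
Proof.
move=> hk; rewrite /tail_lett onth_cat; case: ltnP => // h.
by rewrite onth_flatten_nseq //; lia.
Qed.

Lemma tail_lett_periodic c b k :
  tail_lett c b (size c.2 + k) = onth b.2 (k %% size b.2)%N.
Proof. by rewrite /tail_lett ltnNge leq_addr /= addKn. Qed.

Lemma bi_lett_left b0 c b n k : (k < n * size b0.2)%N ->
  bi_lett b0 c b (k%:Z - (n * size b0.2)%N%:Z) = onth b0.2 (k %% size b0.2)%N.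
Proof.
set L := size b0.2 => hk; have L0 : (0 < L)%N by move: hk; case: L => //; rewrite muln0.
have -> : k%:Z - (n * L)%N%:Z = Negz (n * L - k).-1 by lia.
have rL := ltn_pmod k L0.
have e : (n * L - k).-1 = ((n - (k %/ L).+1) * L + (L - (k %% L).+1))%N.
  have hq : (k %/ L < n)%N by rewrite ltn_divLR.
  rewrite {1}(divn_eq k L) mulnBl mulSn.
  by have := leq_mul hq (leqnn L); rewrite mulSn; lia.
rewrite /= e modnMDl modn_small; last by rewrite -/L; lia.
rewrite onth_rev -/L; last by lia.
by congr onth; lia.
Qed.

Lemma tame_side_periodic w b p : is_string w -> hi w = None -> aperiodic w ->
  (0 < size b.2)%N -> (forall k : nat, lett w (p + k%:Z) = onth b.2 (k %% size b.2)%N) ->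
  tame_side w true.
Proof.
move=> hw hinf hap b0 hb.
have [|q [u ht]] := @right_tail_exists _ w (size b.2) p hw hinf hap b0.
  move=> i hi; have -> : i = p + (absz (i - p)%R)%:Z by lia.
  by rewrite -addrA -PoszD !hb modnDr.
exact: right_tame_side hw ht.
Qed.

(** A shift of a two-sided string which is periodic on the right carries the
    right half over the whole string. *)
Lemma two_sided_aperiodic w b p : lo w = None -> hi w = None -> is_band b ->
  (forall k : nat, lett w (p + k%:Z) = onth b.2 (k %% size b.2)%N) ->
  ~ periodic w -> aperiodic w.
Proof.
move=> hl hh hb hp np s s0 h; apply: np; split=> //; exists b, p; split=> // i.
have L0 := band_pos hb; set L := size b.2 in hp L0 *.
have at_ j : letter_at w j = lett w j by rewrite /letter_at /is_pos hl hh.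
have hs (k : nat) j : lett w (j + k%:Z * s) = lett w j.
  elim: k => [|k IH]; first by rewrite mul0r addr0.
  by rewrite -IH -[in RHS]at_ -h at_ -addn1 PoszD mulrDl mul1r addrA.
(* shifting to the right by many multiples of [s], and of the period of [b] *)
have ha (k : nat) j : lett w (j + k%:Z * `|s|) = lett w j.
  case: (ger0P s) => _; first exact: hs.
  by rewrite -[LHS](hs k); congr lett; lia.
pose k := (absz i * L)%N.
have [m mE] : exists m : nat, i + k%:Z * `|s| = m%:Z.
  exists (absz (i + k%:Z * `|s|)); rewrite gez0_abs //.
  have : `|i| <= k%:Z * `|s|.
    rewrite /k PoszM -mulrA -abszE -{1}[(absz i)%:Z]mulr1 ler_wpM2l //; nia.
  lia.
rewrite -(ha k) -addrA mE hp; congr onth.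
suff -> : (i %% L)%Z = (m %% L)%N%:Z by [].
by rewrite -modz_nat -mE /k PoszM mulrAC addrC modzMDl.
Qed.

Lemma letters_inv_flatten n (u : seq (letter A)) :
  letters_inv (flatten (nseq n u)) = flatten (nseq n (letters_inv u)).
Proof.
by rewrite /letters_inv map_flatten map_nseq rev_flatten map_nseq rev_nseq.
Qed.

(** The inverse of a band is again a band, since its first letter is the inverse
    of the last one. *)
Lemma periodic_inv w : is_string w -> periodic w -> periodic (word_inv w).
Proof.
move=> hw [hl hh [b [p [hb hp]]]]; split; rewrite /left_infinite /right_infinite /= ?hh ?hl //.
have L0 := band_pos hb; set L := size b.2 in hp L0 *.
pose u := letters_inv b.2.
have su : size u = L by rewrite size_rev size_map.
have hu (i : int) : lett (word_inv w) (- p + i) = onth u (absz (i %% L%:Z)%Z).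
  rewrite /=; have -> : - (- p + i) - 1 = p + (- i - 1) by lia.
  rewrite hp; have hi := ltz_pmod i (d := L%:Z) L0; have hi0 : 0 <= (i %% L%:Z)%Z by rewrite modz_ge0; lia.
  have e : (- i - 1 = - ((i %/ L%:Z)%Z + 1) * L%:Z + (L%:Z - 1 - (i %% L%:Z)%Z))%R.
    by rewrite {1}(divz_eq i L%:Z); lia.
  rewrite e modzMDl modz_small; last by lia.
  rewrite /u /letters_inv onth_rev ?size_map; last by rewrite -/L; lia.
  by rewrite onth_map -/L; congr (omap _ (onth _ _)); lia.
have hpos i : is_pos (word_inv w) i by rewrite /is_pos /= hl hh.
exists (vert (word_inv w) (- p), u), (- p); split; last by rewrite /= su.
split; rewrite /= ?su //.
- move=> n; apply: (substring_string (word_inv_string hw)); rewrite ?hpos // => k.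
  rewrite size_flatten_nseq => hk; rewrite /letter_at !hpos /= -[LHS]/(lett (word_inv w) (- p + k%:Z)).
  by rewrite hu modz_nat absz_nat onth_flatten_nseq // su.
- move=> [u' [n [hu' n1 [_ hE]]]]; apply: (band_primitive hb).
  have bE : b.2 = flatten (nseq n (letters_inv u'.2)).
    by rewrite -letters_inv_flatten -hE /u letters_invK.
  exists (b.1, letters_inv u'.2), n; split=> //; last by rewrite /fpow /= -bE -surjective_pairing.
  have hb1 : is_fstring (b.1, b.2) by have := band_pow hb 1; rewrite /fpow /= cats0.
  have sz : (size (letters_inv u'.2) <= L)%N.
    by rewrite /L bE size_flatten_nseq; case: (n) n1 => // m _; rewrite mulSn leq_addr.
  apply: (@substring_string _ (fin_word (b.1, b.2)) 0 (letters_inv u'.2) hb1) => //.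
  move=> k hk; rewrite add0r fin_letter bE; case: (n) n1 => // m _.
  by rewrite /= onth_cat hk.
- have [a ha] := band_last hb; exists a; move: ha; rewrite -/L => ha.
  have := onth_rev (s := map (@letter_inv A) b.2) (k := 0); rewrite size_map -/L => /(_ L0).
  rewrite onth_map subn1 ha /= /u /letters_inv; by case: (rev _) => //= ? ? [->].
- have [a ha] := band_first hb; exists a.
  rewrite /u /letters_inv onth_rev ?size_map -/L; last by lia.
  rewrite onth_map; have -> : (L - L.-1.+1 = 0)%N by lia.
  by move: ha; case: b.2 => //= ? ? [->].
Qed.

Lemma image_atE v (y : string A) s :
  image_at v y s true <-> image_substring_at y s v.
Proof.
have E x : (step y s false = Some (x, false)) <-> letter_at y (s - 1) = Some (x, true).
  rewrite /step; case: (letter_at _ _) => [[a []]|] //=.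
  by split=> -[->].
split=> [h|[[h1 _] h2 h3 h4 h5]].
  have [h1 h2 h3 h4 h5] := h; split=> //.
  - by split=> //; have := image_at_pos h (leqnn _).
  - by case=> a [] // /E /h4.
  - by case=> a [] // /h5.
split=> //.
- by move=> x /E /h4.
- by move=> x /h5.
Qed.

Lemma bi_word_image b0 c b n : is_string (bi_word b0 c b) -> is_band b0 -> is_band b ->
  image_substring_at (bi_word b0 c b) (- (n * size b0.2)%N%:Z)
    (fcat (fcat (fpow b0 n) c) (fpow b n)).
Proof.
set w := bi_word b0 c b => hw hb0 hb.
have at_ i : letter_at w i = bi_lett b0 c b i by [].
have L0 := band_pos hb0; have L1 := band_pos hb.
have left m k : (k < m * size b0.2)%N ->
    letter_at w (- (m * size b0.2)%N%:Z + k%:Z) = onth b0.2 (k %% size b0.2)%N.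
  by move=> hk; rewrite at_ addrC bi_lett_left.
have [x0 hx0] : exists l, onth b0.2 0 = Some l.
  exact: onth_some.
have [x1 hx1] := band_last hb0; have [x2 hx2] := band_first hb.
have last_ m : letter_at w (- (m * size b0.2)%N%:Z - 1) = Some (x1, false).
  have e : - (m * size b0.2)%N%:Z - 1 = - (m.+1 * size b0.2)%N%:Z + (size b0.2).-1%:Z by lia.
  by rewrite e left ?modn_small ?prednK //; lia.
have vertE m : vert w (- (m * size b0.2)%N%:Z) = tgt x1.
  by have [_ _ _] := letter_ends hw (last_ m); rewrite subrK.
have right m k : (k < size c.2 + m * size b.2)%N ->
    letter_at w k%:Z = onth (c.2 ++ flatten (nseq m b.2)) k.
  by move=> hk; rewrite at_ -tail_lett_finite.
have sizeE : size (fcat (fcat (fpow b0 n) c) (fpow b n)).2 =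
    (n * size b0.2 + (size c.2 + n * size b.2))%N.
  by rewrite /= !size_cat !size_flatten_nseq addnA.
split.
- by [].
- (* both this occurrence and [b0] begin where a copy of [b0] ends *)
  have h1 : letter_at (fin_word (fpow b0 1)) 0 = Some x0.
    by rewrite fin_letter -hx0 /= cats0.
  have h2 : letter_at w (- (1 * size b0.2)%N%:Z) = Some x0.
    by have := left 1%N 0%N; rewrite mul1n mod0n hx0 addr0; apply.
  have [_ _ e1 _] := letter_ends (band_pow hb0 1) h1.
  have [_ _ e2 _] := letter_ends hw h2.
  by rewrite vertE -(vertE 1%N) -e2 e1.
- move=> k; rewrite sizeE => hk; rewrite /= -catA onth_cat size_flatten_nseq.
  case: ltnP => h; first by rewrite left // onth_flatten_nseq.
  have -> : - (n * size b0.2)%N%:Z + k%:Z = (k - n * size b0.2)%N%:Z by lia.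
  by apply: right; lia.
- by move=> l; rewrite last_ => -[<-].
- move=> l; rewrite sizeE.
  have -> : - (n * size b0.2)%N%:Z + (n * size b0.2 + (size c.2 + n * size b.2))%N%:Z =
    (size c.2 + n * size b.2)%N%:Z by lia.
  rewrite at_ /= tail_lett_periodic modnMl.
  by case: b.2 hx2 => //= ? ? [->] [<-].
Qed.

Lemma right_word_image c b n : is_string (right_word c b) -> is_band b ->
  image_substring_at (right_word c b) 0 (fcat c (fpow b n)).
Proof.
set w := right_word c b => hw hb; have [x2 hx2] := band_first hb.
have sizeE : size (fcat c (fpow b n)).2 = (size c.2 + n * size b.2)%N.
  by rewrite /= !size_cat !size_flatten_nseq.
split=> //.
- by move=> k; rewrite sizeE => hk; rewrite add0r /= -tail_lett_finite.
- move=> l; rewrite sizeE add0r -[X in X = _]/(tail_lett c b _) tail_lett_periodic modnMl.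
  by case: b.2 hx2 => //= ? ? [->] [<-].
Qed.

End ConcreteWords.

(** * Open sets of string modules *)

Section Neighbourhoods.
Variables (K : fieldType) (A : string_algebra).
Local Notation R := (algebra K A).
Implicit Types (y w : string A) (v : fword A).

Definition inverse_string y : string A := String (word_inv_string (wd_string y)).

Lemma string_point_inv (x : Zg K A) y :
  modules x (string_module K y) -> modules x (string_module K (inverse_string y)).
Proof. by move=> h; apply: modules_closed h (string_module_inv K y). Qed.

Lemma string_pointP w : infinite w -> aperiodic w -> (forall e, tame_side w e) ->
  exists x : Zg K A, modules x (string_module K w).
Proof.
move=> hinf hap ht.
have hx : exists M : lmodType R, [/\ indecomposable M, pure_injective M &
    forall N, isomorphic (string_module K w) N <-> isomorphic M N].
  exists (string_module K w); split=> //; first exact: string_module_indecomposable.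
  exact: string_module_pure_injective.
exists (ZgPoint hx); exact: isomorphic_refl.
Qed.

Lemma infinite_point (x : Zg K A) w : modules x (string_module K w) ->
  infinite w -> ~ periodic w -> U x.
Proof.
move=> hx hinf np; split; first by exists w.
move=> M hM /(isomorphic_fd (modules_iso hM hx)).
exact: infinite_not_fd.
Qed.

Definition basic_open (O : Zg K A -> Prop) : Prop :=
  exists (M N : lmodType R) (f : {linear M -> N}),
    [/\ finite_dimensional M, finite_dimensional N & forall x, O x <-> not_factoring f x].

Lemma basic_open_Zg O : basic_open O -> Zg_open O.
Proof.
move=> [M [N [f [fdM fdN h]]]] x /h hx; exists M, N, f; split=> // y hy.
exact/h.
Qed.

Definition splits y v (hv : is_fstring v) (r0 : R) : Prop :=
  forall g : {linear string_module K (String hv) -> string_module K y},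
  exists g1 g2 : {linear string_module K (String hv) -> string_module K y},
    [/\ forall m, g m = g1 m + g2 m,
        exists t, g1 (zvec K (String hv) 0) = r0 *: t &
        g2 (zvec K (String hv) (size v.2)%:Z) = 0].

(** By [split_module], to split is to factor through one fixed morphism; [r0] will be 0
    or an arrow. *)
Lemma splitting_open v (hv : is_fstring v) (r0 : R) : exists2 O, basic_open O &
  forall x y, modules x (string_module K y) -> O x <-> ~ splits y hv r0.
Proof.
have [N [f [fdN hf]]] := split_module (zvec K (String hv) 0)
  (zvec K (String hv) (size v.2)%:Z) r0 (fin_module_fd K hv).
exists (not_factoring f).
  by exists (string_module K (String hv)), N, f; split=> //; exact: fin_module_fd.
move=> x y hx; rewrite (not_factoring_modules f hx); split.
  by move=> [g ng] hs; apply: ng; apply/hf; apply: hs.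
by move=> hs; apply: contrapT => n; apply: hs => g; apply/hf; apply: contrapT => ?;
  apply: n; exists g.
Qed.

(** For [r0 = 0] the morphisms that do not split detect the image occurrences of [v],
    in either direction. *)
Lemma U_image_open v : is_fstring v -> open_in (@U K A) (U_image v).
Proof.
move=> hv; have [O /basic_open_Zg hO hE] := splitting_open hv 0.
exists O => // x; split.
  move=> [hU [y [np [s /image_atE him] hx]]]; split=> //; apply/(hE _ _ hx) => hs.
  have [|g ng] := image_not_split (K := K) hv (r0 := 0) him.
    by move=> t; rewrite scale0r.
  by apply: ng; apply: hs.
move=> [hU Ox]; split=> //; have [[y np hx] _] := hU.
have /existsNP[s /existsNP[f /contrapT him]] : ~ forall s f, ~ image_at v y s f.
  by move=> h; move/(hE _ _ hx): Ox; apply=> g; apply: no_image_split; left.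
case: f him => him.
  by exists y; split=> //; exists s; apply/image_atE.
exists (inverse_string y); split; last exact: string_point_inv.
  move=> /(periodic_inv (word_inv_string (wd_string y))) /=.
  by rewrite word_invK.
exists (- s); apply/(image_atE v (inverse_string y)).
by apply/image_at_inv; rewrite opprK.
Qed.

Lemma initial_image v y s : image_at v y s true -> step y s false = None ->
  lo y = Some s.
Proof.
move=> [pos _ _ _ _] hN.
have npos : ~~ is_pos y (s - 1).
  by apply/negP => h; have [l] := step_some (wd_string y) (e := false) pos h; rewrite hN.
move: pos npos; rewrite /is_pos; case: (lo y) => [l|]; case: (hi y) => [h|] //=;
  try (move=> ? ?; congr Some; lia); lia.
Qed.

Lemma one_sidedE y s : lo y = Some s -> one_sided y <-> hi y = None.
Proof.
move=> hl; rewrite /one_sided /left_infinite /right_infinite hl; split.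
  by case=> [[]|[]].
by move=> ->; left.
Qed.

(** By [step_unique] there is at most one arrow [a] which can precede an image
    occurrence of [v] in any string, because [v] is not empty.  Hence the occurrence is
    initial exactly if the inclusion of [M(v)] is not a sum of a morphism sending the
    first vertex to a multiple of [a] and one killing the last vertex. *)
Lemma U_initial_open_pos v : is_fstring v -> (0 < size v.2)%N ->
  exists2 O, basic_open O & forall x, U_initial v x <-> @U K A x /\ O x.
Proof.
move=> hv v0.
have [l0 hl0] : exists l, onth v.2 0 = Some l.
  exact: onth_some.
pose precedes a := exists (y : string A) s f,
  image_at v y s f /\ step y s (~~ f) = Some (a, true).
have first_ y s f : image_at v y s f -> step y s f = Some l0.
  by move=> [_ _ + _ _] => /(_ 0%N v0); rewrite sh0 hl0.
have uniq a y s f z : precedes a -> image_at v y s f -> step y s (~~ f) = Some z ->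
    z = (a, true).
  move=> [y' [s' [f' [him' ha]]]] him hz.
  apply: (step_unique (wd_string y) (wd_string y') (first_ _ _ _ him) (first_ _ _ _ him') hz ha).
  by case: z hz => b [] // hz; have [_ _ _ /(_ b)] := him.
have [r0 [hr1 hr2]] : exists r0 : R,
  (forall y s f, image_at v y s f -> step y s (~~ f) = None ->
     forall t : string_module K y, coord (r0 *: t) s = 0) /\
  (forall y, (forall s f, image_at v y s f -> step y s (~~ f) <> None) ->
     (forall s f, ~ image_at v y s f) \/
     (exists2 a, r0 = arr K a & forall s f, image_at v y s f -> step y s (~~ f) = Some (a, true))).
  case: (pselect (exists a, precedes a)) => [[a ha]|na].
    exists (arr K a); split=> [y s f him hN t|y h].
      (* a multiple of [a] could have a coefficient at an initial occurrence only if [a]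
         were the first letter of [v], but then it could not precede [v] *)
      rewrite arr_act (bigD1 (~~ f)) //= hN /= add0r big1 // => d.
      have [y' [s' [f' [him' ha']]]] := ha.
      move=> ne; have -> : d = f by case: (d) (f) ne => [] [].
      rewrite (first_ _ _ _ him).
      case: eqP => // -[l0E]; have := step_reduced (wd_string y') (first_ _ _ _ him').
      by rewrite l0E ha'.
    right; exists a => // s f him; have := h s f him.
    by case E: (step y s (~~ f)) => [z|] // _; rewrite (uniq _ _ _ _ _ ha him E).
  exists 0; split=> [y s f him hN t|y h]; first by rewrite scale0r.
  left=> s f him; have := h s f him.
  case E: (step y s (~~ f)) => [[a []]|] // _; last by have [_ _ _ /(_ a)] := him.
  by apply: na; exists a, y, s, f.
have [O hO hE] := splitting_open hv r0; exists O => // x; split.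
  move=> [hU [y [ho [i hl /image_atE him] hx]]]; split=> //; apply/(hE _ _ hx) => hs.
  have hN : step y i (~~ true) = None.
    rewrite /step /= /letter_at; case: ifP => // /andP[]; rewrite /is_pos hl; lia.
  have [g ng] := image_not_split hv him (hr1 _ _ _ him hN).
  by apply: ng; apply: hs.
move=> [hU Ox]; split=> //; have [[y np hx] _] := hU.
have hinf := fd_point_finite hU hx.
have /existsNP[s /existsNP[f /not_implyP[him /contrapT hN]]] :
    ~ forall s f, image_at v y s f -> step y s (~~ f) <> None.
  by move=> /hr2 h; move/(hE _ _ hx): Ox; apply=> g; apply: no_image_split.
have [y' [s' [him' hN' hx' hinf']]] : exists (y' : string A) s', [/\ image_at v y' s' true,
    step y' s' false = None, modules x (string_module K y') & infinite y'].
  case: f him hN => him hN; first by exists y, s.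
  exists (inverse_string y), (- s); split; last 2 first.
  - exact: string_point_inv.
  - exact: (fd_point_finite hU (string_point_inv hx)).
  - by apply/image_at_inv; rewrite opprK.
  - by rewrite -[LHS]/(step (word_inv y) _ _) step_inv opprK.
have hl := initial_image him' hN'; exists y'; split=> //.
  by apply/(one_sidedE hl); case: hinf'; rewrite // hl.
by exists s' => //; apply/image_atE.
Qed.

(** Only finitely many paths are nonzero, so a string cannot run through
    infinitely many inverse letters in a row. *)
Lemma direct_letter_after y s : (forall j, s <= j -> is_pos y j) ->
  exists k : nat, exists a, letter_at y (s + k%:Z) = Some (a, true).
Proof.
move=> hpos; apply: contrapT => hno.
have inv_ (k : nat) : exists a, letter_at y (s + k%:Z) = Some (a, false).
  have p1 : is_pos y (s + k%:Z) by apply: hpos; lia.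
  have p2 : is_pos y (s + k%:Z + 1) by apply: hpos; lia.
  have [l [e _ _]] := str_walk (wd_string y) p1 p2.
  have e' : letter_at y (s + k%:Z) = Some l by rewrite /letter_at p1 p2.
  case: l e e' => a [] _ e'; last by exists a.
  by case: hno; exists k, a.
have long N : exists t, [/\ size t = N, is_path (vert y (s + N%:Z)) t &
    occurs (word_inv y) (- (s + N%:Z)) [seq (a, true) | a <- t]].
  elim: N => [|N [t [st pt ot]]]; first by exists [::].
  have [a ha] := inv_ N; exists (a :: t); have [_ _ e1 e2] := letter_ends (wd_string y) ha.
  have eN : s + N.+1%:Z = s + N%:Z + 1 by lia.
  split; first by rewrite /= st.
    by rewrite /= eN -e2 eqxx /= -[src a]/(left_end (a, false)) e1.
  case=> [|k] hk /=.
    by rewrite letter_at_inv addr0; have -> : - - (s + N.+1%:Z) - 1 = s + N%:Z; [lia|rewrite ha].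
  by rewrite -ot //; congr letter_at; lia.
pose N := (\max_(p <- nz_basis A) size p.2)%N.
have [t [st pt ot]] := long N.+1.
have hin : (vert y (s + N.+1%:Z), t) \in nz_basis A.
  rewrite nz_basisP /nonzero_path; apply/andP; split=> //.
  by apply: (str_nonzero (word_inv_string (wd_string y)) ot); left.
have := @leq_bigmax_seq _ (nz_basis A) predT (fun p => size p.2) _ hin isT.
by rewrite -/N st ltnn.
Qed.

(** A vertex alone does not determine which arrow can precede it.  But a string which
    starts at this vertex with a direct letter also has a longer initial image
    substring, ending before a later direct letter, so [U_initial v] is a union of
    the open sets for nonempty words. *)
Lemma U_initial_open v : is_fstring v -> open_in (@U K A) (U_initial v).
Proof.
move=> hv; case: (posnP (size v.2)) => [v0|v0]; last first.
  have [O /basic_open_Zg hO hE] := U_initial_open_pos hv v0; by exists O.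
pose longer u := [/\ is_fstring u, (0 < size u.2)%N, u.1 = v.1 &
  exists a, ohead u.2 = Some (a, true)].
exists (fun x => exists u O, [/\ longer u, basic_open O,
  forall x, U_initial u x <-> @U K A x /\ O x & O x]).
  move=> x [u [O [hu bO hE Ox]]].
  have [M [N [f [fdM fdN nf hO]]]] := basic_open_Zg bO Ox.
  by exists M, N, f; split=> // z /hO Oz; exists u, O.
have vE : v.2 = [::] by apply: size0nil.
move=> x; split; last first.
  move=> [hU [u [O [[hu u0 uv [a ua]] bO hE Ox]]]]; split=> //.
  have /(hE x)[_ [y [hy [i hl him] hx]]] : U x /\ O x by [].
  exists y; split=> //; exists i => //.
  have [[p1 p2] p3 p4 p5 p6] := him; split; rewrite ?v0 ?vE ?addr0 -?uv //.
  move=> l; have := p4 0%N u0; rewrite addr0 => ->.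
  by case: u.2 ua => //= ? ? [->] [<-].
move=> [hU [y [hy [i hl him] hx]]]; split=> //.
have hh : hi y = None by apply/(one_sidedE hl).
have [[p1 p2] p3 p4 p5 p6] := him; rewrite v0 addr0 in p6.
have pos j : i <= j -> is_pos y j by rewrite /is_pos hl hh andbT.
have [k [a ha]] : exists (k : nat) a, letter_at y (i + 1 + k%:Z) = Some (a, true).
  by apply: direct_letter_after => j hj; apply: pos; lia.
(* the letters up to one that is followed by a direct letter; the default value never
   occurs *)
pose s := [seq odflt (a, true) (letter_at y (i + j%:Z)) | j <- iota 0 k.+1].
have size_s : size s = k.+1 by rewrite size_map size_iota.
have occ : occurs y i s.
  move=> j; rewrite size_s => hj; rewrite /s onthE -map_comp (nth_map 0%N) ?size_iota //.
  rewrite nth_iota // add0n /=.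
  have q1 : is_pos y (i + j%:Z) by apply: pos; lia.
  have q2 : is_pos y (i + j%:Z + 1) by apply: pos; lia.
  have [l [e _ _]] := str_walk (wd_string y) q1 q2.
  by rewrite /letter_at q1 q2 e.
clearbody s; have hu : is_fstring (vert y i, s).
  by apply: (substring_string (wd_string y)); rewrite ?size_s //; apply: pos; lia.
have u0 : (0 < size (vert y i, s).2)%N by rewrite /= size_s.
have [O bO hE] := U_initial_open_pos hu u0.
have l0 : letter_at y i = ohead s.
  by have := occ 0%N u0; rewrite addr0 => ->; case: (s).
exists (vert y i, s), O; split=> //.
  split=> //=.
  case El: (ohead s) l0 => [[b d]|] hb; last by move: El size_s; case: (s).
  by have := p6 _ hb; rewrite /is_direct /= => ->; exists b.
have /(hE x)[] // : U_initial (vert y i, s) x.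
split=> //; exists y; split=> //; exists i => //; split=> //=.
  by rewrite size_s; split=> //; apply: pos; lia.
rewrite size_s; have -> : i + k.+1%:Z = i + 1 + k%:Z by lia.
by rewrite ha => l [<-].
Qed.

Lemma image_substring_vert y v s k : image_substring_at y s v -> (k <= size v.2)%N ->
  is_pos y (s + k%:Z) /\ vert y (s + k%:Z) = walk_vert v.1 (fin_lett v) k%:Z.
Proof.
move=> [[p1 _] p2 p3 _ _]; case: k => [|k] hk; first by rewrite addr0.
have [l hl] : exists l, onth v.2 k = Some l. by apply: onth_some.
have := p3 k hk; rewrite hl => /(letter_ends (wd_string y))[_ + _].
have -> : s + k%:Z + 1 = s + k.+1%:Z by lia.
move=> -> <-; split=> //; have e1 : k.+1%:Z - 1 = k%:Z by lia.
by rewrite /walk_vert e1 /= hl.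
Qed.

Lemma open_window (V : Zg K A -> Prop) x w : (forall e, tame_side w e) ->
  modules x (string_module K w) -> open_in (@U K A) V -> V x ->
  exists m : nat, forall z y s, @U K A z -> modules z (string_module K y) ->
    (forall i, (absz i <= m)%N -> is_pos y (i + s) = is_pos w i) ->
    (forall i, (absz i <= m)%N -> is_pos w i -> vert y (i + s) = vert w i) ->
    (forall i, (absz i <= m.+1)%N -> letter_at y (i + s) = letter_at w i) -> V z.
Proof.
move=> ht hx [O hO VE] /VE[_ /hO[M [N [f [fdM fdN nf sub]]]]].
have [g ng] := (not_factoring_modules f hx).1 nf.
have [m hm] := not_factoring_nearby fdM fdN ht ng.
exists m => z y s hU hz h1 h2 h3; apply/VE; split=> //; apply: sub.
apply/(not_factoring_modules f hz); apply: (hm y s h1 h2) => i d hi.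
rewrite /step; case: d; first by rewrite h3 //; lia.
have -> : i + s - 1 = i - 1 + s by lia.
by rewrite h3 //; lia.
Qed.

Lemma image_window w y v s s' i : image_substring_at w s v -> image_substring_at y s' v ->
  s <= i <= s + (size v.2)%:Z ->
  [/\ is_pos y (i + (s' - s)), is_pos w i, vert y (i + (s' - s)) = vert w i &
      i < s + (size v.2)%:Z -> letter_at y (i + (s' - s)) = letter_at w i].
Proof.
move=> hw hy hi; have [k kn ->] : exists2 k : nat, (k <= size v.2)%N & i = s + k%:Z.
  by exists (absz (i - s)); lia.
have -> : s + k%:Z + (s' - s) = s' + k%:Z by lia.
have [-> ->] := image_substring_vert hw kn; have [-> ->] := image_substring_vert hy kn.
split=> // hk; have [_ _ o1 _ _] := hw; have [_ _ o2 _ _] := hy.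
by rewrite o1 ?o2 //; lia.
Qed.

End Neighbourhoods.

(** * Bases of neighbourhoods *)

Section Basis.
Variables (K : fieldType) (A : string_algebra).
Implicit Types (b c : fword A).

Lemma bi_word_inv_right b0 c b (k : nat) :
  lett (word_inv (bi_word b0 c b)) (0 + k%:Z) = onth (letters_inv b0.2) (k %% size (letters_inv b0.2))%N.
Proof.
rewrite add0r /=; have -> : - k%:Z - 1 = Negz k by lia.
rewrite /= /letters_inv size_rev size_map -map_rev onth_map //.
Qed.

Lemma bi_word_tame b0 c b : is_string (bi_word b0 c b) -> is_band b0 -> is_band b ->
  aperiodic (bi_word b0 c b) -> forall e, tame_side (bi_word b0 c b) e.
Proof.
move=> hw hb0 hb hap [].
  apply: (tame_side_periodic (p := (size c.2)%:Z) hw _ hap (band_pos hb)) => // k.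
  exact: tail_lett_periodic.
apply: (tame_side_inv (e := true)).
apply: (@tame_side_periodic _ _ (b0.1, letters_inv b0.2) 0) => //.
- exact: word_inv_string.
- exact: aperiodic_inv.
- by rewrite /= size_rev size_map (band_pos hb0).
- by move=> k; apply: bi_word_inv_right.
Qed.

Lemma right_word_tame c b : is_string (right_word c b) -> is_band b ->
  forall e, tame_side (right_word c b) e.
Proof.
move=> hw hb []; last by constructor 1; exists (-1) => i /= hi; rewrite /is_pos /=; lia.
apply: (tame_side_periodic (p := (size c.2)%:Z) hw _ _ (band_pos hb)) => // [|k].
  exact: (one_sided_aperiodic (l := 0) hw).
exact: tail_lett_periodic.
Qed.

(** Every window of the string lies inside of [b0^n c b^n] for large [n], so that the
    strings containing this word share the window. *)
Lemma bi_word_basis b0 c b (hw : is_string (bi_word b0 c b)) :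
  is_band b0 -> is_band b -> ~ periodic (bi_word b0 c b) ->
  exists x : Zg K A, modules x (string_module K (String hw)) /\
    open_nbhs_basis_in (@U K A) x
      (fun n => @U_image K A (fcat (fcat (fpow b0 n) c) (fpow b n))).
Proof.
move=> hb0 hb np; pose w := String hw.
have hap : aperiodic w.
  by apply: (two_sided_aperiodic (p := (size c.2)%:Z) _ _ hb) => // k; apply: tail_lett_periodic.
have ht e : tame_side w e := bi_word_tame hw hb0 hb hap e.
have hinf : infinite w by left.
have [x hx] := string_pointP K hinf hap ht; exists x; split=> //; split=> [n|V hV Vx].
  have him := bi_word_image n hw hb0 hb; split.
    have [[p1 p2] p3 p4 _ _] := him; apply: U_image_open; rewrite /is_fstring.
    have := substring_string hw p1 p2 p4; rewrite p3 /=.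
    by [].
  split; first exact: infinite_point hx hinf np.
  by exists w; split=> //; exists (- (n * size b0.2)%N%:Z).
have [m hm] := open_window ht hx hV Vx; exists m.+2 => z [hU [y [_ [s hs] hz]]].
have := bi_word_image m.+2 hw hb0 hb; set v := fcat _ _ in hs *; set s0 := - _ => him.
have L0 := band_pos hb0; have L1 := band_pos hb.
have win i : (absz i <= m.+1)%N -> [/\ is_pos y (i + (s - s0)), is_pos w i,
    vert y (i + (s - s0)) = vert w i & letter_at y (i + (s - s0)) = letter_at w i].
  move=> hi; have inside : s0 <= i < s0 + (size v.2)%:Z.
    have -> : size v.2 = (m.+2 * size b0.2 + size c.2 + m.+2 * size b.2)%N.
      by rewrite /= !size_cat !size_flatten_nseq.
    rewrite /s0.
    have h0 : (m.+2 <= m.+2 * size b0.2)%N by rewrite leq_pmulr.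
    have h1 : (m.+2 <= m.+2 * size b.2)%N by rewrite leq_pmulr.
    by move: (m.+2 * size b0.2)%N (m.+2 * size b.2)%N (size c.2) h0 h1 => p q r; lia.
  have [|? ? ? hl] := @image_window _ w y v s0 s i him hs; first by lia.
  by split=> //; apply: hl; lia.
apply: (hm z y (s - s0) hU hz) => i hi; last by have [] := win i hi.
  by have [|-> -> _ _] := win i _; first by lia.
by have [|_ _ -> _] := win i _; first by lia.
Qed.

(** As for two-sided strings, except that the window reaches beyond the end of the
    string; that an occurrence is initial makes the ends agree. *)
Lemma right_word_basis c b (hw : is_string (right_word c b)) : is_band b ->
  exists x : Zg K A, modules x (string_module K (String hw)) /\
    open_nbhs_basis_in (@U K A) x (fun n => @U_initial K A (fcat c (fpow b n))).
Proof.
move=> hb; pose w := String hw.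
have hap : aperiodic w by apply: (one_sided_aperiodic (l := 0) hw).
have ht e : tame_side w e := right_word_tame hw hb e.
have hinf : infinite w by right.
have [x hx] := string_pointP K hinf hap ht; exists x; split=> //; split=> [n|V hV Vx].
  have him := right_word_image n hw hb; split.
    have [[p1 p2] _ p4 _ _] := him; apply: U_initial_open.
    exact: (substring_string hw p1 p2 p4).
  split; first by apply: infinite_point hx hinf _ => -[].
  by exists w; split; [left|exists 0|].
have [m hm] := open_window ht hx hV Vx; exists m.+2 => z [hU [y [ho [s hl hs] hz]]].
have := right_word_image m.+2 hw hb; set v := fcat _ _ in hs * => him.
have hh : hi y = None by apply/(one_sidedE hl).
have sv : (m.+2 <= size v.2)%N.
  have -> : size v.2 = (size c.2 + m.+2 * size b.2)%N.
    by rewrite /= !size_cat !size_flatten_nseq.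
  apply: leq_trans (leq_addl _ _).
  by rewrite leq_pmulr // band_pos.
have pos i : is_pos y (i + s) = is_pos w i.
  by rewrite /is_pos hl hh /= !andbT; lia.
have win i : (absz i <= m.+1)%N -> 0 <= i ->
    vert y (i + s) = vert w i /\ letter_at y (i + s) = letter_at w i.
  move=> hi i0; have := @image_window _ w y v 0 s i him hs.
  by rewrite subr0 => -[|_ _ ? hlt]; [lia|split=> //; apply: hlt; lia].
have wpos i : is_pos w i = (0 <= i) by rewrite /is_pos /= andbT.
apply: (hm z y s hU hz) => i hi; first exact: pos.
  by rewrite wpos => i0; have [] := win i _ i0; first by lia.
case: (lerP 0 i) => i0; first by have [] := win i hi i0.
have ni : ~~ is_pos w i by rewrite wpos; lia.
by rewrite !letter_at_None // ?pos (negPf ni).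
Qed.

End Basis.

Theorem corollary10p3 (K : closedFieldType) (A : string_algebra)
    (hA : domestic A) :
  (forall (b0 c b : fword A) (hw : is_string (bi_word b0 c b)),
     is_band b0 -> is_band b -> is_fstring c -> ~ periodic (bi_word b0 c b) ->
     exists x : Zg K A, modules x (string_module K (String hw)) /\
       open_nbhs_basis_in (@U K A) x
         (fun n => @U_image K A (fcat (fcat (fpow b0 n) c) (fpow b n)))) /\
  (forall (c b : fword A) (hw : is_string (right_word c b)),
     is_band b -> is_fstring c ->
     exists x : Zg K A, modules x (string_module K (String hw)) /\
       open_nbhs_basis_in (@U K A) x
         (fun n => @U_initial K A (fcat c (fpow b n)))).
Proof.
split=> [b0 c b hw hb0 hb _ np|c b hw hb _]; first exact: bi_word_basis.
exact: right_word_basis.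
Qed.
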